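(* Let $f_0:\Lambda\to\mathbb{R}^d$ and $f:\mathbb{R}^d\times\Lambda\times\mathbb{R}\to\mathbb{R}^d$, $f=f(x,y,\epsilon)$, be locally Lipschitz in $x$ and $y$, and assume that $\lim_{\epsilon\to0}f(x,y,\epsilon)=f(x,y,0)$ uniformly on compact subsets of $\mathbb{R}^d\times\Lambda$. Assume that $\int_\Lambda f_0\,d\mu=0$ and that the weak invariance principle (WIP) holds for $f_0$ on $\Lambda$, with covariance matrix $\Sigma$. Fix $\xi\in\mathbb{R}^d$ and, for $\epsilon>0$, let $x^{(\epsilon)}(n)\in\mathbb{R}^d$, $n\ge0$, be defined by \[ x^{(\epsilon)}(n+1)=x^{(\epsilon)}(n)+\epsilon f_0(y(n))+\epsilon^2 f(x^{(\epsilon)}(n),y(n),\epsilon),\qquad x^{(\epsilon)}(0)=\xi . \] Define $\hat x^{(\epsilon)}(t)=x^{(\epsilon)}(t\epsilon^{-2})$ for $t=0,\epsilon^2,2\epsilon^2,\ldots$ and linearly interpolate to obtain $\hat x^{(\epsilon)}\in C([0,\infty),\mathbb{R}^d)$. Set $F(x)=\int_\Lambda f(x,y,0)\,d\mu(y)$ and suppose that solutions $X$ to the SDE \[ dX=\sqrt\Sigma\,dW+F(X)\,dt,\qquad X(0)=\xi, \] where $W$ is unit $d$-dimensional Brownian motion, exist on $[0,\infty)$ with probability one. Then $\hat x^{(\epsilon)}\to_w X$ in $C([0,\infty),\mathbb{R}^d)$ as $\epsilon\to0$.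
   Context: Fast dynamics: $\Lambda\subset\mathbb{R}^\ell$ is compact, $g:\Lambda\to\Lambda$ is a map, and $\mu$ is an ergodic $g$-invariant probability measure supported on $\Lambda$. Given $y(0)=\eta\in\Lambda$, the fast variables are $y(n+1)=g(y(n))$, $n\ge0$. The only source of randomness is the initial condition $\eta$, distributed according to $\mu$; thus $x^{(\epsilon)}$ and $\hat x^{(\epsilon)}$ are random elements on the probability space $(\Lambda,\mu)$. WIP: for $f_0:\Lambda\to\mathbb{R}^d$ Lipschitz with $\int_\Lambda f_0\,d\mu=0$, define $W_n(t)=n^{-1/2}\sum_{j=0}^{nt-1}f_0(y(j))$ for $t=0,\frac1n,\frac2n,\ldots$ and linearly interpolate to obtain $W_n\in C([0,\infty),\mathbb{R}^d)$. The WIP is the assumption that $W_n\to_w\sqrt\Sigma\,W$ in $C([0,\infty),\mathbb{R}^d)$, where $W$ is unit $d$-dimensional Brownian motion and $\Sigma$ is a $d\times d$ covariance matrix. The symbol $\to_w$ denotes weak convergence in the sense of probability measures; $C([0,\infty),\mathbb{R}^d)$ carries the topology of uniform convergence on compact sets. *)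

(* Defs.v *)
From HB Require Import structures.
From mathcomp Require Import all_boot all_order all_algebra.
From mathcomp Require Import all_classical all_reals all_analysis.

Set Implicit Arguments.
Unset Strict Implicit.
Unset Printing Implicit Defensive.

Import Order.TTheory GRing.Theory Num.Theory.
Import numFieldNormedType.Exports.

Local Open Scope classical_set_scope.
Local Open Scope ring_scope.

(* R^m is 'cV[R]_m; the library puts the max norm on it, which is equivalent
   to the Euclidean one. *)

Notation borel T := (g_sigma_algebraType (@open T)).

Definition vintegral (R : realType) (dT : measure_display)
    (T : measurableType dT) (mu : {measure set T -> \bar R}) (d : nat)
    (D : set T) (f : T -> 'cV[R]_d) : 'cV[R]_d :=
  \col_i \int[mu]_(x in D) f x i ord0.

Section matrices.
Variables (R : realType) (d : nat).
Implicit Types S : 'M[R]_d.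

(* These matrices are exactly the covariance matrices. *)
Definition sym_psd S : Prop :=
  S^T = S /\ forall v : 'cV[R]_d, 0 <= (v^T *m S *m v) ord0 ord0.

(* The unique symmetric positive semidefinite square root when S is
   itself symmetric positive semidefinite; 0 for an S without such a root. *)
Definition mxsqrt S : 'M[R]_d :=
  xget 0 [set Q : 'M[R]_d | sym_psd Q /\ Q *m Q = S].

End matrices.

(* C([0,oo), R^d) is represented by the subset Cpath of the functions R -> R^d,
   with uniform convergence on the compact subsets of [0,oo). The topology
   ignores the values at negative arguments, so a function on Cpath that is
   continuous for it depends only on the restriction of a path to [0,oo). *)
Notation path_space R d :=
  {family compactly_in (`[0%R, +oo[%classic : set R), R -> 'cV[R]_d}.

Definition Cpath (R : realType) (d : nat) : set (path_space R d) :=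
  [set w | {within `[0, +oo[, continuous (w : R -> 'cV[R]_d)}].
Arguments Cpath R d : clear implicits.

(* The X i are C-valued random elements on the probability space (D, mu),
   where mu D = 1; Y is one on (O, P). *)
Definition weak_cvg (R : realType) (S : topologicalType) (C : set S)
    (I : Type) (F : set_system I)
    (dT : measure_display) (T : measurableType dT) (mu : probability T R)
    (D : set T) (X : I -> T -> S)
    (dO : measure_display) (O : measurableType dO) (P : probability O R)
    (Y : O -> S) : Prop :=
  forall phi : S -> R, {within C, continuous phi} ->
    [bounded phi x | x in C] ->
    (fun i => \int[mu]_(w in D) phi (X i w)) @ F --> \int[P]_w phi (Y w).

(* Linear interpolation of u : at 0, 1, 2, ..., for s >= 0. *)
Definition interpolate (R : realType) (V : lmodType R) (u : nat -> V) (s : R)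
    : V :=
  let n := Num.truncn s in u n + (s - n%:R) *: (u n.+1 - u n).

Section processes.
Variables (R : realType) (dO : measure_display) (O : measurableType dO).
Variable P : probability O R.

(* Taking A i = setT removes i from the family, so the product rule over the
   whole finite family implies it for every subfamily. *)
Definition mutually_independent (I : finType) (X : I -> O -> R) : Prop :=
  forall A : I -> set R, (forall i, measurable (A i)) ->
    P (\bigcap_i (X i @^-1` A i)) = (\prod_i P (X i @^-1` A i))%E.

(* Measurability of the evaluations is Borel measurability of X as a map into
   C([0,oo), R^d), whose Borel sets are generated by the evaluations. *)
Definition random_path (d : nat) (X : O -> path_space R d) : Prop :=
  (forall w, Cpath R d (X w)) /\
  (forall t, 0 <= t -> forall i, measurable_fun setT (fun w => X w t i ord0)).

Definition brownian_motion (d : nat) (W : O -> path_space R d) : Prop :=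
  [/\ random_path W,
      \forall w \ae P, W w 0 = 0,
      forall s t i (A : set R), 0 <= s -> s < t -> measurable A ->
        P [set w | A (W w t i ord0 - W w s i ord0)] =
          normal_prob 0 (Num.sqrt (t - s)) A
    & forall (n : nat) (t : nat -> R),
        0 <= t 0%N -> (forall k, t k < t k.+1) ->
        mutually_independent (fun (ki : 'I_n * 'I_d) w =>
          W w (t ki.1.+1) ki.2 ord0 - W w (t ki.1) ki.2 ord0)].

(* dX = Q dW + F(X) dt, X(0) = xi on [0,oo). As Q is constant, its stochastic
   integral is Q W(t), so that the equation can be read path by path. *)
Definition sde_solution (d : nat) (Q : 'M[R]_d) (F : 'cV[R]_d -> 'cV[R]_d)
    (xi : 'cV[R]_d) (W X : O -> path_space R d) : Prop :=
  random_path X /\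
  \forall w \ae P, forall t, 0 <= t ->
    X w t = xi + Q *m W w t
            + vintegral lebesgue_measure `[0, t] (fun s => F (X w s)).

End processes.

Section fast_slow.
Variables (R : realType) (l d : nat).
Local Notation B := (borel 'cV[R]_l).
Implicit Types (L : set 'cV[R]_l) (g : 'cV[R]_l -> 'cV[R]_l).
Implicit Types (mu : probability B R).
Implicit Types (f : 'cV[R]_d -> 'cV[R]_l -> R -> 'cV[R]_d).

(* g : L -> L and f0 are given by total functions, of which only the values on
   L matter; mu is a Borel measure on R^l with mu L = 1. Invariance and
   ergodicity are those of g : L -> L, whose preimage of A is L `&` g @^-1` A. *)
Definition ergodic_system L g mu : Prop :=
  [/\ mu (L : set B) = 1%E,
      forall y, L y -> L (g y),
      measurable_fun (L : set B) (g : B -> B),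
      forall A : set B, measurable A -> A `<=` L ->
        mu (L `&` g @^-1` A) = mu A
    & forall A : set B, measurable A -> A `<=` L ->
        L `&` g @^-1` A = A -> mu A = 0%E \/ mu A = 1%E].

Definition birkhoff_sum g (f0 : 'cV[R]_l -> 'cV[R]_d)
    (eta : 'cV[R]_l) (n : nat) : 'cV[R]_d :=
  \sum_(j < n) f0 (iter j g eta).

Definition wip_path g (f0 : 'cV[R]_l -> 'cV[R]_d) (n : nat)
    (eta : 'cV[R]_l) : path_space R d :=
  fun t => (Num.sqrt n%:R)^-1 *: interpolate (birkhoff_sum g f0 eta) (n%:R * t).

Definition WIP L g mu (f0 : 'cV[R]_l -> 'cV[R]_d)
    (Sigma : 'M[R]_d) : Prop :=
  exists (dO : measure_display) (O : measurableType dO) (P : probability O R)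
    (W : O -> path_space R d),
    brownian_motion P W /\
    weak_cvg (Cpath R d) \oo mu (L : set B) (wip_path g f0) P
      (fun w t => mxsqrt Sigma *m W w t).

Fixpoint slow g (f0 : 'cV[R]_l -> 'cV[R]_d) f (xi : 'cV[R]_d) (e : R)
    (eta : 'cV[R]_l) (n : nat) : 'cV[R]_d :=
  if n is m.+1 then
    slow g f0 f xi e eta m + e *: f0 (iter m g eta)
    + e ^+ 2 *: f (slow g f0 f xi e eta m) (iter m g eta) e
  else xi.

Definition slow_path g (f0 : 'cV[R]_l -> 'cV[R]_d) f (xi : 'cV[R]_d) (e : R)
    (eta : 'cV[R]_l) : path_space R d :=
  fun t => interpolate (slow g f0 f xi e eta) (t * e ^- 2).

Definition averaged_drift L mu f (x : 'cV[R]_d) : 'cV[R]_d :=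
  vintegral mu (L : set B) (fun y => f x y 0).

End fast_slow.

(* Main.v *)
Require Import Defs.
From mathcomp Require Import all_boot all_order all_algebra.
From mathcomp Require Import all_classical all_reals all_analysis.
From mathcomp Require Import measurable_realfun.
From mathcomp Require Import ring lra.

Set Implicit Arguments.
Unset Strict Implicit.
Unset Printing Implicit Defensive.

Import Order.TTheory GRing.Theory Num.Theory.
Import numFieldNormedType.Exports.

Local Open Scope classical_set_scope.
Local Open Scope ring_scope.

(** Weak convergence on C([0, oo), R^d) is tested on the bounded functionals that
    are Lipschitz for the supremum norm over a bounded time interval
    ([portmanteau]; arbitrary bounded continuous functionals are squeezed between
    Lipschitz envelopes), and along positive sequences [eps k] that tend to 0.

    With [w] the path of the normalised Birkhoff sums of [f0], the slow variables
    satisfy, up to small errors, [x(t) = xi + w(t) + \int_0^t F(x(s)) ds]: on a time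
    interval that is short, but much longer than one step of the fast variables,
    the slow variable is nearly constant and the drift averages to [F] by the
    ergodic theorem ([birkhoff], made uniform in the slow variable in
    [uniform_birkhoff]).  For fixed [w] this equation is a pathwise one, and its
    solution would be a continuous function of [w] if [F] were globally Lipschitz;
    the invariance principle and the continuous mapping principle would conclude.

    The solution map is handled through its Euler schemes.  The Euler path with a
    step [h = 1 / (m + 1)] and a truncated drift is a Lipschitz function of [w]
    ([euler_path_lip]).  The slow path is within a constant times [osc(w, h) + h]
    of it as long as the Euler path stays well inside the truncation radius [r]
    ([slow_euler], [slow_close]); and the Euler paths driven by [sqrt Sigma W]
    converge to the solution X of the limiting equation, as long as X stays inside
    that radius ([sde_euler_cvg]).  The error is therefore bounded by a functional
    of [w] that is itself bounded and Lipschitz ([error_bound]), to which the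
    invariance principle applies ([slow_error], [limit_error]).  It remains to let
    [k], then [m], then [r] go to infinity; the last limit is where the global
    existence of X is used, since a path of X is bounded on every bounded time
    interval.

    The Brownian motion in the invariance principle and the one that drives the
    limiting equation may live on different spaces; [brownian_eq_law] identifies
    their laws. *)

(** * Bounded measurable functions *)

Section bounded_measurable.
Context d (T : measurableType d) (R : realType) (mu : probability T R).
Variables (D : set T) (mD : measurable D).
Implicit Types f g h : T -> R.

(** Measurable and bounded on [D]; the class of integrands of the proof. *)
Definition bmeas f :=
  measurable_fun D f /\ exists B : R, forall x, D x -> `|f x| <= B.

Lemma bmeas_integrable f : bmeas f -> mu.-integrable D (EFin \o f).
Proof.
move=> [mf [B fB]]; apply: measurable_bounded_integrable => //.
  by apply: le_lt_trans (ltry 1); exact: probability_le1.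
exists B; split; first exact: num_real.
by move=> M BM x Dx; apply: (le_trans (fB x Dx)); exact: ltW.
Qed.

Lemma bmeas_cst c : bmeas (fun=> c).
Proof. by split => //; exists `|c|. Qed.

Lemma bmeasD f g : bmeas f -> bmeas g -> bmeas (fun x => f x + g x).
Proof.
move=> [mf [B fB]] [mg [C gC]]; split; first exact: measurable_funD.
exists (B + C) => x Dx.
by rewrite (le_trans (ler_normD _ _))// lerD// ?fB ?gC.
Qed.

Lemma bmeasZ c f : bmeas f -> bmeas (fun x => c * f x).
Proof.
move=> [mf [B fB]]; split; first exact: measurable_funM.
by exists (`|c| * B) => x Dx; rewrite normrM ler_wpM2l// fB.
Qed.

Lemma bmeasB f g : bmeas f -> bmeas g -> bmeas (fun x => f x - g x).
Proof.
move=> bf bg; have := bmeasD bf (bmeasZ (-1) bg).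
by under eq_fun do rewrite mulN1r.
Qed.

Lemma bmeas_norm f : bmeas f -> bmeas (fun x => `|f x|).
Proof.
move=> [mf [B fB]]; split; first exact: measurableT_comp.
by exists B => x Dx; rewrite normr_id fB.
Qed.

Lemma bmeas_max f g : bmeas f -> bmeas g -> bmeas (fun x => Num.max (f x) (g x)).
Proof.
move=> [mf [B fB]] [mg [C gC]]; split; first exact: measurable_maxr.
exists (Num.max B C) => x Dx; rewrite le_max.
by case: (leP (f x) (g x)) => _; rewrite ?fB ?gC// orbT.
Qed.

Lemma le_Rintegral_bmeas f g : bmeas f -> bmeas g ->
  (forall x, D x -> f x <= g x) ->
  \int[mu]_(x in D) f x <= \int[mu]_(x in D) g x.
Proof. by move=> bf bg fg; apply: le_Rintegral => //; exact: bmeas_integrable. Qed.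

Lemma Rintegral_dist_le f g h : bmeas f -> bmeas g -> bmeas h ->
  (forall x, D x -> `|f x - g x| <= h x) ->
  `|\int[mu]_(x in D) f x - \int[mu]_(x in D) g x| <= \int[mu]_(x in D) h x.
Proof.
move=> bf bg bh fgh; rewrite -RintegralB//; try exact: bmeas_integrable.
apply: le_trans (le_normr_Rintegral _ _) _ => //.
  by apply: bmeas_integrable; exact: bmeasB.
by apply: le_Rintegral_bmeas => //; apply: bmeas_norm; exact: bmeasB.
Qed.

Lemma bounded_cvg (f_ : nat -> T -> R) f B :
  (forall n, measurable_fun D (f_ n)) -> measurable_fun D f ->
  (forall n x, D x -> `|f_ n x| <= B) ->
  {ae mu, forall x, D x -> f_ ^~ x @ \oo --> f x} ->
  (fun n => \int[mu]_(x in D) f_ n x) @ \oo --> \int[mu]_(x in D) f x.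
Proof.
move=> mf_ mf fB f_f.
have [] := @dominated_convergence _ _ _ mu D mD
  (fun n => EFin \o f_ n) (EFin \o f) (EFin \o cst B).
- by move=> n; exact/measurable_EFinP.
- exact/measurable_EFinP.
- by apply: filterS f_f => x + Dx => /(_ Dx) fx; apply: cvg_EFin => //; exact: nearW.
- exact/bmeas_integrable/bmeas_cst.
- by apply: aeW => x n Dx; rewrite /= lee_fin fB.
move=> fint _ fcvg; apply: fine_cvg; rewrite fineK; first exact: fcvg.
exact: integrable_fin_num.
Qed.

Lemma Rintegral_prob_cst c : mu D = 1%E -> \int[mu]_(x in D) c = c.
Proof. by move=> D1; rewrite Rintegral_cst// (congr1 fine D1) mulr1. Qed.

End bounded_measurable.

(** * The pointwise ergodic theorem *)

Section ergodic.
Context d (T : measurableType d) (R : realType) (mu : probability T R).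
Variables (D : set T) (mD : measurable D) (g : T -> T).
Hypothesis gD : forall x, D x -> D (g x).
Hypothesis mg : measurable_fun D g.
Implicit Types h : T -> R.

(** Birkhoff sums of the observable [h] along the orbit of [x]. *)
Definition orbit_sum h n x : R := \sum_(j < n) h (iter j g x).

Lemma orbit_sumS h n x : orbit_sum h n.+1 x = h x + orbit_sum h n (g x).
Proof.
rewrite /orbit_sum big_ord_recl; congr (_ + _).
by apply: eq_bigr => j _; rewrite /bump /= -iterSr.
Qed.

Lemma iter_stable j x : D x -> D (iter j g x).
Proof. by move=> Dx; elim: j => //= j; exact: gD. Qed.

Lemma bmeas_comp h : bmeas D h -> bmeas D (h \o g).
Proof.
move=> [mh [B hB]]; split; last by exists B => x /gD; exact: hB.
by apply: (measurable_comp mD) mh mg => _ [x Dx <-]; exact: gD.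
Qed.

Lemma bmeas_orbit_sum h n : bmeas D h -> bmeas D (orbit_sum h n).
Proof.
move=> bh; elim: n => [|n IH].
  rewrite (_ : orbit_sum h 0 = fun=> 0); first exact: bmeas_cst.
  by apply/funext => x; rewrite /orbit_sum big_ord0.
rewrite (_ : orbit_sum h n.+1 = fun x => h x + (orbit_sum h n \o g) x).
  by apply: bmeasD => //; exact: bmeas_comp.
by apply/funext => x; rewrite orbit_sumS.
Qed.

Hypothesis gmu : forall A, measurable A -> A `<=` D -> mu (D `&` g @^-1` A) = mu A.

Lemma Rintegral_invariant h : bmeas D h ->
  \int[mu]_(x in D) h (g x) = \int[mu]_(x in D) h x.
Proof.
(* [g] is only known to be measurable on [D]: push forward along its extension
   by the identity. *)
move=> bh; pose g' x := if x \in D then g x else x.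
have g'D : g' @^-1` D = D.
  apply/seteqP; split=> x; rewrite /preimage/= /g'; case: ifPn => xD.
  - by move=> _; exact/set_mem.
  - by [].
  - by move/gD.
  - by move=> /mem_set; rewrite (negbTE xD).
have mg' : measurable_fun setT g'.
  apply: measurable_fun_if => //.
  - apply: (@measurable_fun_bool _ _ _ _ true).
    rewrite setTI (_ : _ @^-1` _ = D)//.
    by apply/seteqP; split=> x /=; [exact: set_mem|exact: mem_set].
  - rewrite setTI (_ : _ @^-1` _ = D)//.
    by apply/seteqP; split=> x /=; [exact: set_mem|exact: mem_set].
pose h' := h \_ D.
have mh' : measurable_fun setT h' by case: bh => mh _; exact: (measurable_restrictT h mD).1 mh.
have E1 x : x \in D -> h' x = h x by move=> xD; rewrite /h' /patch xD.
have E2 x : x \in D -> h' (g' x) = h (g x).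
  move=> xD; rewrite /h' /patch /g' xD.
  by rewrite mem_set//; exact/gD/set_mem.
transitivity (\int[mu]_(x in D) h' (g' x)).
  by apply: eq_Rintegral => x xD; rewrite E2.
transitivity (\int[mu]_(x in D) h' x); last first.
  by apply: eq_Rintegral => x xD; rewrite E1.
rewrite /Rintegral; congr fine.
have := @integral_pushforward _ _ _ _ _ g' mg' mu D (EFin \o h').
rewrite g'D => <-//.
- apply: eq_measure_integral => A mA AD.
  transitivity (mu (g' @^-1` A)) => //.
  rewrite (_ : g' @^-1` A = D `&` g @^-1` A); first exact: gmu.
  apply/seteqP; split => x; rewrite /preimage/= /g'.
    by case: ifPn => [/set_mem//|+ /AD/mem_set xD]; rewrite xD.
  by move=> [Dx]; rewrite mem_set.
- exact/measurable_EFinP.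
- apply: (@bmeas_integrable _ _ _ _ _ mD (h' \o g')); split.
    exact/measurable_funTS/measurableT_comp.
  have [_ [B hB]] := bmeas_comp bh; exists B => x Dx.
  by rewrite /= E2 ?mem_set//; exact: hB.
Qed.

(** The running maximum of the orbit sums, [max_(0 <= k <= n) orbit_sum h k]. *)
Fixpoint max_orbit_sum h n x : R :=
  if n is m.+1 then Num.max 0 (h x + max_orbit_sum h m (g x)) else 0.

Lemma max_orbit_sum_ge0 h n x : 0 <= max_orbit_sum h n x.
Proof. by case: n => //= n; rewrite le_max lexx. Qed.

Lemma max_orbit_sum_nd h n x : max_orbit_sum h n x <= max_orbit_sum h n.+1 x.
Proof.
elim: n x => [|n IH] x; first exact: max_orbit_sum_ge0.
rewrite [leLHS]/= [leRHS]/= ge_max !le_max lexx /=.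
by apply/orP; right; rewrite lerD2l.
Qed.

Lemma max_orbit_sum_ub h k n x : (k <= n)%N -> orbit_sum h k x <= max_orbit_sum h n x.
Proof.
elim: n k x => [|n IH] [|k] x //; rewrite ?ltnS => kn.
- by rewrite /orbit_sum big_ord0.
- by rewrite /orbit_sum big_ord0 max_orbit_sum_ge0.
- by rewrite orbit_sumS /= le_max lerD2l IH// orbT.
Qed.

Lemma bmeas_max_orbit_sum h n : bmeas D h -> bmeas D (max_orbit_sum h n).
Proof.
move=> bh; elim: n => [|n IH] /=; first exact: bmeas_cst.
by apply: bmeas_max; [exact: bmeas_cst|apply: bmeasD => //; exact: bmeas_comp IH].
Qed.

(** The maximal ergodic theorem, by Garsia's argument: where the running maximum
    [M] is positive, [h >= M - M \o g], and the right-hand side integrates to 0. *)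
Lemma maximal_ergodic h : bmeas D h ->
  {ae mu, forall x, D x -> exists n, 0 < orbit_sum h n x} ->
  0 <= \int[mu]_(x in D) h x.
Proof.
move=> bh hpos.
pose A n := D `&` [set x | 0 < max_orbit_sum h n.+1 x].
have mA n : measurable (A n).
  have [mM _] := bmeas_max_orbit_sum n.+1 bh.
  rewrite (_ : A n = D `&` max_orbit_sum h n.+1 @^-1` `]0, +oo[%classic).
    exact: mM.
  by apply/seteqP; split => x [Dx] /=; rewrite in_itv/= andbT.
have mhA n : measurable_fun D (fun x => h x * \1_(A n) x).
  by apply: measurable_funM; [case: bh|exact: measurable_indic].
have [_ [B hB]] := bh.
have hAB n x : D x -> `|h x * \1_(A n) x| <= B.
  move=> Dx; rewrite normrM (le_trans _ (hB _ Dx))// ler_piMr//.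
  by rewrite indicE ger0_norm// lern1 leq_b1.
have cv : (fun n => \int[mu]_(x in D) (h x * \1_(A n) x)) @ \oo -->
    \int[mu]_(x in D) h x.
  apply: (bounded_cvg mD mhA) hAB _; first by case: bh.
  apply: filterS hpos => x hx Dx; have [k k0] := hx Dx.
  apply: (@cvg_near_cst _ _ (h x)); exists k => // n /= kn.
  rewrite indicE mem_set ?mulr1//; split=> //.
  exact: lt_le_trans k0 (max_orbit_sum_ub _ _ (leqW kn)).
(* Garsia's inequality. *)
have geM n : 0 <= \int[mu]_(x in D) (h x * \1_(A n) x).
  have bM := bmeas_max_orbit_sum n.+1 bh.
  have <- : \int[mu]_(x in D) (max_orbit_sum h n.+1 x - max_orbit_sum h n.+1 (g x)) = 0.
    rewrite RintegralB//; try exact: bmeas_integrable.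
      by rewrite Rintegral_invariant// subrr.
    exact: (bmeas_integrable mu mD (bmeas_comp bM)).
  apply: le_Rintegral_bmeas => //.
  - by apply: bmeasB => //; exact: (bmeas_comp bM).
  - by split=> //; exists B; exact: hAB.
  move=> x Dx; rewrite indicE.
  case: (ltP 0 (max_orbit_sum h n.+1 x)) => Mx.
    rewrite mem_set ?mulr1//.
    rewrite lerBlDr; move: Mx; rewrite [max_orbit_sum h n.+1 x]/= lt_max ltxx /= => Mx.
    by rewrite max_r ?(ltW Mx)// lerD2l max_orbit_sum_nd.
  rewrite memNset ?mulr0; last by move=> [_ /=]; rewrite ltNge Mx.
  by rewrite subr_le0 (le_trans Mx)// max_orbit_sum_ge0.
rewrite -(cvg_lim (@Rhausdorff R) cv); apply: limr_ge.
  by apply: cvgP; exact: cv.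
exact: nearW.
Qed.

Hypothesis D1 : mu D = 1%E.
Hypothesis gerg : forall A, measurable A -> A `<=` D ->
  D `&` g @^-1` A = A -> mu A = 0%E \/ mu A = 1%E.

(** The set where the orbit sums outgrow [n * a] by an arbitrary amount is
    invariant.  If it had full measure, the maximal theorem for [h - a] would
    give [\int h >= a]. *)
Lemma orbit_sum_ub h a : bmeas D h -> \int[mu]_(x in D) h x < a ->
  {ae mu, forall x, D x -> exists C : nat, forall n, orbit_sum h n x <= n%:R * a + C%:R}.
Proof.
move=> bh ha.
pose E := D `&` [set x | forall C : nat, exists n, n%:R * a + C%:R < orbit_sum h n x].
have mE : measurable E.
  rewrite (_ : E = D `&` \bigcap_(C : nat) \bigcup_n
     (D `&` orbit_sum h n @^-1` `]n%:R * a + C%:R, +oo[%classic)).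
    apply: measurableI => //; apply: bigcap_measurableType => C _.
    by apply: bigcup_measurable => n _; apply: (bmeas_orbit_sum n bh).1.
  apply/seteqP; split=> x [Dx Ex]; split=> //.
    by move=> C _; have [n Cn] := Ex C; exists n => //; split => //=; rewrite in_itv/= Cn.
  by move=> C; have [n _ [_ /=]] := Ex C Logic.I; rewrite in_itv/= andbT => ?; exists n.
have invE : D `&` g @^-1` E = E.
  apply/seteqP; split=> x.
    move=> [Dx [Dgx Ex]]; split=> // C.
    have [n Cn] := Ex (C + Num.truncn `|a - h x|).+1; exists n.+1.
    rewrite orbit_sumS -natr1 mulrDl mul1r; move: Cn.
    have := truncnS_gt `|a - h x|; have := ler_norm (a - h x).
    rewrite -addnS natrD; lra.
  move=> [Dx Ex]; split=> //; split; first exact: gD.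
  move=> C; have [[|n]] := Ex (C + Num.truncn `|h x - a|).+1.
    by rewrite /orbit_sum big_ord0 mul0r add0r ltNge ler0n.
  rewrite orbit_sumS -natr1 mulrDl mul1r => Cn; exists n; move: Cn.
  have := truncnS_gt `|h x - a|; have := ler_norm (h x - a).
  rewrite -addnS natrD; lra.
have ED : E `<=` D by move=> x [].
case: (gerg mE ED invE) => muE.
  have : mu.-negligible E by apply/negligibleP.
  apply: negligibleS => x /= nx; apply: contrapT => nE; apply: nx => Dx.
  apply: contrapT => /forallNP nC; apply: nE; split=> // C.
  by have /existsNP[n /negP] := nC C; rewrite -ltNge => ?; exists n.
have : 0 <= \int[mu]_(x in D) (h x - a).
  apply: maximal_ergodic; first by apply: bmeasB => //; exact: bmeas_cst.
  have : mu.-negligible (~` E).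
    apply/negligibleP; first exact: measurableC.
    have := probability_setC mu mE; rewrite muE subee => [H|]; [exact: H|by []].
  apply: negligibleS => x /= nx Ex; apply: nx => Dx; have [n na] := Ex.2 0%N.
  exists n; rewrite addr0 in na.
  rewrite (_ : orbit_sum _ n x = orbit_sum h n x - n%:R * a) ?subr_gt0//.
  rewrite /orbit_sum sumrB; congr (_ - _).
  by rewrite sumr_const card_ord mulr_natl.
rewrite RintegralB//; try exact: bmeas_integrable.
  by rewrite Rintegral_prob_cst// subr_ge0 leNgt ha.
by apply: bmeas_integrable => //; exact: bmeas_cst.
Qed.

(** Birkhoff's theorem for an ergodic system, for bounded observables. The
    convergence of the averages is stated as an error [n * e + C], in which [C]
    does not depend on [n]. *)
Theorem birkhoff h : bmeas D h ->
  {ae mu, forall x, D x -> forall e, 0 < e -> exists C : nat, forall n,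
     `|orbit_sum h n x - n%:R * \int[mu]_(y in D) h y| <= n%:R * e + C%:R}.
Proof.
move=> bh; set m := \int[mu]_(y in D) h y.
have bN : bmeas D (fun x => - h x).
  by have := bmeasZ (-1) bh; under eq_fun do rewrite mulN1r.
have mN : \int[mu]_(y in D) - h y = - m.
  have := RintegralZl (-1) mD (bmeas_integrable mu mD bh).
  by under eq_Rintegral do rewrite mulN1r; rewrite mulN1r.
have up : {ae mu, forall x, forall k : nat, D x -> exists C : nat, forall n,
    orbit_sum h n x <= n%:R * (m + k.+1%:R^-1) + C%:R}.
  by apply: ae_foralln => k; apply: orbit_sum_ub => //; rewrite ltrDl invr_gt0.
have lo : {ae mu, forall x, forall k : nat, D x -> exists C : nat, forall n,
    orbit_sum (fun x => - h x) n x <= n%:R * (- m + k.+1%:R^-1) + C%:R}.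
  apply: ae_foralln => k; apply: orbit_sum_ub => //.
  by rewrite mN ltrDl invr_gt0.
apply: filterS2 up lo => x up lo Dx e e0.
pose k := Num.truncn e^-1.
have ke : k.+1%:R^-1 <= e.
  by rewrite -[leRHS]invrK lef_pV2 ?posrE ?invr_gt0// ltW// truncnS_gt.
have [C1 up1] := up k Dx; have [C2 lo1] := lo k Dx; exists (maxn C1 C2) => n.
have ne : n%:R * k.+1%:R^-1 <= n%:R * e by rewrite ler_wpM2l.
have : C1%:R <= (maxn C1 C2)%:R :> R by rewrite ler_nat leq_maxl.
have : C2%:R <= (maxn C1 C2)%:R :> R by rewrite ler_nat leq_maxr.
have := up1 n; have := lo1 n.
have -> : orbit_sum (fun x => - h x) n x = - orbit_sum h n x.
  by rewrite /orbit_sum sumrN.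
rewrite !mulrDr mulrN; move: ne; move: (n%:R * k.+1%:R^-1) (n%:R * m) (n%:R * e) => u v w.
by rewrite ler_norml => *; apply/andP; split; lra.
Qed.

End ergodic.

(** * Continuous functions of finitely many random variables *)

Section grid.
Variable R : realType.
Implicit Types (x : R) (k : nat).

(** Rounding of [x] to the grid of mesh [1 / (k + 1)] in [[-k, k]]: [grid k x]
    is the index of the cell of [x] and [gval k] the left end of a cell.  Only
    finitely many indices occur. *)
Definition grid_arg k x : R := (Num.min x k%:R + k%:R) * k.+1%:R.
Definition grid_size k : nat := (2 * k * k.+1)%N.
Definition grid k x : 'I_(grid_size k).+1 := inord (Num.truncn (grid_arg k x)).
Definition gval k (i : nat) : R := i%:R / k.+1%:R - k%:R.

Lemma grid_argK k x : grid k x = Num.truncn (grid_arg k x) :> nat.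
Proof.
rewrite /grid inordK// ltnS truncn_le_nat (@le_lt_trans _ _ (grid_size k)%:R)//.
  have -> : (grid_size k)%:R = (k%:R + k%:R) * k.+1%:R :> R.
    by rewrite /grid_size !natrM mulr_natl mulr2n.
  by rewrite ler_wpM2r// lerD2r ge_min lexx orbT.
by rewrite ltr_nat.
Qed.

Lemma gval_dist k x : `|x| <= k%:R -> `|gval k (grid k x) - x| <= k.+1%:R^-1.
Proof.
rewrite ler_norml => /andP[kx xk]; rewrite grid_argK /gval.
have garg : grid_arg k x = (x + k%:R) * k.+1%:R by rewrite /grid_arg min_l.
have /truncn_itv : 0 <= grid_arg k x by rewrite garg mulr_ge0// -lerBlDr sub0r.
move: (Num.truncn _) => n; rewrite garg -[n.+1%:R]natr1 => /andP[].
have k0 : 0 < k.+1%:R :> R by [].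
rewrite -ler_pdivrMr// -ltr_pdivlMr// mulrDl div1r => h1 h2.
have : 0 < (k.+1%:R : R)^-1 by rewrite invr_gt0.
move: (k.+1%:R^-1 : R) h1 h2 => u h1 h2 u0.
by rewrite ler_norml; apply/andP; split; lra.
Qed.

Lemma gval_cvg x : (fun k => gval k (grid k x)) @ \oo --> x.
Proof.
apply/cvgrPdist_le => e e0; near=> k.
rewrite distrC (le_trans (gval_dist _))//.
  by near: k; exact: nbhs_infty_ger.
have ek : e^-1 <= k%:R by near: k; exact: nbhs_infty_ger.
rewrite -[leRHS]invrK lef_pV2 ?posrE ?invr_gt0//.
by rewrite (le_trans ek)// ler_nat.
Unshelve. all: by end_near. Qed.

Lemma measurable_cell k (i : 'I_(grid_size k).+1) :
  measurable [set x | grid k x = i].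
Proof.
have -> : [set x | grid k x = i] =
    [set: R] `&` grid_arg k @^-1` [set y | Num.truncn y = i].
  apply/seteqP; split => x /=; first by move=> <-; split=> //; rewrite grid_argK.
  by move=> [_ xi]; apply: val_inj; rewrite /= grid_argK.
have mg : measurable_fun setT (grid_arg k).
  apply: measurable_funM => //; apply: measurable_funD => //.
  exact: measurable_minr.
apply: mg => //.
case: i => -[|i] _ /=.
  rewrite (_ : mkset _ = `]-oo, 1%R[%classic)//; apply/seteqP; split => y /=.
    by rewrite in_itv/= ltNge -truncn_gt0 => ->.
  by rewrite in_itv/= ltNge -truncn_gt0 lt0n negbK => /eqP.
rewrite (_ : mkset _ = `[i.+1%:R, i.+2%:R[%classic)//.
apply/seteqP; split => y /=; rewrite in_itv/=.
  move=> yi; have y0 : 0 <= y.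
    by rewrite ltW// (lt_le_trans ltr01)// -truncn_gt0 yi.
  by rewrite -truncn_eq// yi.
by move=> /andP[iy yi]; apply: truncn_def; rewrite iy.
Qed.

(** Continuity for the topology of pointwise convergence, on functions of
    finitely many real variables. *)
Definition fcontinuous (I : finType) (h : (I -> R) -> R) :=
  forall (a : I -> R) (e : R), 0 < e -> exists2 r : R, 0 < r &
    forall b : I -> R, (forall i, `|b i - a i| < r) -> `|h b - h a| < e.

Lemma fcontinuous_lip (I : finType) (h : (I -> R) -> R) K :
  (forall (a b : I -> R) r, 0 <= r -> (forall i, `|b i - a i| <= r) ->
     `|h b - h a| <= K * r) ->
  fcontinuous h.
Proof.
move=> hK a e e0; have K0 : 0 < `|K| + 1 by rewrite ltr_wpDl.
exists (e / (`|K| + 1) / 2); first by rewrite !divr_gt0.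
move=> b ab; apply: le_lt_trans (hK a b (e / (`|K| + 1) / 2) _ _) _.
- by rewrite ltW// !divr_gt0.
- by move=> i; exact/ltW.
have He : e / (`|K| + 1) * (`|K| + 1) = e by rewrite divfK// gt_eqF.
have He0 : 0 < e / (`|K| + 1) by rewrite divr_gt0.
apply: le_lt_trans (_ : (`|K| + 1) * (e / (`|K| + 1) / 2) < _).
  by rewrite ler_wpM2r ?divr_ge0 ?ltW// (le_lt_trans (ler_norm _))// ltrDl.
by rewrite mulrA (mulrC (_ + 1)) He ltr_pdivrMr// mulr_natr mulr2n ltrDl.
Qed.

End grid.

Section finite_dim.
Context d (T : measurableType d) (R : realType).
Variables (D : set T) (mD : measurable D) (I : finType) (V : I -> T -> R).
Hypothesis mV : forall i, measurable_fun D (V i).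

(** The random point [(V i w)_i] rounded to the grid. *)
Definition disc k (w : T) (i : I) : R := gval R k (grid k (V i w)).

(** The event that the rounded point has indices [a]. *)
Definition cells k (a : {ffun I -> 'I_(grid_size k).+1}) : set T :=
  \bigcap_(i in [set: I]) (D `&` V i @^-1` [set x | grid k x = a i]).

Lemma measurable_cells k a : measurable (@cells k a).
Proof.
apply: fin_bigcap_measurable => [|i _]; first exact: finite_finset.
by apply: mV => //; exact: measurable_cell.
Qed.

Lemma discE (h : (I -> R) -> T -> R) k w : D w ->
  h (disc k w) w =
  \sum_(a : {ffun I -> 'I_(grid_size k).+1})
     \1_(cells a) w * h (fun i => gval R k (a i)) w.
Proof.
move=> Dw; rewrite (bigD1 [ffun i => grid k (V i w)])//= big1 ?addr0.
  rewrite indicE mem_set ?mul1r.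
    by congr h; apply/funext => i; rewrite /disc ffunE.
  by move=> i _; split => //=; rewrite ffunE.
move=> a /eqP neq; rewrite indicE memNset ?mul0r// => wa; apply: neq.
by apply/ffunP => i; rewrite ffunE; have [_ <-] := wa i Logic.I.
Qed.

Lemma disc_cvg (h : (I -> R) -> R) w : fcontinuous h ->
  (fun k => h (disc k w)) @ \oo --> h (V ^~ w).
Proof.
move=> ch; apply/cvgrPdist_lt => e e0; have [r r0 hr] := ch (V ^~ w) _ e0.
have : \forall k \near \oo, forall i, i \in enum I -> `|V i w - disc k w i| < r.
  elim: (enum I) => [|i s IH]; first exact: nearW.
  have : \forall k \near \oo, `|V i w - disc k w i| < r.
    by have /cvgrPdist_lt/(_ _ r0) := @gval_cvg R (V i w).
  apply: filterS2 IH => k IH Vi j; rewrite in_cons => /predU1P[->//|].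
  exact: IH.
apply: filterS => k Vk; rewrite distrC; apply: hr => i.
by rewrite distrC Vk// mem_enum.
Qed.

Lemma measurable_disc (h : (I -> R) -> T -> R) k :
  (forall a, measurable_fun D (h a)) ->
  measurable_fun D (fun w => h (disc k w) w).
Proof.
move=> mh; apply: eq_measurable_fun (_ : measurable_fun D (fun w =>
    \sum_(a : {ffun I -> 'I_(grid_size k).+1})
       \1_(cells a) w * h (fun i => gval R k (a i)) w)).
  by move=> w; rewrite inE => Dw; rewrite discE.
apply: measurable_sum => a; apply: measurable_funM => //.
exact/measurable_indic/measurable_cells.
Qed.

(** A function that is measurable in the sample point and continuous in
    finitely many real parameters remains measurable when random variables are
    substituted for the parameters. *)
Lemma measurable_caratheodory (h : (I -> R) -> T -> R) :
  (forall a, measurable_fun D (h a)) ->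
  (forall w, D w -> fcontinuous (h ^~ w)) ->
  measurable_fun D (fun w => h (V ^~ w) w).
Proof.
move=> mh ch.
apply: (@measurable_fun_cvg _ _ _ _ (fun k w => h (disc k w) w)).
  by move=> k; exact: measurable_disc.
by move=> w Dw; exact: disc_cvg (ch w Dw).
Qed.

Lemma measurable_fcontinuous (h : (I -> R) -> R) : fcontinuous h ->
  measurable_fun D (fun w => h (V ^~ w)).
Proof.
move=> ch; apply: (measurable_caratheodory (h := fun a _ => h a)) => //.
Qed.

Lemma Rintegral_disc (mu : probability T R) (h : (I -> R) -> R) k :
  \int[mu]_(w in D) h (disc k w) =
  \sum_(a : {ffun I -> 'I_(grid_size k).+1})
     fine (mu (cells a `&` D)) * h (fun i => gval R k (a i)).
Proof.
have mi a : bmeas D (\1_(@cells k a) : T -> R).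
  split; first exact/measurable_indic/measurable_cells.
  by exists 1 => w _; rewrite indicE ger0_norm// lern1 leq_b1.
pose F (a : {ffun I -> 'I_(grid_size k).+1}) w :=
  \1_(cells a) w * h (fun i => gval R k (a i)) : R.
have bF a : bmeas D (F a).
  by have := bmeasZ (h (fun i => gval R k (a i))) (mi a); under eq_fun do rewrite mulrC.
have iF a : \int[mu]_(w in D) F a w = fine (mu (cells a `&` D)) * h (fun i => gval R k (a i)).
  rewrite RintegralZr//; last exact: bmeas_integrable.
  by congr (_ * _); rewrite /Rintegral integral_indic//; exact: measurable_cells.
transitivity (\int[mu]_(w in D) \sum_a F a w).
  by apply: eq_Rintegral => w /set_mem Dw; rewrite (discE (fun a _ => h a)).
suff [_ ->] : bmeas D (fun w => \sum_a F a w) /\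
    \int[mu]_(w in D) (\sum_a F a w) = \sum_a \int[mu]_(w in D) F a w.
  by apply: eq_bigr => a _.
elim: (index_enum _) => [|a s [IH1 IH2]].
  split; first by under eq_fun do rewrite big_nil; exact: bmeas_cst.
  rewrite big_nil; under eq_Rintegral do rewrite big_nil.
  by rewrite /Rintegral integral0.
split; first by under eq_fun do rewrite big_cons; exact: bmeasD.
under eq_Rintegral do rewrite big_cons.
by rewrite RintegralD// ?IH2 ?big_cons//; exact: bmeas_integrable.
Qed.

End finite_dim.

(** Two finite families of random variables that give the same probability to
    every measurable rectangle have the same law. *)
Lemma Rintegral_eq_law d (T : measurableType d) d' (T' : measurableType d')
    (R : realType) (mu : probability T R) (mu' : probability T' R)
    (I : finType) (V : I -> T -> R) (V' : I -> T' -> R) (h : (I -> R) -> R) B :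
  (forall i, measurable_fun setT (V i)) ->
  (forall i, measurable_fun setT (V' i)) ->
  (forall A : I -> set R, (forall i, measurable (A i)) ->
     mu (\bigcap_i (V i @^-1` A i)) = mu' (\bigcap_i (V' i @^-1` A i))) ->
  fcontinuous h -> (forall a, `|h a| <= B) ->
  \int[mu]_w h (V ^~ w) = \int[mu']_w h (V' ^~ w).
Proof.
move=> mV mV' VV' ch hB.
have cvgV d1 (T1 : measurableType d1) (mu1 : probability T1 R) (V1 : I -> T1 -> R) :
    (forall i, measurable_fun setT (V1 i)) ->
    (fun k => \int[mu1]_w h (disc V1 k w)) @ \oo --> \int[mu1]_w h (V1 ^~ w).
  move=> mV1; apply: (@bounded_cvg _ _ _ _ _ _ _ _ B) => //.
  - by move=> k; apply: (measurable_disc _ mV1 (h := fun a _ => h a)).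
  - exact: measurable_fcontinuous.
  - by apply: aeW => w _; exact: disc_cvg.
have E1 := cvg_lim (@Rhausdorff R) (cvgV _ _ mu _ mV).
have E2 := cvg_lim (@Rhausdorff R) (cvgV _ _ mu' _ mV').
rewrite -E1 -E2; congr (lim (_ @ \oo)); apply/funext => k.
rewrite !Rintegral_disc//; apply: eq_bigr => a _; congr (fine _ * _).
rewrite !setIT /cells.
under eq_bigcapr do rewrite setTI; under [in RHS]eq_bigcapr do rewrite setTI.
by apply: VV' => i; exact: measurable_cell.
Qed.

(** * Piecewise linear interpolation *)

Section interpolation.
Variables (R : realType) (V : normedModType R).
Implicit Types (u v : nat -> V) (s t r : R).

(** The time spent in [[k, k + 1]] before [s]. *)
Definition ramp (k : nat) s : R := Num.min 1 (Num.max 0 (s - k%:R)).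

Lemma ramp_nd k s t : s <= t -> ramp k s <= ramp k t.
Proof.
move=> st; rewrite /ramp; case: (leP 1 (Num.max 0 (s - k%:R))) => h1.
  rewrite le_min lexx/= (le_trans h1)//.
  by rewrite ge_max !le_max lexx/= lerD2r st orbT.
rewrite le_min ltW//= ge_max !le_max lexx/= lerD2r st orbT//.
Qed.

Lemma ramp1 k s : k.+1%:R <= s -> ramp k s = 1.
Proof.
move=> ks; rewrite /ramp min_l// le_max; apply/orP; right.
by rewrite lerBrDl natr1.
Qed.

Lemma interpolate_nat u n : interpolate u n%:R = u n.
Proof. by rewrite /interpolate natrK subrr scale0r addr0. Qed.

(** Interpolation as a sum of increments, one for each of the intervals before
    [N]; both its Lipschitz bound and its linearity are read off this form. *)
Lemma interpolate_sum u N s : 0 <= s -> s <= N%:R ->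
  interpolate u s = u 0%N + \sum_(k < N) ramp k s *: (u k.+1 - u k).
Proof.
move=> s0; elim: N => [|N IH] sN.
  rewrite big_ord0 addr0; have -> : s = 0%:R by apply/eqP; rewrite eq_le s0 sN.
  exact: interpolate_nat.
rewrite big_ord_recr/= addrA; have [sleN|Nlts] := leP s N%:R.
  have -> : ramp N s = 0 by rewrite /ramp max_l ?subr_le0// min_r.
  by rewrite scale0r addr0 IH.
have -> : u 0%N + \sum_(k < N) ramp k s *: (u k.+1 - u k) = u N.
  rewrite (eq_bigr (fun k : 'I_N => u k.+1 - u k)); last first.
    move=> k _; rewrite ramp1 ?scale1r// (le_trans _ (ltW Nlts))// ler_nat.
    exact: ltn_ord.
  by rewrite -(big_mkord xpredT (fun k => u k.+1 - u k)) telescope_sumr// addrC subrK.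
have [->|sneN] := eqVneq s N.+1%:R.
  by rewrite interpolate_nat ramp1// scale1r addrC subrK.
have sltN : s < N.+1%:R by rewrite lt_neqAle sneN.
have trs : Num.truncn s = N by apply: truncn_def; rewrite (ltW Nlts).
rewrite /interpolate trs /ramp max_r ?subr_ge0 ?(ltW Nlts)// min_r//.
by rewrite lerBlDl natr1 ltW.
Qed.

Lemma ramp_sum N s : 0 <= s -> s <= N%:R -> \sum_(k < N) ramp k s = s.
Proof.
elim: N => [|N IH] s0 sN; first by rewrite big_ord0; apply/eqP; rewrite eq_le s0 sN.
rewrite big_ord_recr/=; have [sleN|Nlts] := leP s N%:R.
  by rewrite IH// /ramp max_l ?subr_le0// min_r// addr0.
rewrite (eq_bigr (fun=> 1)); last first.
  move=> k _; rewrite ramp1// (le_trans _ (ltW Nlts))// ler_nat; exact: ltn_ord.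
rewrite sumr_const card_ord /ramp max_r ?subr_ge0 ?(ltW Nlts)// min_r.
  by rewrite addrC subrK.
by rewrite lerBlDl natr1.
Qed.

Lemma interpolate_dist u s t N K : 0 <= s -> s <= t -> t <= N%:R ->
  (forall k, (k < N)%N -> `|u k.+1 - u k| <= K) ->
  `|interpolate u t - interpolate u s| <= K * (t - s).
Proof.
move=> s0 st tN uK.
have t0 := le_trans s0 st; have sN := le_trans st tN.
rewrite (interpolate_sum u t0 tN) (interpolate_sum u s0 sN).
rewrite opprD addrACA subrr add0r -sumrB.
apply: le_trans (ler_norm_sum _ _ _) _.
rewrite -[X in K * (X - _)](ramp_sum t0 tN) -[X in K * (_ - X)](ramp_sum s0 sN).
rewrite -sumrB mulr_sumr; apply: ler_sum => k _.
have rk := ramp_nd k st.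
rewrite -scalerBl normrZ ger0_norm ?subr_ge0// mulrC ler_wpM2r ?subr_ge0//.
exact: uK.
Qed.

(** An interpolated value lies in every ball that contains the two neighbouring
    nodes. *)
Lemma interpolate_ball u (c : V) s r : 0 <= s ->
  `|u (Num.truncn s) - c| <= r -> `|u (Num.truncn s).+1 - c| <= r ->
  `|interpolate u s - c| <= r.
Proof.
move=> s0; have /andP[ns sn] := truncn_itv s0; rewrite /interpolate.
move: (Num.truncn s) ns sn => n ns sn un unn.
have th0 : 0 <= s - n%:R by rewrite subr_ge0.
have th1 : 0 <= 1 - (s - n%:R) by rewrite subr_ge0 lerBlDl natr1 ltW.
move: (s - n%:R) th0 th1 => th th0 th1.
rewrite (_ : _ - c = (1 - th) *: (u n - c) + th *: (u n.+1 - c)); last first.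
  have -> : u n.+1 - u n = (u n.+1 - c) - (u n - c) by rewrite opprB addrA subrK.
  by rewrite addrAC scalerBr scalerBl scale1r addrA addrAC.
rewrite (le_trans (ler_normD _ _))// !normrZ (ger0_norm th0) (ger0_norm th1).
have -> : r = (1 - th) * r + th * r by rewrite -mulrDl subrK mul1r.
by rewrite lerD// ler_wpM2l.
Qed.

Lemma interpolateB u v s :
  interpolate (fun k => u k - v k) s = interpolate u s - interpolate v s.
Proof.
rewrite /interpolate/=; move: (Num.truncn s) => n.
rewrite [in RHS]opprD [RHS]addrACA; congr (_ + _); rewrite -scalerBr; congr (_ *: _).
by rewrite !opprB addrACA [RHS]addrACA; congr (_ + _); rewrite addrC.
Qed.

Lemma interpolate_close u v s r : 0 <= s ->
  (forall k, (k <= (Num.truncn s).+1)%N -> `|u k - v k| <= r) ->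
  `|interpolate u s - interpolate v s| <= r.
Proof.
move=> s0 uv; rewrite -interpolateB -[X in `|X|]subr0.
by apply: interpolate_ball; rewrite ?subr0// uv.
Qed.

End interpolation.

(** * Continuous paths *)

Section column_norm.
Variables (R : realType).

Lemma cV_norm_le d (x : 'cV[R]_d) (r : R) : 0 <= r ->
  (forall i, `|x i ord0| <= r) -> `|x| <= r.
Proof.
move=> r0 xr; rewrite [`|x|]mx_normrE; apply/bigmax_leP; split => // -[i j] _ /=.
by rewrite ord1.
Qed.

Lemma cV_coord_le d (x : 'cV[R]_d) i : `|x i ord0| <= `|x|.
Proof.
rewrite [leRHS]mx_normrE.
exact: (le_bigmax _ (fun ij : 'I_d * 'I_1 => `|x ij.1 ij.2|) (i, ord0)).
Qed.

Lemma mulmx_norm_le d (Q : 'M[R]_d) :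
  exists2 C : R, 0 < C & forall x : 'cV[R]_d, `|Q *m x| <= C * `|x|.
Proof.
exists (1 + \sum_i \sum_j `|Q i j|) => [|x].
  by rewrite ltr_wpDr// sumr_ge0// => i _; exact: sumr_ge0.
have S0 : 0 <= \sum_i \sum_j `|Q i j| by apply: sumr_ge0 => i _; exact: sumr_ge0.
apply: cV_norm_le => [|i]; first by rewrite mulr_ge0// addr_ge0.
rewrite mxE (le_trans (ler_norm_sum _ _ _))//.
apply: (@le_trans _ _ (\sum_j `|Q i j| * `|x|)).
  by apply: ler_sum => j _; rewrite normrM ler_wpM2l// cV_coord_le.
rewrite -mulr_suml ler_wpM2r//.
apply: ler_wpDl => //; rewrite [leRHS](bigD1 i)//= lerDl.
by apply: sumr_ge0 => k _; exact: sumr_ge0.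
Qed.

End column_norm.

Section paths.
Variables (R : realType) (d : nat).
Local Notation path := (path_space R d).
Implicit Types (w x y : path) (s t r e : R) (N m : nat).

(** Paths are uniformly continuous on compact time intervals. *)
Lemma CpathP w : Cpath R d w <->
  forall N e, 0 < e -> exists2 dl : R, 0 < dl & forall s t,
    0 <= s <= N%:R -> 0 <= t <= N%:R -> `|s - t| < dl -> `|w s - w t| < e.
Proof.
split.
  move=> /subspace_continuousP cw N e e0.
  have e20 : 0 < e / 2 by rewrite divr_gt0.
  have cpt := @segment_compact R 0 N%:R.
  move/compact_near_coveringP : cpt => /(_ R 0^'+ (fun dl (s : R) =>
    forall t, 0 <= s -> 0 <= t -> `|s - t| < dl -> `|w s - w t| < e) _) cov.
  have : \forall dl \near 0^'+, `[0, N%:R]%classic `<=` (fun s =>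
    forall t, 0 <= s -> 0 <= t -> `|s - t| < dl -> `|w s - w t| < e).
    apply: cov => s; rewrite /= in_itv/= => /andP[s0 sN].
    have s_ge0 : `[0, +oo[%classic s by rewrite /= in_itv/= s0.
    have /cvgrPdist_lt cws := cw s s_ge0.
    have := cws _ e20; rewrite near_withinE.
    move=> /nbhs_ballP[r /= r0 rw].
    have r20 : 0 < r / 2 by rewrite divr_gt0.
    near=> s' dl => t s'0 t0 st.
    have ss' : `|s - s'| < r / 2.
      by near: s'; exact: (@nbhsx_ballx _ _ s _ r20).
    have dlr : dl <= r / 2.
      by near: dl; apply: nbhs_right_le.
    have Hs' : `|w s - w s'| < e / 2.
      apply: rw; last by rewrite /= in_itv/= s'0.
      by rewrite /ball/= (lt_trans ss')// ltr_pdivrMr// ltr_pMr// ltr1n.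
    have Ht : `|w s - w t| < e / 2.
      apply: rw; last by rewrite /= in_itv/= t0.
      rewrite /ball/= -(subrK s' s) -addrA (le_lt_trans (ler_normD _ _))//.
      by rewrite [ltRHS]splitr ltrD// (lt_le_trans st).
    rewrite -(subrK (w s) (w s')) -addrA (le_lt_trans (ler_normD _ _))//.
    by rewrite [ltRHS]splitr ltrD// distrC.
  move=> [dl /= dl0 Hdl]; exists (dl / 2); first by rewrite divr_gt0.
  move=> s t /andP[s0 sN] /andP[t0 tN] st.
  apply: (Hdl (dl / 2)) => //=.
  - rewrite sub0r normrN gtr0_norm ?divr_gt0//.
    by rewrite ltr_pdivrMr// ltr_pMr// ltr1n.
  - by rewrite divr_gt0.
  - by rewrite in_itv/= s0.
move=> Hw; apply/subspace_continuousP => s; rewrite /= in_itv/= andbT => s0.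
apply/cvgrPdist_lt => e e0; rewrite near_withinE.
pose N := (Num.truncn s).+2.
have sN : s + 1 < N%:R by rewrite -natr1 ltrD2r truncnS_gt.
have [dl dl0 Hdl] := Hw N e e0.
have d10 : 0 < Num.min 1 dl by rewrite lt_min ltr01.
apply/nbhs_ballP; exists (Num.min 1 dl) => //= t.
rewrite /ball/= lt_min => /andP[st1 stdl]; rewrite in_itv/= andbT => t0.
apply: Hdl => //; first by rewrite s0 (le_trans _ (ltW sN))// lerDl.
rewrite t0/= (le_trans _ (ltW sN))//.
by move: st1; rewrite ltr_norml => /andP[? ?]; lra.
Unshelve. all: by end_near. Qed.

Lemma Cpath_lip w :
  (forall N, exists K, forall s t, 0 <= s -> s <= t -> t <= N%:R ->
     `|w t - w s| <= K * (t - s)) -> Cpath R d w.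
Proof.
move=> Hw; apply/CpathP => N e e0; have [K HK] := Hw N.
have K0 : 0 < `|K| + 1 by rewrite ltr_wpDl.
exists (e / (`|K| + 1)); first by rewrite divr_gt0.
have main s t : 0 <= s -> s <= t -> t <= N%:R -> `|s - t| < e / (`|K| + 1) ->
    `|w t - w s| < e.
  move=> s0 st tN; rewrite distrC ger0_norm ?subr_ge0// ltr_pdivlMr// => h.
  apply: le_lt_trans (HK _ _ s0 st tN) _; apply: le_lt_trans h.
  rewrite mulrC ler_wpM2l ?subr_ge0//.
  by rewrite (le_trans (ler_norm _))// lerDl.
move=> s t /andP[s0 sN] /andP[t0 tN] sd; have [st|/ltW ts] := leP s t.
  by rewrite distrC; exact: main.
by apply: main => //; rewrite distrC.
Qed.

Lemma Cpath_interpolate (u : nat -> 'cV[R]_d) c : 0 <= c ->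
  Cpath R d (fun t => interpolate u (t * c)).
Proof.
move=> c0; apply: Cpath_lip => N.
pose M := (Num.truncn (N%:R * c)).+1.
exists ((\sum_(k < M) `|u k.+1 - u k|) * c) => s t s0 st tN.
rewrite -mulrA mulrBr !(mulrC c); apply: (@interpolate_dist _ _ _ _ _ M).
- by rewrite mulr_ge0.
- by rewrite ler_wpM2r.
- by rewrite (le_trans _ (ltW (truncnS_gt _)))// ler_wpM2r.
move=> k kM; rewrite (bigD1 (Ordinal kM))//= lerDl.
by apply: sumr_ge0 => j _.
Qed.

Lemma Cpath_mulmx (Q : 'M[R]_d) w : Cpath R d w -> Cpath R d (fun t => Q *m w t).
Proof.
have [C C0 QC] := mulmx_norm_le Q.
move=> /CpathP Hw; apply/CpathP => N e e0.
have [dl dl0 Hdl] := Hw N (e / C) (divr_gt0 e0 C0); exists dl => // s t sN tN st.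
rewrite -mulmxBr (le_lt_trans (QC _))// mulrC -ltr_pdivlMr//.
exact: Hdl.
Qed.

End paths.

Arguments Cpath_mulmx {R d} Q {w} _.

Section path_functionals.
Variables (R : realType) (d : nat).
Local Notation path := (path_space R d).
Local Notation C := (Cpath R d).
Implicit Types (w x y : path) (s t r e h : R) (N m k : nat) (phi : path -> R).

Lemma CpathB x y : C x -> C y -> C (fun t => x t - y t).
Proof.
move=> /CpathP Hx /CpathP Hy; apply/CpathP => N e e0.
have e20 : 0 < e / 2 by rewrite divr_gt0.
have [dx dx0 {}Hx] := Hx N _ e20; have [dy dy0 {}Hy] := Hy N _ e20.
exists (Num.min dx dy) => [|s t sN tN]; first by rewrite lt_min dx0.
rewrite lt_min => /andP[sx sy].
rewrite opprD addrACA -opprD (le_lt_trans (ler_normB _ _))//.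
by rewrite [ltRHS]splitr ltrD ?Hx ?Hy.
Qed.

Lemma Cpath_bounded x N : C x -> exists B : R, forall t, 0 <= t <= N%:R -> `|x t| <= B.
Proof.
move=> Cx.
have cpt := @segment_compact R 0 N%:R.
have cx : {within `[0, N%:R]%classic, continuous (x : R -> 'cV[R]_d)}.
  apply: continuous_subspaceW Cx => t /=; rewrite !in_itv/= andbT.
  by move=> /andP[].
have [B [_ HB]] := compact_bounded (continuous_compact cx cpt).
exists (B + 1) => t tN; apply: (HB (B + 1)); first by rewrite ltrDl.
by exists t => //; rewrite /= in_itv.
Qed.

(** The supremum norm over [[0, N]]. *)
Definition pnorm N x : R := sup [set `|x t| | t in `[0, N%:R]%classic].

(** The modulus of continuity over [[0, N]], at step [h]. *)
Definition pmod N (h : R) x : R :=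
  sup [set r | exists s t, [/\ 0 <= s <= N%:R, 0 <= t <= N%:R, `|s - t| <= h
                             & r = `|x s - x t|]].

Lemma pnorm_ub N x t : C x -> 0 <= t <= N%:R -> `|x t| <= pnorm N x.
Proof.
move=> Cx tN; apply: ub_le_sup; last by exists t => //; rewrite /= in_itv.
have [B HB] := Cpath_bounded N Cx.
by exists B => _ [s /= + <-]; rewrite in_itv/=; exact: HB.
Qed.

Lemma pnorm_le N x r : (forall t, 0 <= t <= N%:R -> `|x t| <= r) -> pnorm N x <= r.
Proof.
move=> xr; apply: ge_sup.
  by exists `|x 0|, 0 => //; rewrite /= in_itv/= lexx/=.
by move=> _ [s /= + <-]; rewrite in_itv/=; exact: xr.
Qed.

Lemma pnorm_ge0 N x : C x -> 0 <= pnorm N x.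
Proof. by move=> Cx; apply: le_trans (pnorm_ub (t := 0) Cx _); rewrite ?lexx/=. Qed.

Lemma pnormB_ge0 N x y : C x -> C y -> 0 <= pnorm N (fun t => x t - y t).
Proof. by move=> Cx Cy; exact: pnorm_ge0 (CpathB Cx Cy). Qed.

Lemma pnormB_ub N x y t : C x -> C y -> 0 <= t <= N%:R ->
  `|x t - y t| <= pnorm N (fun t => x t - y t).
Proof. by move=> Cx Cy tN; exact: (pnorm_ub (CpathB Cx Cy) tN). Qed.

Lemma pmod_ub N h x s t : C x -> 0 <= s <= N%:R -> 0 <= t <= N%:R ->
  `|s - t| <= h -> `|x s - x t| <= pmod N h x.
Proof.
move=> Cx sN tN st; apply: ub_le_sup; last by exists s, t.
have [B HB] := Cpath_bounded N Cx.
exists (B + B) => _ [s' [t' [s'N t'N _ ->]]].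
by rewrite (le_trans (ler_normB _ _))// lerD ?HB.
Qed.

Lemma pmod_le N h x r : 0 <= h ->
  (forall s t, 0 <= s <= N%:R -> 0 <= t <= N%:R -> `|s - t| <= h -> `|x s - x t| <= r) ->
  pmod N h x <= r.
Proof.
move=> h0 xr; apply: ge_sup.
  by exists `|x 0 - x 0|, 0, 0; rewrite ?lexx ?subrr ?normr0//=.
by move=> _ [s [t [? ? ? ->]]]; exact: xr.
Qed.

Lemma pmod_ge0 N h x : 0 <= h -> C x -> 0 <= pmod N h x.
Proof.
by move=> h0 Cx; apply: le_trans (pmod_ub (s := 0) (t := 0) Cx _ _ _);
  rewrite ?subrr ?normr0 ?lexx/=.
Qed.

(** [phi] is [K]-Lipschitz on continuous paths, for the supremum norm over
    [[0, N]]; in particular it only depends on the path up to time [N]. *)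
Definition plip N (K : R) phi := forall x y r, C x -> C y ->
  (forall t, 0 <= t <= N%:R -> `|x t - y t| <= r) -> `|phi x - phi y| <= K * r.

Lemma plip_sym N K phi :
  (forall x y r, C x -> C y -> (forall t, 0 <= t <= N%:R -> `|x t - y t| <= r) ->
     phi x <= phi y + K * r) -> plip N K phi.
Proof.
move=> H x y r Cx Cy xy; rewrite ler_distl; apply/andP; split.
  by rewrite lerBlDr; apply: H => // t tN; rewrite distrC xy.
exact: H.
Qed.

Lemma plip_pnorm N : plip N 1 (pnorm N).
Proof.
apply: plip_sym => x y r Cx Cy xy; apply: pnorm_le => t tN; rewrite mul1r.
rewrite -(subrK (y t) (x t)) (le_trans (ler_normD _ _))// addrC lerD ?xy//.
exact: pnorm_ub.
Qed.

Lemma plip_pmod N h : 0 <= h -> plip N 2 (pmod N h).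
Proof.
move=> h0; apply: plip_sym => x y r Cx Cy xy; apply: pmod_le => // s t sN tN st.
have -> : x s - x t = (y s - y t) + ((x s - y s) - (x t - y t)).
  by apply/matrixP => i j; rewrite !mxE; ring.
rewrite (le_trans (ler_normD _ _))// lerD//; first exact: pmod_ub.
by rewrite mulr_natl mulr2n (le_trans (ler_normB _ _))// lerD// xy.
Qed.

(** ** The topology of uniform convergence on compact sets *)

Lemma nbhs_path x N r : 0 < r ->
  nbhs x [set y | forall t, 0 <= t <= N%:R -> `|x t - y t| < r].
Proof.
move=> r0.
have cN : compactly_in (`[0, +oo[%classic : set R) `[0, N%:R]%classic.
  split; last exact: segment_compact.
  by move=> t /=; rewrite !in_itv/= andbT => /andP[].
have := @fam_nbhs R 'cV[R]_d (compactly_in (`[0, +oo[%classic : set R))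
  `[0, N%:R]%classic _ x (entourage_ball _ (PosNum r0)) cN.
apply: filterS => y /= xy t tN.
by have := xy t; rewrite /= in_itv/= -ball_normE => /(_ tN).
Qed.

Lemma nbhs_path_basis x (A : set path) : nbhs x A ->
  exists N, exists2 r, 0 < r &
    forall y, (forall t, 0 <= t <= N%:R -> `|x t - y t| < r) -> A y.
Proof.
move=> xA.
pose F : set_system path := [set B | exists N, exists2 r, 0 < r &
  forall y, (forall t, 0 <= t <= N%:R -> `|x t - y t| < r) -> B y].
have FF : Filter F.
  split.
  - by exists 0%N, 1.
  - move=> B B' [N [r r0 HB]] [N' [r' r'0 HB']].
    exists (maxn N N'), (Num.min r r') => [|y xy]; first by rewrite lt_min r0.
    split.
      apply: HB => t /andP[t0 tN]; have := xy t; rewrite lt_min t0/=.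
      by rewrite (le_trans tN) ?ler_nat ?leq_maxl// => /(_ isT) /andP[].
    apply: HB' => t /andP[t0 tN]; have := xy t; rewrite lt_min t0/=.
    by rewrite (le_trans tN) ?ler_nat ?leq_maxr// => /(_ isT) /andP[].
  - by move=> B B' BB' [N [r r0 HB]]; exists N, r => // y /HB/BB'.
suff : F --> x by apply.
apply/fam_cvgP => K [K0 cK] B /uniform_nbhs[E [entE EB]].
move: entE; rewrite -entourage_ballE => -[r /= r0 rE].
have [M [_ HM]] := compact_bounded cK.
exists (Num.truncn (M + 1)).+1, r => // y xy; apply: EB => t Kt; apply: rE.
rewrite /= -ball_normE /=; apply: xy.
have := K0 _ Kt; rewrite /= in_itv/= andbT => -> /=.
rewrite (le_trans (ler_norm _))// (le_trans _ (ltW (truncnS_gt _)))//.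
by apply: (HM (M + 1)) => //; rewrite ltrDl.
Qed.

Lemma plip_continuous N K phi : plip N K phi -> {within C, continuous phi}.
Proof.
move=> lphi; apply/subspace_continuousP => x Cx; apply/cvgrPdist_lt => e e0.
rewrite near_withinE.
have K0 : 0 < `|K| + 1 by rewrite ltr_wpDl.
have r0 : 0 < e / (`|K| + 1) by rewrite divr_gt0.
apply: filterS (nbhs_path x N r0) => y xy Cy.
apply: (@le_lt_trans _ _ (K * (e / (`|K| + 1)))).
  by apply: lphi => // t tN; rewrite ltW// xy.
apply: (@le_lt_trans _ _ (`|K| * (e / (`|K| + 1)))).
  by rewrite ler_wpM2r ?ler_norm// ltW.
by rewrite mulrCA gtr_pMr// ltr_pdivrMr// mul1r ltrDl.
Qed.

Lemma continuous_path_basis phi x e : {within C, continuous phi} -> C x -> 0 < e ->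
  exists N, exists2 r, 0 < r & forall y, C y ->
    (forall t, 0 <= t <= N%:R -> `|x t - y t| < r) -> `|phi x - phi y| < e.
Proof.
move=> /subspace_continuousP/(_ x) cphi /cphi /cvgrPdist_lt H e0.
have := H _ e0; rewrite near_withinE => /nbhs_path_basis[N [r r0 Hr]].
by exists N, r => // y Cy /Hr; apply.
Qed.

(** ** Lower envelopes *)

(** The Lipschitz lower envelopes of [phi]; for a bounded continuous [phi] they
    converge to [phi] from below. *)
Definition envelope phi k x : R :=
  inf [set phi y + k%:R * pnorm k (fun t => x t - y t) | y in C].

Section envelope_theory.
Variables (phi : path -> R) (B : R).
Hypothesis phiB : forall x, C x -> `|phi x| <= B.

Let Cx0 : C (fun=> 0).
Proof. by apply: Cpath_lip => N; exists 0 => s t *; rewrite subrr normr0 mul0r. Qed.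

Lemma envelope_le k x y : C x -> C y ->
  envelope phi k x <= phi y + k%:R * pnorm k (fun t => x t - y t).
Proof.
move=> Cx Cy; apply: ge_inf; last by exists y.
exists (- B) => _ [z Cz <-]; rewrite ler_wpDr ?(mulr_ge0 _ (pnormB_ge0 k Cx Cz))//.
by have := phiB Cz; rewrite ler_norml => /andP[].
Qed.

Lemma envelope_ge k x c :
  (forall y, C y -> c <= phi y + k%:R * pnorm k (fun t => x t - y t)) ->
  c <= envelope phi k x.
Proof.
move=> H; apply: lb_le_inf.
  by exists (phi (fun=> 0) + k%:R * pnorm k (fun t => x t - 0)), (fun=> 0).
by move=> _ [z Cz <-]; exact: H.
Qed.

Lemma envelope_le_self k x : C x -> envelope phi k x <= phi x.
Proof.
move=> Cx; apply: le_trans (envelope_le k Cx Cx) _.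
rewrite gerDl mulr_ge0_le0//; apply: pnorm_le => t _.
by rewrite subrr normr0.
Qed.

Lemma envelope_bound k x : C x -> `|envelope phi k x| <= B.
Proof.
move=> Cx; rewrite ler_norml; apply/andP; split; last first.
  apply: le_trans (envelope_le_self k Cx) _.
  by have := phiB Cx; rewrite ler_norml => /andP[].
apply: envelope_ge => y Cy; rewrite ler_wpDr ?(mulr_ge0 _ (pnormB_ge0 k Cx Cy))//.
by have := phiB Cy; rewrite ler_norml => /andP[].
Qed.

Lemma plip_envelope k : plip k k%:R (envelope phi k).
Proof.
apply: plip_sym => x y r Cx Cy xy; rewrite -lerBlDr; apply: envelope_ge => z Cz.
rewrite lerBlDr -addrA -mulrDr; apply: le_trans (envelope_le k Cx Cz) _.
rewrite lerD2l ler_wpM2l//; apply: pnorm_le => t tk.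
have -> : x t - z t = (y t - z t) + (x t - y t).
  by apply/matrixP => i j; rewrite !mxE; ring.
rewrite (le_trans (ler_normD _ _))// lerD ?xy//.
exact: pnormB_ub.
Qed.

Lemma envelope_cvg x : {within C, continuous phi} -> C x ->
  (fun k => envelope phi k x) @ \oo --> phi x.
Proof.
move=> cphi Cx; apply/cvgrPdist_le => e e0.
have [N [r r0 Hr]] := continuous_path_basis cphi Cx e0.
near=> k.
rewrite ger0_norm ?subr_ge0 ?envelope_le_self// lerBlDr addrC -lerBlDr.
apply: envelope_ge => y Cy.
have [xyr|rxy] := ltP (pnorm k (fun t => x t - y t)) r.
  rewrite ler_wpDr ?(mulr_ge0 _ (pnormB_ge0 k Cx Cy))// lerBlDr -lerBlDl.
  apply: le_trans (ler_norm _) _; rewrite ltW//; apply: Hr => // t /andP[t0 tN].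
  apply: le_lt_trans xyr; apply: pnormB_ub => //.
  rewrite t0 (le_trans tN)// ler_nat; near: k; exact: nbhs_infty_ge.
have xB : phi x <= B by have := phiB Cx; rewrite ler_norml => /andP[].
have yB : - B <= phi y by have := phiB Cy; rewrite ler_norml => /andP[].
have kB : 2 * B <= k%:R * pnorm k (fun t => x t - y t).
  apply: (@le_trans _ _ (k%:R * r)); last by rewrite ler_wpM2l.
  rewrite -ler_pdivrMr//; near: k; exact: nbhs_infty_ger.
move: kB; set u := k%:R * _ => kB; lra.
Unshelve. all: by end_near. Qed.

End envelope_theory.

End path_functionals.

Arguments plip_envelope {R d phi B} phiB k : rename.

(** * Random paths *)

Section grid_paths.
Variables (R : realType) (d : nat).
Local Notation path := (path_space R d).
Local Notation C := (Cpath R d).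

(** The interpolation of a continuous path at the multiples of [1 / (m + 1)]
    converges to the path, uniformly on compact time intervals. *)
Lemma interpolate_grid_cvg (x : path) N (e : R) : C x -> 0 < e ->
  \forall m \near \oo, forall t : R, 0 <= t <= N%:R ->
    `|interpolate (fun k => x (k%:R / m.+1%:R)) (t * m.+1%:R) - x t| <= e.
Proof.
move=> /CpathP Cx e0; have [dl dl0 Hdl] := Cx N.+1 e e0.
near=> m => t /andP[t0 tN].
have m0 : 0 < m.+1%:R :> R by [].
have mdl : m.+1%:R^-1 < dl.
  rewrite -[ltRHS]invrK ltf_pV2 ?posrE ?invr_gt0//.
  have h : dl^-1 <= m%:R by near: m; exact: nbhs_infty_ger.
  by rewrite (le_lt_trans h)// ltr_nat.
have m1 : (m.+1%:R^-1 : R) <= 1 by rewrite invf_le1// ler1n.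
have tm0 : 0 <= t * m.+1%:R by rewrite mulr_ge0.
have close (s : R) : 0 <= s -> `|s - t| <= m.+1%:R^-1 -> `|x s - x t| <= e.
  move=> s0 st; rewrite ltW//; apply: Hdl.
  - rewrite s0/= -(subrK t s) (le_trans (lerD (le_trans (ler_norm _) st) tN))//.
    by rewrite -[N.+1%:R]natr1 addrC lerD2l.
  - by rewrite t0 (le_trans tN)// ler_nat.
  - exact: le_lt_trans mdl.
have := truncn_itv tm0; have u0 : 0 < (m.+1%:R^-1 : R) by rewrite invr_gt0.
move: (interpolate_ball (u := fun k => x (k%:R / m.+1%:R)) (c := x t) (r := e) tm0).
move: (Num.truncn _) => k; rewrite -[k.+1%:R]natr1 => ball /andP[].
rewrite -ler_pdivrMr// -ltr_pdivlMr// mulrDl mul1r => k1 k2.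
apply: ball; apply: close; rewrite ?divr_ge0//.
  move: (m.+1%:R^-1 : R) k1 k2 u0 => u *.
  by rewrite ler_norml; apply/andP; split; lra.
rewrite mulrDl mul1r; move: (m.+1%:R^-1 : R) k1 k2 u0 => u *.
by rewrite ler_norml; apply/andP; split; lra.
Unshelve. all: by end_near. Qed.

(** The piecewise linear path whose values at the multiples of [1 / (m + 1)] up
    to time [N] are given by [a]. *)
Definition grid_path N m (a : 'I_(N * m.+1).+2 * 'I_d -> R) : path :=
  fun t => interpolate (fun k => \col_i a (inord k, i)) (t * m.+1%:R).

Lemma Cpath_grid N m a : C (@grid_path N m a).
Proof. exact: Cpath_interpolate. Qed.

Lemma truncn_grid_le N m (t : R) : 0 <= t <= N%:R ->
  (Num.truncn (t * m.+1%:R) <= N * m.+1)%N.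
Proof.
move=> /andP[t0 tN]; rewrite truncn_le_nat.
by rewrite (@le_lt_trans _ _ (N * m.+1)%:R) ?ltr_nat// natrM ler_wpM2r.
Qed.

Variables (phi : path -> R) (N : nat) (K : R).
Hypothesis lphi : plip N K phi.

Lemma fcontinuous_grid m : fcontinuous (fun a => phi (@grid_path N m a)).
Proof.
apply: (@fcontinuous_lip _ _ _ K) => a b r r0 ab.
apply: lphi; try exact: Cpath_grid.
move=> t tN; apply: interpolate_close => [|k _].
  by case/andP: tN => t0 _; rewrite mulr_ge0.
by apply: cV_norm_le => // i; rewrite !mxE.
Qed.

Lemma plip_cvg (x_ : nat -> path) (x : path) : (forall m, C (x_ m)) -> C x ->
  (forall e, 0 < e -> \forall m \near \oo, forall t : R, 0 <= t <= N%:R ->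
     `|x_ m t - x t| <= e) -> (fun m => phi (x_ m)) @ \oo --> phi x.
Proof.
move=> Cx_ Cx xx; apply/cvgrPdist_le => e e0.
have K0 : 0 < `|K| + 1 by rewrite ltr_wpDl.
apply: filterS (xx _ (divr_gt0 e0 K0)) => m xm.
rewrite distrC (le_trans (lphi (Cx_ m) Cx xm))//.
rewrite (@le_trans _ _ (`|K| * (e / (`|K| + 1))))//.
  by rewrite ler_wpM2r ?ler_norm// ltW ?divr_gt0.
by rewrite mulrCA ger_pMr// ler_pdivrMr// mul1r lerDl.
Qed.

Lemma grid_path_cvg (x : path) : C x ->
  (fun m => phi (@grid_path N m (fun ki => x (ki.1%:R / m.+1%:R) ki.2 ord0)))
    @ \oo --> phi x.
Proof.
move=> Cx; apply: plip_cvg => [m||e e0] //; first exact: Cpath_grid.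
apply: filterS (interpolate_grid_cvg N Cx e0) => m Hm t tN.
apply: le_trans (Hm t tN); rewrite le_eqVlt; apply/orP; left; apply/eqP.
have trN := truncn_grid_le m tN.
have node k : (k <= (N * m.+1).+1)%N ->
    \col_i x ((inord k : 'I_(N * m.+1).+2)%:R / m.+1%:R) i ord0 = x (k%:R / m.+1%:R).
  by move=> kN; apply/colP => i; rewrite mxE inordK.
by rewrite /grid_path /interpolate /= !node// leqW.
Qed.

End grid_paths.

Section random_paths.
Context dT (T : measurableType dT) (R : realType) (d : nat).
Variables (D : set T) (mD : measurable D).
Local Notation path := (path_space R d).
Local Notation C := (Cpath R d).

(** A [C([0, oo), R^d)]-valued random element, defined on the event [D]. *)
Definition rpath (X : T -> path) := (forall w, D w -> C (X w)) /\
  (forall t, 0 <= t -> forall i, measurable_fun D (fun w => X w t i ord0)).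

Variables (X : T -> path) (rX : rpath X).

Lemma measurable_plip phi N K : plip N K phi -> measurable_fun D (fun w => phi (X w)).
Proof.
move=> lphi; have [CX mX] := rX.
apply: (@measurable_fun_cvg _ _ _ _ (fun m w => phi (@grid_path R d N m
    (fun ki => X w (ki.1%:R / m.+1%:R) ki.2 ord0)))) => [m|w Dw]; last first.
  by apply: (grid_path_cvg lphi); exact: CX.
pose V (ki : 'I_(N * m.+1).+2 * 'I_d) w := X w (ki.1%:R / m.+1%:R) ki.2 ord0.
have mV ki : measurable_fun D (V ki) by apply: mX; rewrite divr_ge0.
exact: (measurable_fcontinuous mD mV (fcontinuous_grid lphi (m := m))).
Qed.

Lemma bmeas_plip (phi : path -> R) N (K B : R) : plip N K phi -> (forall x, C x -> `|phi x| <= B) ->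
  bmeas D (fun w => phi (X w)).
Proof.
move=> lphi phiB; split; first exact: measurable_plip lphi.
by exists B => w Dw; apply: phiB; exact: rX.1.
Qed.

Lemma bmeas_continuous (phi : path -> R) (B : R) : {within C, continuous phi} ->
  (forall x, C x -> `|phi x| <= B) -> bmeas D (fun w => phi (X w)).
Proof.
move=> cphi phiB; split; last first.
  by exists B => w Dw; apply: phiB; exact: rX.1.
apply: (@measurable_fun_cvg _ _ _ _ (fun k w => envelope phi k (X w))).
  by move=> k; exact: (measurable_plip (plip_envelope phiB k)).
by move=> w Dw; apply: (envelope_cvg phiB cphi); exact: rX.1.
Qed.

End random_paths.

(** Weak convergence need only be tested on the bounded functionals that are
    Lipschitz for the supremum norm over a bounded time interval. *)
Lemma portmanteau dT (T : measurableType dT) (R : realType) (d : nat)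
    (mu : probability T R) (D : set T) (X : nat -> T -> path_space R d)
    dO (O : measurableType dO) (P : probability O R) (Y : O -> path_space R d) :
  measurable D -> (forall n, rpath D (X n)) -> rpath setT Y ->
  (forall (phi : path_space R d -> R) N (K B : R), plip N K phi ->
     (forall x, Cpath R d x -> `|phi x| <= B) ->
     (fun n => \int[mu]_(w in D) phi (X n w)) @ \oo --> \int[P]_w phi (Y w)) ->
  forall phi : path_space R d -> R, {within Cpath R d, continuous phi} ->
    [bounded phi x | x in Cpath R d] ->
    (fun n => \int[mu]_(w in D) phi (X n w)) @ \oo --> \int[P]_w phi (Y w).
Proof.
move=> mD rX rY Hlip.
(* The lower envelopes of [phi] give the lower bound for [phi], and also, applied
   to [- phi], the upper bound. *)
have half (phi : path_space R d -> R) (B : R) : {within Cpath R d, continuous phi} ->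
    (forall x, Cpath R d x -> `|phi x| <= B) -> forall e : R, 0 < e ->
    \forall n \near \oo, \int[P]_w phi (Y w) - e <= \int[mu]_(w in D) phi (X n w).
  move=> cphi phiB e e0; have e20 : 0 < e / 2 by rewrite divr_gt0.
  have envY k := bmeas_plip measurableT rY (plip_envelope phiB k) (envelope_bound phiB k).
  have : (fun k => \int[P]_w envelope phi k (Y w)) @ \oo --> \int[P]_w phi (Y w).
    apply: (bounded_cvg _ (B := B)) => //.
    - by move=> k; case: (envY k).
    - by have [] := bmeas_continuous measurableT rY cphi phiB.
    - by move=> k w _; apply: (envelope_bound phiB); exact: rY.1.
    - by apply: aeW => w _; apply: (envelope_cvg phiB cphi); exact: rY.1.
  move/cvgrPdist_le/(_ _ e20) => [k _ /(_ k (leqnn k))]; rewrite ler_norml => /andP[_ Hk].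
  have /cvgrPdist_le/(_ _ e20) :=
    Hlip _ _ _ _ (plip_envelope phiB k) (envelope_bound phiB k).
  apply: filterS => n; rewrite ler_norml => /andP[_ Hn].
  have : \int[mu]_(w in D) envelope phi k (X n w) <= \int[mu]_(w in D) phi (X n w).
    apply: le_Rintegral_bmeas => //.
    - by have := bmeas_plip mD (rX n) (plip_envelope phiB k) (envelope_bound phiB k).
    - by have := bmeas_continuous mD (rX n) cphi phiB.
    - by move=> w Dw; apply: (envelope_le_self phiB); exact: (rX n).1.
  by move: Hk Hn; lra.
move=> phi cphi [M [_ /(_ (M + 1))]]; rewrite ltrDl ltr01 => /(_ isT) phiB.
have cN : {within Cpath R d, continuous (fun x : path_space R d => - phi x)}.
  by move=> x; apply: continuousN; exact: cphi.
have NB x : Cpath R d x -> `|- phi x| <= M + 1 by move=> Cx; rewrite normrN phiB.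
have bX n := bmeas_continuous mD (rX n) cphi phiB.
have bY := bmeas_continuous measurableT rY cphi phiB.
have intN d1 (T1 : measurableType d1) (mu1 : probability T1 R) (D1 : set T1) f :
    measurable D1 -> bmeas D1 f -> \int[mu1]_(w in D1) (- f w) = - \int[mu1]_(w in D1) f w.
  move=> mD1 bf; have := RintegralZl (-1) mD1 (bmeas_integrable mu1 mD1 bf).
  by under eq_Rintegral do rewrite mulN1r; rewrite mulN1r.
apply/cvgrPdist_le => e e0.
apply: filterS2 (half _ _ cphi phiB e e0) (half _ _ cN NB e e0) => n h1 h2.
rewrite !intN// in h2; rewrite ler_norml; apply/andP; split; lra.
Qed.

(** * Uniqueness in law of Brownian motion *)

Section brownian_law.
Variables (R : realType) (d : nat) (Q : 'M[R]_d).
Local Notation path := (path_space R d).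
Local Notation C := (Cpath R d).
Variables (phi : path -> R) (N : nat) (K B : R).
Hypothesis lphi : plip N K phi.
Hypothesis phiB : forall x, C x -> `|phi x| <= B.

Let n m := (N * m.+1).+1.

(** The path [Q w], at grid times, in terms of the increments [a] of [w]. *)
Definition increments_path m (a : 'I_(n m) * 'I_d -> R) : path :=
  fun t => interpolate
    (fun k => Q *m \col_i \sum_(j < n m | (j < k)%N) a (j, i)) (t * m.+1%:R).

Lemma fcontinuous_increments m : fcontinuous (fun a => phi (@increments_path m a)).
Proof.
have [c c0 Qc] := mulmx_norm_le Q.
apply: (@fcontinuous_lip _ _ _ (K * (c * (n m)%:R))) => a b r r0 ab.
rewrite -mulrA; apply: lphi; try exact: Cpath_interpolate.
move=> t tN; apply: interpolate_close => [|k _].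
  by case/andP: tN => t0 _; rewrite mulr_ge0.
rewrite -mulmxBr (le_trans (Qc _))// -mulrA ler_wpM2l ?(ltW c0)//.
apply: cV_norm_le => [|i]; first by rewrite mulr_ge0.
rewrite !mxE -sumrB (le_trans (ler_norm_sum _ _ _))//.
rewrite (@le_trans _ _ (\sum_(j < n m) r))//.
  rewrite [leRHS](bigID (fun j : 'I_(n m) => (j < k)%N))/= -[leLHS]addr0 lerD//.
    by apply: ler_sum => j _.
  exact: sumr_ge0.
by rewrite sumr_const card_ord mulr_natl.
Qed.

Context dO (O : measurableType dO) (P : probability O R) (W : O -> path).
Hypothesis bmW : brownian_motion P W.

(** The increments of [W] between consecutive grid times, by coordinates. *)
Definition increment m (ki : 'I_(n m) * 'I_d) (w : O) : R :=
  W w (ki.1.+1%:R / m.+1%:R) ki.2 ord0 - W w (ki.1%:R / m.+1%:R) ki.2 ord0.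

Lemma increments_path_cvg w : W w 0 = 0 ->
  (fun m => phi (increments_path (@increment m ^~ w))) @ \oo -->
    phi (fun t => Q *m W w t).
Proof.
have [[CW mW] _ _ _] := bmW => W0.
have CQ : C (fun t => Q *m W w t) := Cpath_mulmx Q (CW w).
apply: (plip_cvg lphi) => [m||e e0]; [exact: Cpath_interpolate|exact: CQ|].
apply: filterS (interpolate_grid_cvg N CQ e0) => m Hm t tN.
apply: le_trans (Hm t tN); rewrite le_eqVlt; apply/orP; left; apply/eqP.
have trN := truncn_grid_le m tN.
have node k : (k <= n m)%N -> \col_i \sum_(j < n m | (j < k)%N) @increment m (j, i) w
    = W w (k%:R / m.+1%:R).
  move=> kn; apply/colP => i; rewrite mxE.
  rewrite -(big_ord_widen_cond _ xpredT
    (fun j => W w (j.+1%:R / m.+1%:R) i ord0 - W w (j%:R / m.+1%:R) i ord0) kn).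
  rewrite -(big_mkord xpredT
    (fun j => W w (j.+1%:R / m.+1%:R) i ord0 - W w (j%:R / m.+1%:R) i ord0)).
  rewrite (telescope_sumr (fun j => W w (j%:R / m.+1%:R) i ord0))//.
  by rewrite mul0r W0 mxE subr0.
by rewrite /increments_path /interpolate /= !node// leqW.
Qed.

Lemma measurable_increment m ki : measurable_fun setT (@increment m ki).
Proof.
have [[CW mW] _ _ _] := bmW.
by apply: measurable_funB; apply: mW; rewrite divr_ge0.
Qed.

Lemma Rintegral_increments_cvg :
  (fun m => \int[P]_w phi (increments_path (@increment m ^~ w))) @ \oo -->
    \int[P]_w phi (fun t => Q *m W w t).
Proof.
have [[CW mW] W0 _ _] := bmW.
have rQ : rpath setT (fun w => (fun t => Q *m W w t) : path).
  split=> [w _|t t0 i]; first exact/Cpath_mulmx/CW.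
  under eq_fun do rewrite mxE.
  by apply: measurable_sum => j; apply: measurable_funM => //; exact: mW.
apply: (bounded_cvg _ (B := B)) => //.
- move=> m; exact: (measurable_fcontinuous measurableT (@measurable_increment m)
    (fcontinuous_increments (m := m))).
- by have := measurable_plip measurableT rQ lphi.
- by move=> m w _; apply: phiB; exact: Cpath_interpolate.
- by apply: filterS W0 => w W0 _; exact: increments_path_cvg.
Qed.

Lemma increment_rectangle m (A : 'I_(n m) * 'I_d -> set R) :
  (forall ki, measurable (A ki)) ->
  P (\bigcap_ki (@increment m ki @^-1` A ki)) =
  (\prod_ki normal_prob 0 (Num.sqrt (m.+1%:R^-1 : R)) (A ki))%E.
Proof.
move=> mA; have [_ _ nW iW] := bmW.
have := iW (n m) (fun k => k%:R / m.+1%:R).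
have -> : 0%:R / m.+1%:R = 0 :> R by rewrite mul0r.
have tS (k : nat) : k%:R / m.+1%:R < k.+1%:R / m.+1%:R :> R.
  by rewrite ltr_pM2r ?invr_gt0// ltr_nat.
move=> /(_ (lexx _) tS A mA) ->; apply: eq_bigr => -[k i] _.
have t0 : 0 <= k%:R / m.+1%:R :> R by rewrite divr_ge0.
have dt : m.+1%:R^-1 = k.+1%:R / m.+1%:R - k%:R / m.+1%:R :> R.
  by rewrite -mulrBl -[k.+1%:R]natr1 addrC addKr mul1r.
by rewrite [in RHS]dt -(nW _ _ i _ t0 (tS k) (mA (k, i))).
Qed.

End brownian_law.

(** All Brownian motions have the same law: the increments over a grid give the
    same probability to every rectangle, and a Lipschitz functional is the limit
    of functionals of finitely many increments. *)
Lemma brownian_eq_law (R : realType) (d : nat) (Q : 'M[R]_d)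
    (phi : path_space R d -> R) N (K B : R)
    dO (O : measurableType dO) (P : probability O R) (W : O -> path_space R d)
    dO' (O' : measurableType dO') (P' : probability O' R) (W' : O' -> path_space R d) :
  plip N K phi -> (forall x, Cpath R d x -> `|phi x| <= B) ->
  brownian_motion P W -> brownian_motion P' W' ->
  \int[P]_w phi (fun t => Q *m W w t) = \int[P']_w phi (fun t => Q *m W' w t).
Proof.
move=> lphi phiB bW bW'.
rewrite -(cvg_lim (@Rhausdorff R) (Rintegral_increments_cvg (Q := Q) lphi phiB bW)).
rewrite -(cvg_lim (@Rhausdorff R) (Rintegral_increments_cvg (Q := Q) lphi phiB bW')).
congr (lim (_ @ \oo)); apply/funext => m.
apply: (Rintegral_eq_law (B := B)
  (h := fun a => phi (increments_path Q (N := N) (m := m) a))).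
- exact: measurable_increment bW m.
- exact: measurable_increment bW' m.
- by move=> A mA; rewrite (increment_rectangle bW mA) (increment_rectangle bW' mA).
- exact: (@fcontinuous_increments R d Q phi N K lphi m).
- by move=> a; apply: phiB; exact: Cpath_interpolate.
Qed.

(** * Euler schemes *)

Section euler.
Variables (R : realType) (d : nat).
Local Notation V := 'cV[R]_d.
Local Notation path := (path_space R d).
Local Notation C := (Cpath R d).
Variables (F : V -> V) (xi : V) (m : nat).
Let h : R := m.+1%:R^-1.
Implicit Types (w x : path).

(** The Euler scheme with step [h = 1 / (m + 1)] for [x = xi + w + \int F(x)]:
    the sum approximating the integral, the values at the grid times, and the
    interpolated path. *)
Fixpoint euler_sum w k : V :=
  if k is j.+1 then
    euler_sum w j + h *: F (xi + w (j%:R / m.+1%:R) + euler_sum w j)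
  else 0.

Definition euler w k : V := xi + w (k%:R / m.+1%:R) + euler_sum w k.

Definition euler_path w : path := fun t => interpolate (euler w) (t * m.+1%:R).

Lemma euler_sumS w k : euler_sum w k.+1 = euler_sum w k + h *: F (euler w k).
Proof. by []. Qed.

Lemma Cpath_euler w : C (euler_path w).
Proof. exact: Cpath_interpolate. Qed.

Let h0 : 0 < h. Proof. by rewrite invr_gt0. Qed.
Let h1 : h <= 1. Proof. by rewrite invf_le1// ler1n. Qed.

Variables (L : R) (L0 : 0 <= L).
Hypothesis FL : forall x y : V, `|F x - F y| <= L * `|x - y|.

Variable N : nat.

(** A bound on the growth factor of errors under the scheme up to time [N + 1]. *)
Definition growth : R := N.+1%:R * expR (L * N.+1%:R).

Lemma growth_ge0 : 0 <= growth.
Proof. by rewrite mulr_ge0// expR_ge0. Qed.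

Let time_le k : (k <= (N * m.+1).+1)%N -> k%:R * h <= N.+1%:R.
Proof.
move=> kN; rewrite ler_pdivrMr// -natrM ler_nat (leq_trans kN)//.
by rewrite mulSn addnC addnS ltnS leq_addr.
Qed.

Lemma discrete_gronwall (b : nat -> R) (c : R) : 0 <= c -> b 0%N <= 0 ->
  (forall k, (k <= N * m.+1)%N -> b k.+1 <= (1 + L * h) * b k + c * h) ->
  forall k, (k <= (N * m.+1).+1)%N -> b k <= growth * c.
Proof.
move=> c0 b0 bS k kN.
have r1 : 1 <= 1 + L * h by rewrite lerDl mulr_ge0// ltW.
have bk j : (j <= (N * m.+1).+1)%N -> b j <= j%:R * (c * h) * (1 + L * h) ^+ j.
  elim: j => [|j IH] jN; first by rewrite !mul0r.
  have r0 : 0 <= (1 + L * h) ^+ j.+1 by rewrite exprn_ge0// (le_trans ler01).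
  apply: le_trans (bS j jN) _.
  have -> : j.+1%:R * (c * h) * (1 + L * h) ^+ j.+1 =
      (1 + L * h) * (j%:R * (c * h) * (1 + L * h) ^+ j) + c * h * (1 + L * h) ^+ j.+1.
    by rewrite -natr1 exprS; ring.
  rewrite lerD//; first by rewrite ler_wpM2l ?(le_trans ler01)// IH// ltnW.
  by rewrite ler_peMr ?mulr_ge0 ?(ltW h0)// exprn_ege1.
apply: le_trans (bk k kN) _.
have -> : k%:R * (c * h) = (k%:R * h) * c by rewrite mulrA mulrAC.
rewrite -mulrA mulrCA [leRHS]mulrC ler_wpM2l//.
have e1 : (1 + L * h) ^+ k <= expR (L * N.+1%:R).
  apply: (@le_trans _ _ (expR (L * h) ^+ k)).
    by rewrite lerXn2r ?nnegrE ?expR_ge0 ?(le_trans ler01)// expR_ge1Dx.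
  by rewrite -expRM_natl ler_expR mulrCA ler_wpM2l// time_le.
apply: le_trans (_ : N.+1%:R * (1 + L * h) ^+ k <= _).
  by rewrite ler_wpM2r ?time_le// exprn_ge0// (le_trans ler01).
by rewrite ler_wpM2l.
Qed.

(** Stability: a path that solves the equation up to an error [a], whose drift
    term [A] has the right increments up to [c * h], is close to the scheme. *)
Lemma euler_stable w (x : path) (A : nat -> V) (a c r : R) :
  0 <= c -> A 0%N = 0 ->
  (forall k, (k <= (N * m.+1).+1)%N ->
     `|x (k%:R / m.+1%:R) - (xi + w (k%:R / m.+1%:R) + A k)| <= a) ->
  (forall k, (k <= N * m.+1)%N ->
     `|A k.+1 - A k - h *: F (x (k%:R / m.+1%:R))| <= c * h) ->
  (forall s t : R, 0 <= s <= N.+1%:R -> 0 <= t <= N.+1%:R -> `|s - t| <= h ->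
     `|x s - x t| <= r) ->
  forall t : R, 0 <= t <= N%:R -> `|x t - euler_path w t| <= r + a + growth * (L * a + c).
Proof.
move=> c0 A0 xA AF xr.
have a0 : 0 <= a by apply: le_trans (xA 0%N _) => //.
have bk : forall k, (k <= (N * m.+1).+1)%N ->
    `|A k - euler_sum w k| <= growth * (L * a + c).
  apply: discrete_gronwall => [||k kN].
  - by rewrite addr_ge0// mulr_ge0.
  - by rewrite A0 subrr normr0.
  rewrite euler_sumS.
  have -> : A k.+1 - (euler_sum w k + h *: F (euler w k)) =
      (A k - euler_sum w k) + (A k.+1 - A k - h *: F (x (k%:R / m.+1%:R))) +
      h *: (F (x (k%:R / m.+1%:R)) - F (euler w k)).
    by apply/matrixP => i j; rewrite !mxE; ring.
  have xe : `|x (k%:R / m.+1%:R) - euler w k| <= a + `|A k - euler_sum w k|.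
    have -> : x (k%:R / m.+1%:R) - euler w k =
        (x (k%:R / m.+1%:R) - (xi + w (k%:R / m.+1%:R) + A k)) + (A k - euler_sum w k).
      by rewrite /euler; apply/matrixP => i j; rewrite !mxE; ring.
    by rewrite (le_trans (ler_normD _ _))// lerD// xA// ltnW.
  have Fe : `|h *: (F (x (k%:R / m.+1%:R)) - F (euler w k))| <=
      h * (L * (a + `|A k - euler_sum w k|)).
    rewrite normrZ gtr0_norm// ler_wpM2l ?(ltW h0)// (le_trans (FL _ _))//.
    by rewrite ler_wpM2l.
  have := AF k kN; move: Fe.
  have := ler_normD (A k - euler_sum w k + (A k.+1 - A k - h *: F (x (k%:R / m.+1%:R))))
    (h *: (F (x (k%:R / m.+1%:R)) - F (euler w k))).
  have := ler_normD (A k - euler_sum w k) (A k.+1 - A k - h *: F (x (k%:R / m.+1%:R))).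
  move: `|_ + _| `|_ + _| `|h *: _| `|_ - h *: _| `|A k - _| => n1 n2 n3 n4 n5.
  nra.
move=> t /andP[t0 tN].
have th0 : 0 <= t * m.+1%:R by rewrite mulr_ge0.
have trN : (Num.truncn (t * m.+1%:R) <= N * m.+1)%N by apply: truncn_grid_le; rewrite t0.
have node k : (k <= (N * m.+1).+1)%N ->
    `|x (k%:R / m.+1%:R) - euler w k| <= a + growth * (L * a + c).
  move=> kN; have -> : x (k%:R / m.+1%:R) - euler w k =
      (x (k%:R / m.+1%:R) - (xi + w (k%:R / m.+1%:R) + A k)) + (A k - euler_sum w k).
    by rewrite /euler; apply/matrixP => i j; rewrite !mxE; ring.
  by rewrite (le_trans (ler_normD _ _))// lerD ?xA ?bk.
pose y t := interpolate (fun k => x (k%:R / m.+1%:R)) (t * m.+1%:R).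
have -> : x t - euler_path w t = (x t - y t) + (y t - euler_path w t).
  by rewrite addrA subrK.
rewrite -[leRHS]addrA (le_trans (ler_normD _ _))// lerD//.
  have := truncn_itv th0.
  rewrite distrC.
  move: (interpolate_ball (u := fun k => x (k%:R / m.+1%:R)) (c := x t) (r := r) th0).
  move: (Num.truncn _) trN => k kN ball /andP[].
  rewrite -[k.+1%:R]natr1 -ler_pdivrMr// -ltr_pdivlMr// mulrDl mul1r => k1 k2.
  have tN1 : 0 <= t <= N.+1%:R by rewrite t0 (le_trans tN)// ler_nat.
  have kh : 0 <= (k%:R / m.+1%:R : R) by rewrite divr_ge0.
  apply: ball; apply: xr => //.
  - by rewrite kh; apply: time_le; rewrite leqW.
  - by move: k1 k2 h0; rewrite /h; move: (m.+1%:R^-1 : R) => u *;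
      rewrite ler_norml; apply/andP; split; lra.
  - by rewrite divr_ge0//=; apply: time_le.
  - rewrite -[k.+1%:R]natr1 mulrDl mul1r; move: k1 k2 h0; rewrite /h; move: (m.+1%:R^-1 : R) => u *.
    by rewrite ler_norml; apply/andP; split; lra.
apply: interpolate_close => // k kN; apply: node; exact: leq_trans kN _.
Qed.

End euler.

(** * The slow variables follow the Euler scheme *)

Section slow_euler.
Variables (R : realType) (d : nat).
Local Notation V := 'cV[R]_d.
Local Notation path := (path_space R d).
Variables (F : V -> V) (fb : nat -> V -> V) (xi : V) (L B : R) (N m : nat).
Hypothesis L0 : 0 <= L.
Hypothesis B0 : 0 <= B.
Hypothesis FL : forall x y : V, `|F x - F y| <= L * `|x - y|.
Hypothesis FB : forall x, `|F x| <= B.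
Hypothesis fbL : forall j (x y : V), `|fb j x - fb j y| <= L * `|x - y|.
Let h : R := m.+1%:R^-1.

Let h0 : 0 < h. Proof. by rewrite invr_gt0. Qed.
Let h1 : h <= 1. Proof. by rewrite invf_le1// ler1n. Qed.

(** The constant of the final estimate. *)
Definition slow_const : R :=
  3 + 2 * (B + 1) + growth L N * (4 * L + 3 * B + 6 + 4 * L * (B + 1)).

Lemma slow_const_ge1 : 1 <= slow_const.
Proof.
have g0 := growth_ge0 L N.
rewrite /slow_const -[leLHS]addr0 !lerD//; last first.
  by rewrite mulr_ge0// !addr_ge0// !mulr_ge0// addr_ge0.
by rewrite -[leLHS]addr0 lerD ?ler1n// mulr_ge0// addr_ge0.
Qed.

(** The slow variables [x] move by a fast term [e * s] and a drift [e ^ 2 * q];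
    the drift is close to [fb], which depends on the time and on the slow variable
    and whose time averages, at a fixed value of the slow variable, are close to
    [F]. The path [w] is that of the normalised sums of [s], at [n] steps per unit
    of time; [om] bounds its oscillation at the scale [h]. *)
Variables (x s q : nat -> V) (e : R) (n : nat) (om : R).
Hypothesis e0 : 0 < e.
Hypothesis eh : e ^+ 2 <= h ^+ 2.
Hypothesis ne : n = Num.truncn (e ^- 2).
Hypothesis nh : N.+1%:R <= h * n%:R.
Hypothesis x0 : x 0%N = xi.
Hypothesis xS : forall j, x j.+1 = x j + e *: s j + e ^+ 2 *: q j.
Hypothesis qB : forall j, `|q j| <= B + 1.
Hypothesis qfb : forall j, `|q j - fb j (x j)| <= h.
Hypothesis erg : forall v k, k%:R * e ^+ 2 <= N.+1%:R ->
  e ^+ 2 * `|\sum_(j < k) (fb j v - F v)| <= h ^+ 2.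

(* [xh = xi + u + Ah]: the fast term [u] is [w] up to a change of scales, and [Ah]
   is the accumulated drift. *)
Let S (k : nat) : V := \sum_(j < k) s j.
Let A (k : nat) : V := e ^+ 2 *: \sum_(j < k) q j.
Let w : path := fun t => (Num.sqrt n%:R)^-1 *: interpolate S (n%:R * t).
Let xh : path := fun t => interpolate x (t * e ^- 2).
Let Ah (t : R) : V := interpolate A (t * e ^- 2).
Let u (t : R) : V := e *: interpolate S (t * e ^- 2).

Hypothesis w_mod : forall t1 t2 : R, 0 <= t1 <= N.+2%:R -> 0 <= t2 <= N.+2%:R ->
  `|t1 - t2| <= 4 * h -> `|w t1 - w t2| <= om.
Hypothesis w_bound : forall t : R, 0 <= t <= N.+2%:R -> h * `|w t| <= om.

Let E0 : 0 < e ^+ 2. Proof. by rewrite exprn_gt0. Qed.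
Let Ei : e ^+ 2 * e ^- 2 = 1. Proof. by rewrite divff// gt_eqF. Qed.
Let Eh : e ^+ 2 <= h.
Proof. by rewrite (le_trans eh)// expr2 ler_piMr// ltW. Qed.
Let n0 : 0 < n%:R :> R.
Proof. by rewrite -(pmulr_rgt0 _ h0) (lt_le_trans _ nh). Qed.
Let nE : n%:R <= e ^- 2 < n%:R + 1.
Proof. by have := truncn_itv (ltW (_ : 0 < e ^- 2)); rewrite -ne invr_gt0 natr1; apply. Qed.

(** Ratio between the rescaled times of [xh] and [w]. *)
Let kap : R := e ^- 2 / n%:R.

Let kap_ge1 : 1 <= kap.
Proof. by rewrite ler_pdivlMr// mul1r; case/andP: nE. Qed.

Let kap_dist (t : R) : 0 <= t <= N.+1%:R -> 0 <= kap * t - t <= h.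
Proof.
move=> /andP[t0 tN]; rewrite -[X in _ - X]mul1r -mulrBl mulr_ge0 ?subr_ge0//=.
have k1 : kap - 1 <= n%:R^-1.
  rewrite lerBlDl /kap ler_pdivrMr// mulrDl mul1r mulVf ?gt_eqF//.
  by case/andP: nE => _ /ltW.
apply: (@le_trans _ _ (n%:R^-1 * N.+1%:R)).
  by rewrite ler_pM ?subr_ge0.
by rewrite mulrC ler_pdivrMr.
Qed.

Let kap_le2 : kap <= 2.
Proof.
have /andP[_] : 0 <= kap * 1 - 1 <= h by apply: kap_dist; rewrite ler01 ler1n.
rewrite mulr1 lerBlDl => k2; rewrite (le_trans k2)//.
by rewrite -[leRHS]/(1 + 1) lerD2l.
Qed.

Let kap_time (t : R) : 0 <= t <= N.+1%:R -> 0 <= kap * t <= N.+2%:R.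
Proof.
move=> tN; have /andP[k0 kh] := kap_dist tN; case/andP: tN => t0 tN.
rewrite -[N.+2%:R]natr1; move: kh k0 h1 t0 tN; move: (kap * t) N.+1%:R => a b *.
by apply/andP; split; lra.
Qed.

(** Ratio between the rescaled amplitudes of [xh] and [w]. *)
Let c1 : R := e * Num.sqrt n%:R.

Let c1_sqr : c1 ^+ 2 = e ^+ 2 * n%:R.
Proof. by rewrite exprMn sqr_sqrtr// ltW. Qed.

Let c1_ge0 : 0 <= c1. Proof. by apply: mulr_ge0; [exact: ltW|exact: sqrtr_ge0]. Qed.

Let c1_le1 : c1 <= 1.
Proof.
rewrite -(@ler_sqr _ c1 1) ?nnegrE// c1_sqr expr1n -[leRHS]Ei.
by rewrite ler_wpM2l ?(ltW E0)//; case/andP: nE.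
Qed.

Let c1_dist : 1 - c1 <= h.
Proof.
have : e ^+ 2 * e ^- 2 <= e ^+ 2 * (n%:R + 1).
  by rewrite ler_wpM2l ?(ltW E0)//; case/andP: nE => _ /ltW.
rewrite Ei mulrDr mulr1 -c1_sqr.
have : c1 ^+ 2 <= c1 by rewrite expr2 ler_piMr.
by move: Eh; lra.
Qed.

Let u_w t : u t = c1 *: w (kap * t).
Proof.
rewrite /u /w /c1 scalerA -mulrA divff ?mulr1 ?gt_eqF ?sqrtr_gt0//.
congr (_ *: interpolate S _); rewrite /kap mulrA mulrCA divff ?mulr1 ?gt_eqF//.
by rewrite mulrC.
Qed.

Let om0 : 0 <= om.
Proof.
apply: le_trans (w_bound (t := 0) _); first by rewrite mulr_ge0// ltW.
by rewrite lexx/=.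
Qed.

Let time_weaken (t : R) : 0 <= t <= N.+1%:R -> 0 <= t <= N.+2%:R.
Proof. by move=> /andP[-> tN] /=; rewrite (le_trans tN)// ler_nat. Qed.

Let u_close (t : R) : 0 <= t <= N.+1%:R -> `|u t - w t| <= 2 * om.
Proof.
move=> tN; have -> : u t - w t = c1 *: (w (kap * t) - w t) - (1 - c1) *: w t.
  by rewrite u_w; apply/matrixP => i j; rewrite !mxE; ring.
rewrite (le_trans (ler_normB _ _))//.
rewrite [`|c1 *: _|]normrZ [`|(1 - c1) *: _|]normrZ.
rewrite [`|c1|]ger0_norm// [`|1 - c1|]ger0_norm ?subr_ge0// mulr_natl mulr2n lerD//.
  apply: (@le_trans _ _ `|w (kap * t) - w t|); first by rewrite ler_piMl.
  apply: w_mod; [exact: kap_time|exact: time_weaken|].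
  have /andP[k0 kh] := kap_dist tN.
  by rewrite ger0_norm// (le_trans kh)// ler_peMl ?ler1n// ltW.
by apply: le_trans (w_bound (time_weaken tN)); rewrite ler_wpM2r.
Qed.

Let u_mod (t1 t2 : R) : 0 <= t1 <= N.+1%:R -> 0 <= t2 <= N.+1%:R ->
  `|t1 - t2| <= 2 * h -> `|u t1 - u t2| <= om.
Proof.
move=> t1N t2N t12; rewrite !u_w -scalerBr normrZ (ger0_norm c1_ge0).
apply: (@le_trans _ _ `|w (kap * t1) - w (kap * t2)|); first by rewrite ler_piMl.
apply: w_mod; [exact: kap_time|exact: kap_time|].
have kap0 := le_trans ler01 kap_ge1.
rewrite -mulrBr normrM (ger0_norm kap0).
have -> : 4 * h = 2 * (2 * h) by ring.
by rewrite ler_pM.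
Qed.

Let Ah_lip (t1 t2 : R) : 0 <= t1 -> t1 <= t2 -> `|Ah t2 - Ah t1| <= (B + 1) * (t2 - t1).
Proof.
move=> t10 t12; rewrite /Ah.
have i0 : 0 <= e ^- 2 by rewrite invr_ge0 ltW.
have := @interpolate_dist _ _ A (t1 * e ^- 2) (t2 * e ^- 2)
  (Num.truncn (t2 * e ^- 2)).+1 (e ^+ 2 * (B + 1)).
rewrite -mulrBl mulrACA -mulrA => H.
have -> : (B + 1) * (t2 - t1) = e ^+ 2 * ((B + 1) * (t2 - t1) * e ^- 2).
  by rewrite mulrCA Ei mulr1.
apply: le_trans (H _ _ _ _) _; rewrite ?mulr_ge0 ?ler_wpM2r//.
- by rewrite ltW// truncnS_gt.
- move=> k _; rewrite /A -scalerBr normrZ (gtr0_norm E0) ler_wpM2l ?(ltW E0)//.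
  by rewrite big_ord_recr/= addrAC subrr add0r.
- by rewrite [(B + 1) * (t2 - t1)]mulrC -[(t2 - t1) * (B + 1) / _]mulrA.
Qed.

Let xE k : x k = xi + e *: S k + A k.
Proof.
elim: k => [|k IH]; first by rewrite /S /A !big_ord0 !scaler0 !addr0.
rewrite xS IH /S /A !big_ord_recr/= !scalerDr.
by apply/matrixP => i j; rewrite !mxE; ring.
Qed.

Let xhE t : xh t = xi + u t + Ah t.
Proof.
rewrite /xh /u /Ah /interpolate !xE.
by apply/matrixP => i j; rewrite !mxE; ring.
Qed.

Let r : R := om + (B + 1) * (2 * h).

Let xh_mod (t1 t2 : R) : 0 <= t1 <= N.+1%:R -> 0 <= t2 <= N.+1%:R ->
  `|t1 - t2| <= 2 * h -> `|xh t1 - xh t2| <= r.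
Proof.
move=> t1N t2N t12; rewrite !xhE.
have -> : xi + u t1 + Ah t1 - (xi + u t2 + Ah t2) = (u t1 - u t2) + (Ah t1 - Ah t2).
  by apply/matrixP => i j; rewrite !mxE; ring.
rewrite (le_trans (ler_normD _ _))// lerD ?u_mod//.
have B10 : 0 <= B + 1 by rewrite addr_ge0.
case/andP: t1N => t10 _; case/andP: t2N => t20 _.
have [t12'|/ltW t21] := leP t1 t2.
  rewrite distrC (le_trans (Ah_lip _ _))// ler_wpM2l//.
  by rewrite distrC in t12; exact: le_trans (ler_norm _) t12.
by rewrite (le_trans (Ah_lip _ _))// ler_wpM2l// (le_trans (ler_norm _)).
Qed.

(** The averaging step: over one step of the scheme the drift of the slow
    variables is [h F] up to a small multiple of [h]. *)
Let c : R := 2 * (B + 1) * h + 2 * (h + L * r) + 2 * h + B * h.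

Let drift_step k : (k <= N * m.+1)%N ->
  `|Ah (k.+1%:R / m.+1%:R) - Ah (k%:R / m.+1%:R) - h *: F (xh (k%:R / m.+1%:R))|
    <= c * h.
Proof.
move=> kN; set v := xh _.
have tau0 : 0 <= (k%:R / m.+1%:R : R) by rewrite divr_ge0.
have tauN : (k%:R / m.+1%:R : R) <= N%:R by rewrite ler_pdivrMr// -natrM ler_nat.
have -> : k.+1%:R / m.+1%:R = k%:R / m.+1%:R + h by rewrite -[k.+1%:R]natr1 mulrDl mul1r.
move: (k%:R / m.+1%:R) @v tau0 tauN => tau v tau0 tauN.
have tauhN : tau + h <= N.+1%:R by rewrite -natr1 lerD.
have floorP (t : R) : 0 <= t -> (Num.truncn (t * e ^- 2))%:R * e ^+ 2 <= t <
    (Num.truncn (t * e ^- 2))%:R * e ^+ 2 + e ^+ 2.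
  move=> t0; have i0 : 0 <= t * e ^- 2 by rewrite mulr_ge0// invr_ge0 ltW.
  have := truncn_itv i0; rewrite -natr1.
  by rewrite -[X in _ -> _ <= _ < _ + X]mul1r -mulrDl -ler_pdivlMr// -ltr_pdivrMr//.
have AhA j : Ah (j%:R * e ^+ 2) = A j.
  by rewrite /Ah -mulrA Ei mulr1 interpolate_nat.
have xhx j : xh (j%:R * e ^+ 2) = x j.
  by rewrite /xh -mulrA Ei mulr1 interpolate_nat.
have Afloor (t : R) : 0 <= t -> `|Ah t - A (Num.truncn (t * e ^- 2))| <= (B + 1) * e ^+ 2.
  move=> t0; have /andP[f1 f2] := floorP t t0; rewrite -AhA.
  apply: le_trans (Ah_lip _ f1) _; first by rewrite mulr_ge0// ltW.
  by rewrite ler_wpM2l ?addr_ge0// lerBlDl ltW.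
have tauh0 : 0 <= tau + h by rewrite addr_ge0// ltW.
have := Afloor _ tau0; have := Afloor _ tauh0.
have := floorP _ tau0; have := floorP _ tauh0.
have PP : (Num.truncn (tau * e ^- 2) <= Num.truncn ((tau + h) * e ^- 2))%N.
  by apply: le_truncn; rewrite ler_wpM2r ?invr_ge0 ?(ltW E0)// lerDl ltW.
move: (Num.truncn _) (Num.truncn _) PP => P' P PP /andP[P'1 P'2] /andP[P1 P2] AP' AP.
have len : (P' - P)%:R * e ^+ 2 = P'%:R * e ^+ 2 - P%:R * e ^+ 2.
  by rewrite natrB// mulrBl.
have len_h : `|(P' - P)%:R * e ^+ 2 - h| <= e ^+ 2.
  by rewrite len ler_norml; apply/andP; split; lra.
have len_2h : (P' - P)%:R * e ^+ 2 <= 2 * h by rewrite len; move: Eh; lra.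
(* Between the times [tau] and [tau + h] the fast steps are those from [P] to
   [P']. Freeze the slow variable at [v], average, and correct the length. *)
have dec : A P' - A P - h *: F v =
    e ^+ 2 *: \sum_(P <= j < P') (q j - fb j v) +
    e ^+ 2 *: \sum_(P <= j < P') (fb j v - F v) +
    ((P' - P)%:R * e ^+ 2 - h) *: F v.
  rewrite -scalerDr -big_split/=.
  rewrite (eq_bigr (fun j => q j - F v)) => [|j _]; last by rewrite addrA subrK.
  rewrite sumrB sumr_const_nat scalerBr -scalerMnr.
  rewrite scalerBl -[X in _ + (X - _)]scalerA scaler_nat.
  rewrite /A -scalerBr -(big_mkord xpredT q) -(big_mkord xpredT q).
  rewrite (@big_cat_nat _ _ _ P 0 P')//= [_ + \sum_(P <= _ < _) _]addrC addrK.
  by rewrite addrA subrK.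
have n1 : `|e ^+ 2 *: \sum_(P <= j < P') (q j - fb j v)| <= 2 * h * (h + L * r).
  rewrite normrZ (gtr0_norm E0).
  apply: (@le_trans _ _ (e ^+ 2 * ((P' - P)%:R * (h + L * r)))).
    rewrite ler_wpM2l ?(ltW E0)// (le_trans (ler_norm_sum _ _ _))//.
    rewrite [leRHS]mulr_natl -sumr_const_nat.
    rewrite !big_nat; apply: ler_sum => j /andP[Pj jP'].
    have -> : q j - fb j v = (q j - fb j (x j)) + (fb j (x j) - fb j v).
      by rewrite addrA subrK.
    rewrite (le_trans (ler_normD _ _))// lerD// (le_trans (fbL _ _ _))// ler_wpM2l//.
    rewrite -xhx; apply: xh_mod.
    - rewrite mulr_ge0 ?(ltW E0)//= (le_trans _ tauhN)// (le_trans _ P'1)//.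
      by rewrite ler_wpM2r ?(ltW E0)// ler_nat ltnW.
    - by rewrite tau0 (le_trans tauN)// ler_nat.
    - have Pj' : P%:R * e ^+ 2 <= j%:R * e ^+ 2.
        by rewrite ler_wpM2r ?(ltW E0)// ler_nat.
      have jP'' : j%:R * e ^+ 2 <= P'%:R * e ^+ 2.
        by rewrite ler_wpM2r ?(ltW E0)// ler_nat ltnW.
      by rewrite ler_norml; apply/andP; split; move: Eh h0; lra.
  rewrite mulrA [e ^+ 2 * _]mulrC ler_wpM2r//.
  by rewrite addr_ge0 ?(ltW h0)// mulr_ge0// addr_ge0// !mulr_ge0 ?addr_ge0// ltW.
have n2 : `|e ^+ 2 *: \sum_(P <= j < P') (fb j v - F v)| <= 2 * h ^+ 2.
  have -> : e ^+ 2 *: \sum_(P <= j < P') (fb j v - F v) =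
      e ^+ 2 *: (\sum_(j < P') (fb j v - F v)) - e ^+ 2 *: (\sum_(j < P) (fb j v - F v)).
    rewrite -scalerBr -(big_mkord xpredT (fun j => fb j v - F v)).
    rewrite -(big_mkord xpredT (fun j => fb j v - F v)).
    by rewrite (@big_cat_nat _ _ _ P 0 P')//= [_ + \sum_(P <= _ < _) _]addrC addrK.
  rewrite (le_trans (ler_normB _ _))// normrZ [X in _ + X]normrZ (gtr0_norm E0) mulr_natl mulr2n.
  rewrite lerD// erg// (le_trans _ tauhN)//.
  by rewrite (le_trans P1)// lerDl ltW.
have n3 : `|((P' - P)%:R * e ^+ 2 - h) *: F v| <= h ^+ 2 * B.
  by rewrite normrZ ler_pM// (le_trans len_h).
have -> : Ah (tau + h) - Ah tau - h *: F v =
    (Ah (tau + h) - A P') - (Ah tau - A P) + (A P' - A P - h *: F v).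
  by apply/matrixP => i j; rewrite !mxE; ring.
rewrite dec.
have tri (a1 a2 a3 a4 a5 : V) : `|a1 - a2 + (a3 + a4 + a5)| <=
    `|a1| + `|a2| + (`|a3| + `|a4| + `|a5|).
  rewrite (le_trans (ler_normD _ _))// lerD ?ler_normB//.
  by rewrite (le_trans (ler_normD _ _))// lerD2r ler_normD.
apply: le_trans (tri _ _ _ _ _) _.
have BE : (B + 1) * e ^+ 2 <= (B + 1) * h ^+ 2 by rewrite ler_wpM2l// addr_ge0.
have -> : c * h = (B + 1) * h ^+ 2 + (B + 1) * h ^+ 2 +
    (2 * h * (h + L * r) + 2 * h ^+ 2 + h ^+ 2 * B) by rewrite /c expr2; ring.
by rewrite !lerD// (le_trans _ BE).
Qed.

Lemma slow_euler (t : R) : 0 <= t <= N%:R ->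
  `|xh t - euler_path F xi m w t| <= slow_const * (om + h).
Proof.
have g0 := growth_ge0 L N.
have r0 : 0 <= r by rewrite addr_ge0// !mulr_ge0 ?addr_ge0// ltW.
move=> tN; apply: le_trans (@euler_stable _ _ F xi m L L0 FL N w xh
  (fun k => Ah (k%:R / m.+1%:R)) (2 * om) c r _ _ _ _ _ t tN) _.
- rewrite /c !addr_ge0// ?mulr_ge0 ?addr_ge0 ?mulr_ge0 ?(ltW h0)//.
- by rewrite mul0r /Ah mul0r (interpolate_nat A 0) /A big_ord0 scaler0.
- move=> k kN; rewrite xhE.
  have -> : xi + u (k%:R / m.+1%:R) + Ah (k%:R / m.+1%:R) -
      (xi + w (k%:R / m.+1%:R) + Ah (k%:R / m.+1%:R)) =
      u (k%:R / m.+1%:R) - w (k%:R / m.+1%:R).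
    by apply/matrixP => i j; rewrite !mxE; ring.
  apply: u_close; rewrite divr_ge0//= ler_pdivrMr// -natrM ler_nat (leq_trans kN)//.
  by rewrite mulSn addnC addnS ltnS leq_addr.
- by move=> k kN; exact: drift_step.
- move=> t1 t2 t1N t2N t12; apply: xh_mod => //.
  by rewrite (le_trans t12)// ler_peMl ?ler1n// ltW.
have hl : 2 * L * om + c <= (4 * L + 3 * B + 6 + 4 * L * (B + 1)) * (om + h).
  have oL : 0 <= om * (L * (B + 1)) by rewrite !mulr_ge0// addr_ge0.
  have oB : 0 <= om * (3 * B + 6) by rewrite !mulr_ge0// !addr_ge0// mulr_ge0.
  have hL : 0 <= h * L by rewrite mulr_ge0// ltW.
  have hB : 0 <= h * B by rewrite mulr_ge0// ltW.
  by rewrite /c /r; lra.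
rewrite /slow_const [leRHS]mulrDl; apply: lerD.
  have oB : 0 <= om * B by rewrite mulr_ge0.
  by rewrite /r; move: h0 om0; lra.
by rewrite -[leRHS]mulrA ler_wpM2l// mulrA (mulrC L 2).
Qed.

End slow_euler.

(** * Truncation and Lipschitz bounds on compact sets *)

Section clamp.
Variables (R : realType) (d : nat).
Implicit Types (x y : 'cV[R]_d) (r : R).

(** The coordinatewise projection onto the ball of radius [r], for the maximum
    norm. *)
Definition clamp r x : 'cV[R]_d := \col_i Num.max (- r) (Num.min r (x i ord0)).

Lemma clamp_bound r x : 0 <= r -> `|clamp r x| <= r.
Proof.
move=> r0; apply: cV_norm_le => // i; rewrite mxE ler_norml le_max lexx/=.
by rewrite ge_max ge_min lexx/= andbT (le_trans _ r0)// oppr_le0.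
Qed.

Lemma clamp_id r x : `|x| <= r -> clamp r x = x.
Proof.
move=> xr; apply/colP => i; rewrite mxE.
have := le_trans (cV_coord_le x i) xr; rewrite ler_norml => /andP[x1 x2].
by rewrite min_r// max_r.
Qed.

Lemma clamp_lip r x y : `|clamp r x - clamp r y| <= `|x - y|.
Proof.
apply: cV_norm_le => // i; rewrite !mxE.
have := cV_coord_le (x - y) i; rewrite !mxE; move: `|x - y| (x i ord0) (y i ord0).
move=> n a b; rewrite !ler_norml => /andP[h1 h2].
have n0 : 0 <= n by lra.
case: (leP r a) => ra; case: (leP r b) => rb;
  rewrite /Num.max; (repeat case: ifPn => ?); apply/andP; split; lra.
Qed.

Lemma clamp_clamp r x : 0 <= r -> clamp r (clamp r x) = clamp r x.
Proof. by move=> r0; rewrite clamp_id// clamp_bound. Qed.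

Lemma compact_ball r : compact [set x : 'cV[R]_d | `|x| <= r].
Proof.
have [r0|rlt0] := leP 0 r; last first.
  rewrite (_ : mkset _ = set0); first exact: compact0.
  by apply/seteqP; split=> x //= xr; move: rlt0; rewrite ltNge (le_trans _ xr).
have cpt : compact [set v : 'rV[R]_d | forall i, `[- r, r]%classic (v ord0 i)].
  by apply: (@rV_compact R d (fun=> `[- r, r]%classic)) => i; exact: segment_compact.
have ctr : {within [set v : 'rV[R]_d | forall i, `[- r, r]%classic (v ord0 i)],
    continuous (fun v : 'rV[R]_d => v^T)}.
  apply: continuous_subspaceT => v A /nbhs_ballP[e e0 eA].
  apply/nbhs_ballP; exists e => // u [_ vu]; apply: eA; split => // i j.
  by rewrite !mxE; exact: vu.
rewrite (_ : mkset _ = (fun v : 'rV[R]_d => v^T) @`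
    [set v : 'rV[R]_d | forall i, `[- r, r]%classic (v ord0 i)]).
  exact: continuous_compact ctr cpt.
apply/seteqP; split=> [x /= xr|_ [v /= vr <-]].
  exists x^T; last by rewrite trmxK.
  move=> i; rewrite mxE /= in_itv/= -ler_norml; exact: le_trans (cV_coord_le x i) xr.
by apply: cV_norm_le => // i; have := vr i; rewrite mxE /= in_itv/= -ler_norml.
Qed.

End clamp.

Section lipschitz_compact.
Variables (R : realType) (V W : normedModType R).

(** On a compact set, a locally Lipschitz function is Lipschitz. *)
Lemma locally_lipschitz_compact (f : V -> W) (A A' : set V) :
  compact A -> A `<=` A' -> [locally [lipschitz f x | x in A']] ->
  exists2 K : R, 0 <= K & forall x y, A x -> A y -> `|f x - f y| <= K * `|x - y|.
Proof.
move=> cA AA' lf.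
have cAA : compact (A `*` A) by exact: compact_setX.
move/compact_near_coveringP : cAA => /(_ R (+oo : set_system R)
  (fun K (p : V * V) => (A `*` A) p -> `|f p.1 - f p.2| <= K * `|p.1 - p.2|) _) cov.
have : \forall K \near (+oo : set_system R), A `*` A `<=` (fun p : V * V =>
    (A `*` A) p -> `|f p.1 - f p.2| <= K * `|p.1 - p.2|).
  apply: cov => p [Ap1 Ap2].
  have [M [Mr HM]] := lf p (conj (AA' _ Ap1) (AA' _ Ap2)).
  have MM : M < M + 1 by rewrite ltrDl.
  have HM' : \forall q \near p, (A' `*` A') q ->
      `|f q.1 - f q.2| <= (M + 1) * `|q.1 - q.2| by exact: HM MM.
  near=> q K => -[/= Aq1 Aq2].
  have Hq : (A' `*` A') q -> `|f q.1 - f q.2| <= (M + 1) * `|q.1 - q.2|.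
    by near: q; exact: HM'.
  apply: (@le_trans _ _ ((M + 1) * `|q.1 - q.2|)).
    by apply: Hq; split; exact: AA'.
  by rewrite ler_wpM2r//; near: K; apply: nbhs_pinfty_ge; exact: num_real.
move=> [M [Mr HM]]; exists (Num.max 0 (M + 1)); first by rewrite le_max lexx.
move=> x y Ax Ay; apply: (HM _ _ (x, y)) => //.
by rewrite lt_max ltrDl ltr01 orbT.
Unshelve. all: by end_near. Qed.

Lemma lipschitz_compact_bounded (f : V -> W) (A : set V) (K : R) :
  compact A -> 0 <= K -> (forall x y, A x -> A y -> `|f x - f y| <= K * `|x - y|) ->
  exists2 B : R, 0 <= B & forall x, A x -> `|f x| <= B.
Proof.
move=> cA K0 fK; have [[a Aa]|nA] := pselect (exists a, A a); last first.
  by exists 0 => // x Ax; exfalso; apply: nA; exists x.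
have [M [_ /(_ (M + 1))]] := compact_bounded cA; rewrite ltrDl ltr01 => /(_ isT) AM.
have M0 : 0 <= M + 1 by exact: le_trans (AM a Aa).
exists (`|f a| + K * (M + 1 + (M + 1))) => [|x Ax].
  by rewrite !addr_ge0// mulr_ge0// addr_ge0.
rewrite -(subrK (f a) (f x)) (le_trans (ler_normD _ _))// addrC lerD2l.
rewrite (le_trans (fK _ _ Ax Aa))// ler_wpM2l// (le_trans (ler_normB _ _))//.
by rewrite lerD// AM.
Qed.

End lipschitz_compact.

(** * Measurability on a compact set of states *)

Section borel_compact.
Variables (R : realType) (l : nat) (Lambda : set 'cV[R]_l).
Hypothesis cL : compact Lambda.
Local Notation B := (borel 'cV[R]_l).

Lemma measurable_compact : measurable (Lambda : set B).
Proof.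
have clL : closed Lambda by apply: compact_closed => //; exact: norm_hausdorff.
rewrite -(setCK (Lambda : set B)); apply: measurableC.
by apply: sub_sigma_algebra; exact: closed_openC.
Qed.

Lemma measurable_lipschitz_on (k : 'cV[R]_l -> R) (K : R) : 0 <= K ->
  (forall x y, Lambda x -> Lambda y -> `|k x - k y| <= K * `|x - y|) ->
  measurable_fun (Lambda : set B) (k : B -> R).
Proof.
move=> K0 kK; have mL := measurable_compact.
apply: (measurability _ (RGenOpens.measurableE R)).
move=> _ [_ [a [b ->] <-]].
have ck : {within Lambda, continuous k}.
  apply/subspace_continuousP => x Lx; apply/cvgrPdist_lt => e e0.
  rewrite near_withinE; have K1 : 0 < K + 1 by rewrite ltr_wpDl.
  apply/nbhs_ballP; exists (e / (K + 1)); first by rewrite /= divr_gt0.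
  move=> y; rewrite -ball_normE /= ltr_pdivlMr// => xy Ly.
  apply: le_lt_trans (kK _ _ Lx Ly) _; apply: le_lt_trans xy.
  by rewrite mulrC ler_wpM2l// lerDl.
have oab : open (`]a, b[%classic : set R) by exact: interval_open.
move/continuousP/(_ _ oab)/open_subspaceP : ck => [U oU UL].
rewrite setIC -UL; apply: measurableI => //; exact: sub_sigma_algebra.
Qed.

End borel_compact.

Lemma ae_forall_count d (T : measurableType d) (R : realType)
    (mu : {measure set T -> \bar R}) (I : countType) (P : I -> T -> Prop) :
  (forall i, \forall x \ae mu, P i x) -> \forall x \ae mu, forall i, P i x.
Proof.
move=> H.
have : \forall x \ae mu, forall n : nat, if unpickle n is Some i then P i x else True.
  by apply: ae_foralln => n; case: unpickle => [i|]; [exact: H|exact: aeW].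
by apply: filterS => x Hx i; have := Hx (pickle i); rewrite pickleK.
Qed.

(** * The fast-slow system *)

Section fast_slow_system.
Variables (R : realType) (l d : nat).
Variables (Lambda : set 'cV[R]_l) (g : 'cV[R]_l -> 'cV[R]_l).
Variable mu : probability (borel 'cV[R]_l) R.
Variables (f0 : 'cV[R]_l -> 'cV[R]_d) (f : 'cV[R]_d -> 'cV[R]_l -> R -> 'cV[R]_d).
Variable xi : 'cV[R]_d.
Local Notation B := (borel 'cV[R]_l).
Local Notation L := (Lambda : set B).
Local Notation path := (path_space R d).
Hypothesis cL : compact Lambda.
Hypothesis esys : ergodic_system Lambda g mu.
Hypothesis lf0 : [locally [lipschitz f0 y | y in Lambda]].
Hypothesis lf : forall e : R,
  [locally [lipschitz f p.1 p.2 e | p in [set: 'cV[R]_d] `*` Lambda]].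

Let mL : measurable L := measurable_compact cL.
Let mu1 : mu L = 1%E. Proof. by case: esys. Qed.
Let gL : forall y, Lambda y -> Lambda (g y). Proof. by case: esys. Qed.
Let mg : measurable_fun L (g : B -> B). Proof. by case: esys. Qed.
Let gmu : forall A : set B, measurable A -> A `<=` L -> mu (L `&` g @^-1` A) = mu A.
Proof. by case: esys. Qed.
Let gerg : forall A : set B, measurable A -> A `<=` L ->
  L `&` g @^-1` A = A -> mu A = 0%E \/ mu A = 1%E.
Proof. by case: esys. Qed.

Lemma measurable_iter j : measurable_fun L (iter j g : B -> B).
Proof.
elim: j => [|j IH]; first exact: measurable_id.
apply: (measurable_comp mL) mg IH => _ [y Ly <-].
by apply: (@iter_stable _ _ L g).
Qed.

Lemma orbit_in j y : Lambda y -> Lambda (iter j g y).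
Proof. by elim: j => //= j IH Ly; exact/gL/IH. Qed.

Lemma measurable_orbit (k : 'cV[R]_l -> R) j :
  measurable_fun L (k : B -> R) -> measurable_fun L (fun y => k (iter j g y)).
Proof.
move=> mk; apply: (measurable_comp mL) mk (measurable_iter j) => _ [y Ly <-].
exact: orbit_in.
Qed.

Lemma measurable_f0 i : measurable_fun L (fun y => f0 y i ord0).
Proof.
have [K K0 HK] := locally_lipschitz_compact cL (@subset_refl _ Lambda) lf0.
apply: (measurable_lipschitz_on cL K0) => x y Lx Ly.
apply: le_trans (HK x y Lx Ly); have := cV_coord_le (f0 x - f0 y) i.
by rewrite !mxE.
Qed.

Lemma lipschitz_f (r e : R) : exists2 K : R, 0 <= K & forall (x x' : 'cV[R]_d) y y',
  `|x| <= r -> `|x'| <= r -> Lambda y -> Lambda y' ->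
  `|f x y e - f x' y' e| <= K * Num.max `|x - x'| `|y - y'|.
Proof.
have cA : compact ([set x : 'cV[R]_d | `|x| <= r] `*` Lambda).
  by apply: compact_setX => //; exact: compact_ball.
have AA' : [set x : 'cV[R]_d | `|x| <= r] `*` Lambda `<=` [set: 'cV[R]_d] `*` Lambda.
  by move=> p [_ ?].
have [K K0 HK] := locally_lipschitz_compact cA AA' (lf e).
exists K => // x x' y y' xr x'r Ly Ly'.
by have := HK (x, y) (x', y') (conj xr Ly) (conj x'r Ly').
Qed.

Lemma lipschitz_f_x (r e : R) : exists2 K : R, 0 <= K & forall (x x' : 'cV[R]_d) y,
  `|x| <= r -> `|x'| <= r -> Lambda y -> `|f x y e - f x' y e| <= K * `|x - x'|.
Proof.
have [K K0 HK] := lipschitz_f r e; exists K => // x x' y xr x'r Ly.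
by have := HK x x' y y xr x'r Ly Ly; rewrite subrr normr0 max_l.
Qed.

Lemma bounded_f (r e : R) : exists2 C : R, 0 <= C &
  forall (x : 'cV[R]_d) y, `|x| <= r -> Lambda y -> `|f x y e| <= C.
Proof.
have cA : compact ([set x : 'cV[R]_d | `|x| <= r] `*` Lambda).
  by apply: compact_setX => //; exact: compact_ball.
have [K K0 HK] := lipschitz_f r e.
have [|C C0 HC] := @lipschitz_compact_bounded R _ _
    (fun p : 'cV[R]_d * 'cV[R]_l => f p.1 p.2 e) _ K cA K0.
  by move=> [x y] [x' y'] [/= xr Ly] [/= x'r Ly']; exact: HK.
by exists C => // x y xr Ly; apply: (HC (x, y)).
Qed.

Lemma measurable_f x e i : measurable_fun L (fun y => f x y e i ord0).
Proof.
have [K K0 HK] := lipschitz_f `|x| e.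
apply: (measurable_lipschitz_on cL K0) => y y' Ly Ly'.
have := HK x x y y' (lexx _) (lexx _) Ly Ly'; rewrite subrr normr0 max_r//.
apply: le_trans; have := cV_coord_le (f x y e - f x y' e) i.
by rewrite !mxE.
Qed.

Lemma measurable_slow e n i : measurable_fun L (fun y => slow g f0 f xi e y n i ord0).
Proof.
elim: n i => [|n IH] i /=; first exact: measurable_cst.
under eq_fun do rewrite !mxE.
apply: measurable_funD; first apply: measurable_funD => //.
  by apply: measurable_funM => //; exact: (measurable_orbit n (measurable_f0 i)).
apply: measurable_funM => //.
pose h (a : 'I_d -> R) (y : B) := f (\col_j a j) (iter n g y) e i ord0.
pose V (j : 'I_d) (y : B) := slow g f0 f xi e y n j ord0.
rewrite (_ : (fun y : B => f (slow g f0 f xi e y n) (iter n g y) e i ord0) =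
   (fun y => h (V ^~ y) y)); last first.
  apply/funext => y; rewrite /h; congr (f _ _ _ _ _).
  by apply/colP => j; rewrite mxE.
apply: (@measurable_caratheodory _ B R L mL 'I_d V IH h) => [a|y Ly].
  exact: (measurable_orbit n (measurable_f (\col_j a j) e i)).
move=> a eps eps0.
pose r := `|(\col_j a j : 'cV[R]_d)| + 1.
have [K K0 HK] := lipschitz_f_x r e.
have K1 : 0 < K + 1 by rewrite ltr_wpDl.
exists (Num.min 1 (eps / (K + 1) / 2)) => [|b ab]; first by rewrite lt_min ltr01 !divr_gt0.
have dab : `|(\col_j b j - \col_j a j : 'cV[R]_d)| <= Num.min 1 (eps / (K + 1) / 2).
  apply: cV_norm_le => [|j]; first by rewrite le_min ler01 !divr_ge0// ltW.
  by rewrite !mxE; exact/ltW.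
move: dab; rewrite le_min => /andP[d1 d2].
have br : `|(\col_j b j : 'cV[R]_d)| <= r.
  rewrite -(subrK (\col_j a j) (\col_j b j : 'cV[R]_d)) (le_trans (ler_normD _ _))//.
  by rewrite addrC lerD2l.
have ar : `|(\col_j a j : 'cV[R]_d)| <= r by rewrite lerDl.
have Ly' := orbit_in n Ly.
have H := HK _ _ _ br ar Ly'.
have := cV_coord_le (f (\col_j b j) (iter n g y) e - f (\col_j a j) (iter n g y) e) i.
rewrite !mxE => /le_lt_trans; apply; apply: le_lt_trans H _.
apply: (@le_lt_trans _ _ ((K + 1) * (eps / (K + 1) / 2))).
  by rewrite ler_pM// lerDl.
rewrite mulrA [(K + 1) * _]mulrC divfK ?gt_eqF//.
by rewrite ltr_pdivrMr// mulr_natr mulr2n ltrDl.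
Qed.

Lemma measurable_interpolate (u : B -> nat -> 'cV[R]_d) (s : R) i :
  (forall n, measurable_fun L (fun y => u y n i ord0)) ->
  measurable_fun L (fun y => interpolate (u y) s i ord0).
Proof.
move=> mu_; rewrite /interpolate; under eq_fun do rewrite !mxE.
apply: measurable_funD => //; apply: measurable_funM => //.
exact: measurable_funB.
Qed.

Lemma rpath_slow e : rpath L (slow_path g f0 f xi e).
Proof.
split=> [y _|t t0 i]; last by apply: measurable_interpolate => n; exact: measurable_slow.
by apply: Cpath_interpolate; rewrite invr_ge0 exprn_even_ge0.
Qed.

Lemma rpath_wip n : rpath L (wip_path g f0 n).
Proof.
split=> [y _|t t0 i].
  rewrite (_ : wip_path g f0 n y = (fun t => interpolate
     (fun k => (Num.sqrt n%:R)^-1 *: birkhoff_sum g f0 y k) (t * n%:R))).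
    exact: Cpath_interpolate.
  apply/funext => t; rewrite /wip_path [t * _]mulrC /interpolate.
  by apply/matrixP => i j; rewrite !mxE; ring.
rewrite /wip_path; under eq_fun do rewrite mxE.
apply: measurable_funM => //; apply: measurable_interpolate => k.
rewrite /birkhoff_sum; under eq_fun do rewrite summxE.
by apply: measurable_sum => j; exact: (measurable_orbit j (measurable_f0 i)).
Qed.

(** ** The truncated drift *)

Section truncated.
Variables (r : R) (r0 : 0 <= r).

(** The drift [f], truncated in [x] at radius [r], and its average. *)
Definition trunc_f x y e : 'cV[R]_d := f (clamp r x) y e.
Definition trunc_F x : 'cV[R]_d := averaged_drift Lambda mu f (clamp r x).

Lemma trunc_f_lip : exists2 K : R, 0 <= K & forall (x x' : 'cV[R]_d) y, Lambda y ->
  `|trunc_f x y 0 - trunc_f x' y 0| <= K * `|x - x'|.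
Proof.
have [K K0 HK] := lipschitz_f_x r 0; exists K => // x x' y Ly.
apply: le_trans (HK _ _ _ (clamp_bound x r0) (clamp_bound x' r0) Ly) _.
by rewrite ler_wpM2l// clamp_lip.
Qed.

Lemma trunc_f_bound : exists2 C : R, 0 <= C &
  forall (x : 'cV[R]_d) y, Lambda y -> `|trunc_f x y 0| <= C.
Proof.
have [C C0 HC] := bounded_f r 0; exists C => // x y Ly; apply: HC => //.
exact: clamp_bound.
Qed.

Lemma trunc_F_bound (C : R) : 0 <= C -> (forall x y, Lambda y -> `|trunc_f x y 0| <= C) ->
  forall x, `|trunc_F x| <= C.
Proof.
move=> C0 HC x; apply: cV_norm_le => // i; rewrite mxE.
have bf : bmeas L (fun y => f (clamp r x) y 0 i ord0).
  split; first exact: measurable_f.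
  by exists C => y Ly; apply: le_trans (HC x y Ly); exact: cV_coord_le.
have := Rintegral_dist_le mu mL bf (bmeas_cst L 0) (bmeas_cst L C).
rewrite !(Rintegral_prob_cst mL)// subr0; apply => y Ly.
by rewrite subr0; apply: le_trans (HC x y Ly); exact: cV_coord_le.
Qed.

Lemma trunc_F_lip (K : R) : 0 <= K -> (forall x x' y, Lambda y ->
    `|trunc_f x y 0 - trunc_f x' y 0| <= K * `|x - x'|) ->
  forall x x', `|trunc_F x - trunc_F x'| <= K * `|x - x'|.
Proof.
move=> K0 HK x x'; apply: cV_norm_le => [|i]; first by rewrite mulr_ge0.
have [C C0 HC] := trunc_f_bound.
have bf z : bmeas L (fun y => f (clamp r z) y 0 i ord0).
  split; first exact: measurable_f.
  by exists C => y Ly; apply: le_trans (HC z y Ly); exact: cV_coord_le.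
rewrite !mxE; have := Rintegral_dist_le mu mL (bf x) (bf x') (bmeas_cst L (K * `|x - x'|)).
rewrite (Rintegral_prob_cst mL)//; apply => y Ly.
apply: le_trans (HK x x' y Ly).
by have := cV_coord_le (trunc_f x y 0 - trunc_f x' y 0) i; rewrite !mxE.
Qed.

Lemma averaged_clamp x : `|x| <= r -> averaged_drift Lambda mu f x = trunc_F x.
Proof. by move=> xr; rewrite /trunc_F clamp_id. Qed.

(** The ergodic theorem holds uniformly in the slow variable: almost surely for
    all rational [x] simultaneously, hence for all [x] by compactness. *)
Lemma uniform_birkhoff : {ae mu, forall y, L y -> forall dl : R, 0 < dl ->
  exists C : nat, forall k x,
    `|\sum_(j < k) (trunc_f x (iter j g y) 0 - trunc_F x)| <= k%:R * dl + C%:R}.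
Proof.
have [K K0 HK] := trunc_f_lip; have FK := trunc_F_lip K0 HK.
have [C C0 HC] := trunc_f_bound.
pose rv (q : 'cV[rat]_d) : 'cV[R]_d := map_mx ratr q.
have bir : {ae mu, forall y, forall qi : 'cV[rat]_d * 'I_d, L y -> forall dl : R, 0 < dl ->
    exists C : nat, forall k,
    `|orbit_sum (g : B -> B) (fun y : B => trunc_f (rv qi.1) y 0 qi.2 ord0) k y -
      k%:R * \int[mu]_(y in L) trunc_f (rv qi.1) y 0 qi.2 ord0| <= k%:R * dl + C%:R}.
  apply: ae_forall_count => -[q i]; apply: (birkhoff mL) => //.
  split; first exact: measurable_f.
  by exists C => y Ly; apply: le_trans (HC (rv q) y Ly); exact: cV_coord_le.
apply: filterS bir => y bir Ly dl dl0.
have K1 : 0 < 4 * K + 1 by rewrite ltr_wpDl// mulr_ge0.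
(* Moving [x] by [2 * rho] costs at most [dl / 2] per step, since both the drift
   and its average are [K]-Lipschitz. *)
pose rho := dl / 2 / (4 * K + 1).
have rho0 : 0 < rho by rewrite !divr_gt0.
have dl20 : 0 < dl / 2 by rewrite divr_gt0.
have := @compact_ball R d r => /compact_near_coveringP/(_ nat \oo
  (fun (C : nat) (x : 'cV[R]_d) => forall k : nat,
    `|\sum_(j < k) (trunc_f x (iter j g y) 0 - trunc_F x)| <= k%:R * dl + C%:R) _) cov.
suff : \forall C \near \oo, [set x : 'cV[R]_d | `|x| <= r] `<=` (fun x => forall k : nat,
    `|\sum_(j < k) (trunc_f x (iter j g y) 0 - trunc_F x)| <= k%:R * dl + C%:R).
  move=> [M _ /(_ M (leqnn M)) HM]; exists M => k x.
  have := HM (clamp r x) (clamp_bound x r0) k.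
  by rewrite /trunc_f /trunc_F clamp_clamp.
apply: cov => x0 _.
have qex i : {q : rat | `|x0 i ord0 - ratr q| < rho}.
  apply: cid; have x0rho : x0 i ord0 - rho < x0 i ord0 + rho by rewrite ltrD2l gtrN.
  have [q] := rat_in_itvoo x0rho.
  by rewrite in_itv/= => /andP[q1 q2]; exists q; rewrite distrC ltr_distl q1 q2.
pose q : 'cV[rat]_d := \col_i sval (qex i).
have x0q : `|x0 - rv q| <= rho.
  apply: cV_norm_le => [|i]; first exact: ltW.
  by rewrite !mxE; case: (qex i) => /= ? ?; exact: ltW.
have bq i := bir (q, i) Ly _ dl20.
pose Ci i := projT1 (cid (bq i)).
have HCi i : forall k, `|orbit_sum (g : B -> B) (fun y : B => trunc_f (rv q) y 0 i ord0) k y -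
    k%:R * \int[mu]_(y in L) trunc_f (rv q) y 0 i ord0| <= k%:R * (dl / 2) + (Ci i)%:R.
  exact: projT2 (cid (bq i)).
have near0 : \forall x \near x0, `|x0 - x| < rho.
  by apply/nbhs_ballP; exists rho => //= z; rewrite -ball_normE.
near=> x M => k /=.
have xq : `|x - rv q| <= 2 * rho.
  have xx0 : `|x0 - x| < rho by near: x.
  rewrite -(subrK x0 x) -addrA (le_trans (ler_normD _ _))// mulr_natl mulr2n.
  by rewrite lerD// distrC ltW.
have CM i : (Ci i <= M)%N.
  have : (\sum_i Ci i <= M)%N by near: M; exact: nbhs_infty_ge.
  by apply: leq_trans; rewrite (bigD1 i)//= leq_addr.
have qk : `|\sum_(j < k) (trunc_f (rv q) (iter j g y) 0 - trunc_F (rv q))| <=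
    k%:R * (dl / 2) + M%:R.
  apply: cV_norm_le => [|i]; first by rewrite addr_ge0// mulr_ge0// ltW.
  apply: (@le_trans _ _ (k%:R * (dl / 2) + (Ci i)%:R)); last by rewrite lerD2l ler_nat.
  apply: le_trans (HCi i k); rewrite le_eqVlt; apply/orP; left; apply/eqP; congr `|_|.
  rewrite summxE /orbit_sum.
  rewrite (eq_bigr (fun j : 'I_k => trunc_f (rv q) (iter j g y) 0 i ord0 -
    trunc_F (rv q) i ord0)) => [|j _]; last by rewrite !mxE.
  by rewrite sumrB sumr_const card_ord -[in LHS]mulr_natl [trunc_F _ _ _]mxE.
have -> : \sum_(j < k) (trunc_f x (iter j g y) 0 - trunc_F x) =
    \sum_(j < k) (trunc_f (rv q) (iter j g y) 0 - trunc_F (rv q)) +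
    \sum_(j < k) ((trunc_f x (iter j g y) 0 - trunc_f (rv q) (iter j g y) 0) -
                  (trunc_F x - trunc_F (rv q))).
  rewrite -big_split/=; apply: eq_bigr => j _.
  by apply/matrixP => a b; rewrite !mxE; ring.
rewrite (le_trans (ler_normD _ _))//.
have -> : k%:R * dl + M%:R = k%:R * (dl / 2) + M%:R + k%:R * (dl / 2).
  by rewrite addrAC -mulrDr -splitr.
rewrite lerD// (le_trans (ler_norm_sum _ _ _))//.
rewrite (@le_trans _ _ (\sum_(j < k) (dl / 2)))//; last first.
  by rewrite sumr_const card_ord mulr_natl.
apply: ler_sum => j _; rewrite (le_trans (ler_normB _ _))//.
have h1 := HK x (rv q) _ (orbit_in j Ly); have h2 := FK x (rv q).
have h3 : K * `|x - rv q| <= K * (2 * rho) by rewrite ler_wpM2l.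
have h4 : (4 * K + 1) * rho = dl / 2 by rewrite /rho mulrC divfK// gt_eqF.
have := rho0; move: h1 h2 h3 h4; lra.
Unshelve. all: by end_near. Qed.

End truncated.

End fast_slow_system.

(** * Almost sure comparison of the slow variables with the Euler scheme *)

(** The truncation is not felt as long as the slow variables stay in the ball. *)
Lemma slow_trunc (R : realType) (l d : nat) (g : 'cV[R]_l -> 'cV[R]_l)
    (f0 : 'cV[R]_l -> 'cV[R]_d) (f : 'cV[R]_d -> 'cV[R]_l -> R -> 'cV[R]_d)
    (xi : 'cV[R]_d) (r e : R) y k :
  (forall j, (j < k)%N -> `|slow g f0 (trunc_f f r) xi e y j| <= r) ->
  slow g f0 f xi e y k = slow g f0 (trunc_f f r) xi e y k.
Proof.
elim: k => [//|k IH] Hk /=.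
rewrite IH => [|j jk]; last by apply: Hk; exact: leqW.
have := Hk k (ltnSn k); move: (slow _ _ _ _ _ _ k) => x xr.
by rewrite /trunc_f clamp_id.
Qed.

Section slow_close.
Variables (R : realType) (l d : nat).
Variables (Lambda : set 'cV[R]_l) (g : 'cV[R]_l -> 'cV[R]_l).
Variable mu : probability (borel 'cV[R]_l) R.
Variables (f0 : 'cV[R]_l -> 'cV[R]_d) (f : 'cV[R]_d -> 'cV[R]_l -> R -> 'cV[R]_d).
Variable xi : 'cV[R]_d.
Local Notation L := (Lambda : set (borel 'cV[R]_l)).
Hypothesis cL : compact Lambda.
Hypothesis esys : ergodic_system Lambda g mu.
Hypothesis lf : forall e : R,
  [locally [lipschitz f p.1 p.2 e | p in [set: 'cV[R]_d] `*` Lambda]].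
Hypothesis uf : forall K : set ('cV[R]_d * 'cV[R]_l),
  compact K -> K `<=` [set: 'cV[R]_d] `*` Lambda ->
  {uniform K, (fun (e : R) (p : 'cV[R]_d * 'cV[R]_l) => f p.1 p.2 e) @ 0^'
                --> (fun p : 'cV[R]_d * 'cV[R]_l => f p.1 p.2 0)}.

Lemma trunc_f_cvg (r c : R) : 0 <= r -> 0 < c ->
  \forall e \near 0^', forall x y, Lambda y ->
    `|trunc_f f r x y e - trunc_f f r x y 0| <= c.
Proof.
move=> r0 c0; pose K := [set x : 'cV[R]_d | `|x| <= r] `*` Lambda.
have cK : compact K by apply: compact_setX => //; exact: compact_ball.
have KL : K `<=` [set: 'cV[R]_d] `*` Lambda by move=> p [_ ?].
have := uf cK KL.
move=> /(_ [set h | forall p, K p -> `|f p.1 p.2 0 - h p| < c]) H.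
have : \forall e \near 0^', forall p, K p -> `|f p.1 p.2 0 - f p.1 p.2 e| < c.
  apply: H; apply/uniform_nbhs.
  exists [set uv : 'cV[R]_d * 'cV[R]_d | ball uv.1 c uv.2]; split.
    exact: (entourage_ball _ (PosNum c0)).
  by move=> h /= Hh p Kp; have := Hh p Kp; rewrite -ball_normE.
apply: filterS => e He x y Ly; rewrite distrC ltW//.
by apply: (He (clamp r x, y)); split=> //=; exact: clamp_bound.
Qed.

Variable eps : nat -> R.
Hypothesis eps0 : forall k, 0 < eps k.
Hypothesis eps_cvg : eps @ \oo --> 0.

(** Number of fast steps in a unit of slow time. *)
Definition steps k : nat := Num.truncn (eps k ^- 2).

Lemma eps_small (c : R) : 0 < c -> \forall k \near \oo, eps k <= c.
Proof.
move=> c0; move/cvgrPdist_le : eps_cvg => /(_ _ c0); apply: filterS => k.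
by rewrite sub0r normrN gtr0_norm.
Qed.

Lemma eps_near (P : R -> Prop) : (\forall e \near 0^', P e) -> \forall k \near \oo, P (eps k).
Proof.
move=> [c /= c0 HP]; have c20 : 0 < c / 2 by rewrite divr_gt0.
apply: filterS (eps_small c20) => k ek; apply: HP; last by rewrite gt_eqF.
rewrite /ball_ /= sub0r normrN gtr0_norm// (le_lt_trans ek)//.
by rewrite ltr_pdivrMr// ltr_pMr// ltr1n.
Qed.

Lemma steps_cvg : steps @ \oo --> \oo.
Proof.
move=> A [M _ MA]; have M0 : 0 < M.+1%:R^-1 :> R by rewrite invr_gt0.
apply: filterS (eps_small M0) => k ek; apply: MA => /=.
have e0 := eps0 k.
rewrite /steps truncn_ge_nat ?invr_ge0 ?exprn_ge0 ?(ltW e0)//.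
apply: (@le_trans _ _ M.+1%:R); first by rewrite ler_nat.
rewrite -[leLHS]invrK lef_pV2 ?posrE ?exprn_gt0//.
have e1 : eps k <= 1 by rewrite (le_trans ek)// invf_le1// ler1n.
by apply: le_trans ek; rewrite expr2 ler_piMl ?(ltW e0).
Qed.

(** Almost surely, and as soon as [k] is large enough, the slow path is within
    [Cst * (om + h)] of the Euler path driven by the normalised Birkhoff sums
    [w], provided that the Euler path stays away from the truncation radius.
    Here [h = 1 / (m + 1)], and [om] bounds the oscillation of [w] at the scale
    [h]. *)
Lemma slow_close (r : R) (N : nat) : 0 <= r ->
  exists2 Cst : R, 1 <= Cst & forall m : nat,
  {ae mu, forall y, L y -> \forall k \near \oo, forall om : R,
    (forall t1 t2 : R, 0 <= t1 <= N.+2%:R -> 0 <= t2 <= N.+2%:R ->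
      `|t1 - t2| <= 4 * m.+1%:R^-1 ->
      `|wip_path g f0 (steps k) y t1 - wip_path g f0 (steps k) y t2| <= om) ->
    (forall t : R, 0 <= t <= N.+2%:R ->
      m.+1%:R^-1 * `|wip_path g f0 (steps k) y t| <= om) ->
    (forall t : R, 0 <= t <= N%:R ->
      `|euler_path (trunc_F Lambda mu f r) xi m (wip_path g f0 (steps k) y) t| <= r - 1) ->
    Cst * (om + m.+1%:R^-1) <= 1 ->
    forall t : R, 0 <= t <= N%:R ->
      `|slow_path g f0 f xi (eps k) y t -
        euler_path (trunc_F Lambda mu f r) xi m (wip_path g f0 (steps k) y) t| <=
      Cst * (om + m.+1%:R^-1)}.
Proof.
move=> r0.
have [K K0 HK] := trunc_f_lip cL lf r0; have FK := trunc_F_lip cL esys lf r0 K0 HK.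
have [C C0 HC] := trunc_f_bound cL lf r0; have FC := trunc_F_bound cL esys lf C0 HC.
exists (slow_const K C N) => [|m]; first exact: slow_const_ge1.
apply: filterS (uniform_birkhoff cL esys lf r0) => y bir Ly.
have h0 : 0 < (m.+1%:R^-1 : R) by rewrite invr_gt0.
have h1 : (m.+1%:R^-1 : R) <= 1 by rewrite invf_le1// ler1n.
set h : R := m.+1%:R^-1; rewrite -/h in h0 h1.
have h20 : 0 < h ^+ 2 by rewrite exprn_gt0.
have [M HM] := bir Ly (h ^+ 2 / 2 / N.+1%:R) (divr_gt0 (divr_gt0 h20 (ltr0n _ 2)) (ltr0n _ N.+1)).
have sN : \forall k \near \oo, ((Num.truncn (N.+1%:R / h)).+1 <= steps k)%N.
  exact: (steps_cvg (nbhs_infty_ge (Num.truncn (N.+1%:R / h)).+1)).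
have M0 : 0 < h ^+ 2 / (2 * M.+1%:R) by rewrite divr_gt0// mulr_gt0.
apply: filterS3 (filterI (eps_small h0) sN) (eps_near (trunc_f_cvg r0 h0))
  (eps_small M0) => k [eh sk] fh eM om w_mod w_bound EB Co1 t tN.
set w := wip_path _ _ _ _ in w_mod w_bound EB *.
set E := euler_path _ _ _ _ in EB *.
have e0 := eps0 k.
have e21 : eps k ^+ 2 <= eps k by rewrite expr2 ler_piMl ?(ltW e0)// (le_trans eh).
pose x := slow g f0 (trunc_f f r) xi (eps k) y.
have close : forall t : R, 0 <= t <= N%:R ->
    `|slow_path g f0 (trunc_f f r) xi (eps k) y t - E t| <= slow_const K C N * (om + h).
  apply: (@slow_euler R d (trunc_F Lambda mu f r)
    (fun j v => trunc_f f r v (iter j g y) 0) xi K C N m K0 C0 FK FC _ x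
    (fun j => f0 (iter j g y)) (fun j => trunc_f f r (x j) (iter j g y) (eps k))
    (eps k) (steps k) om e0).
  - by move=> j u v; apply: HK; exact: (orbit_in esys).
  - by rewrite -/h lerXn2r// nnegrE ltW.
  - by [].
  - rewrite -/h mulrC -ler_pdivrMr// (le_trans (ltW (truncnS_gt _)))//.
    by rewrite ler_nat.
  - by [].
  - by [].
  - move=> j; have Lj := orbit_in esys j Ly.
    rewrite -(subrK (trunc_f f r (x j) (iter j g y) 0) (trunc_f _ _ _ _ (eps k))).
    by rewrite (le_trans (ler_normD _ _))// addrC lerD ?HC// (le_trans (fh _ _ Lj)).
  - by move=> j; apply: fh; exact: (orbit_in esys).
  - move=> v j jN; apply: (@le_trans _ _ (eps k ^+ 2 *
        (j%:R * (h ^+ 2 / 2 / N.+1%:R) + M%:R))).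
      by rewrite ler_wpM2l ?exprn_ge0 ?(ltW e0)// HM.
    rewrite mulrDr [leRHS]splitr lerD//.
      rewrite -/h mulrA [_ * j%:R]mulrC mulrCA ler_piMr//.
        by rewrite ltW// divr_gt0.
      by rewrite ler_pdivrMr// mul1r.
    apply: (@le_trans _ _ (h ^+ 2 / (2 * M.+1%:R) * M.+1%:R)).
      by rewrite ler_pM ?exprn_ge0 ?(ltW e0) ?ler_nat// (le_trans e21).
    by rewrite invfM mulrA divfK.
  - exact: w_mod.
  - exact: w_bound.
(* The Euler path is at most [r - 1] and the error at most [1], so that the
   truncated slow variables stay in the ball of radius [r]. *)
have bound (s : R) : 0 <= s <= N%:R ->
    `|slow_path g f0 (trunc_f f r) xi (eps k) y s| <= r.
  move=> sN'; have cs := le_trans (close s sN') Co1.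
  rewrite -(subrK (E s) (slow_path _ _ _ _ _ _ s)).
  apply: le_trans (ler_normD _ _) _; have rE : 1 + (r - 1) = r by rewrite addrC subrK.
  rewrite -[leRHS]rE.
  by apply: lerD; [exact: cs|exact: EB].
suff -> : slow_path g f0 f xi (eps k) y t = slow_path g f0 (trunc_f f r) xi (eps k) y t.
  exact: close.
case/andP: tN => t0 tN.
have i0 : 0 <= eps k ^- 2 by rewrite invr_ge0 exprn_ge0// ltW.
have te0 : 0 <= t * eps k ^- 2 by rewrite mulr_ge0.
have xB j : (j < (Num.truncn (t * eps k ^- 2)).+1)%N ->
    `|slow g f0 (trunc_f f r) xi (eps k) y j| <= r.
  rewrite ltnS truncn_ge_nat// -[j%:R <= _]/(j%:R <= t / eps k ^+ 2) ler_pdivlMr ?exprn_gt0// => jt.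
  have := bound (j%:R * eps k ^+ 2).
  rewrite mulr_ge0 ?exprn_ge0 ?(ltW e0)//= (le_trans jt)// => /(_ isT).
  by rewrite /slow_path mulfK ?interpolate_nat// gt_eqF// exprn_gt0.
have E1 := slow_trunc xB.
have E2 := slow_trunc (fun j jk => xB j (leqW jk)).
by rewrite /slow_path /interpolate E1 E2.
Qed.

End slow_close.

(** * Lipschitz functionals built from the Euler scheme *)

Section functionals.
Variables (R : realType) (d : nat).
Local Notation V := 'cV[R]_d.
Local Notation path := (path_space R d).
Local Notation C := (Cpath R d).
Implicit Types (phi psi : path -> R) (N : nat) (K : R).

Lemma plip_le N N' K phi : (N <= N')%N -> plip N K phi -> plip N' K phi.
Proof.
move=> NN' lphi x y r Cx Cy xy; apply: lphi => // t /andP[t0 tN]; apply: xy.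
by rewrite t0 (le_trans tN)// ler_nat.
Qed.

Lemma plipD N K K' phi psi : plip N K phi -> plip N K' psi ->
  plip N (K + K') (fun x => phi x + psi x).
Proof.
move=> lphi lpsi x y r Cx Cy xy; rewrite opprD addrACA mulrDl.
by rewrite (le_trans (ler_normD _ _))// lerD ?lphi ?lpsi.
Qed.

Lemma plipZ N K c phi : plip N K phi -> plip N (`|c| * K) (fun x => c * phi x).
Proof.
by move=> lphi x y r Cx Cy xy; rewrite -mulrBr normrM -mulrA ler_wpM2l// lphi.
Qed.

Lemma plip_comp N K phi (k : R -> R) : (forall a b, `|k a - k b| <= `|a - b|) ->
  plip N K phi -> plip N K (fun x => k (phi x)).
Proof. by move=> kl lphi x y r Cx Cy xy; rewrite (le_trans (kl _ _))// lphi. Qed.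

Lemma plip_cst N (c : R) : plip N 0 (fun _ : path => c).
Proof. by move=> x y r _ _ _; rewrite subrr normr0 mul0r. Qed.

Lemma plip_abs N K phi : plip N K phi -> plip N `|K| phi.
Proof.
move=> lphi x y r Cx Cy xy; apply: le_trans (lphi x y r Cx Cy xy) _.
have r0 : 0 <= r by apply: le_trans (xy 0 _); rewrite ?lexx/=.
by apply: ler_wpM2r => //; exact: ler_norm.
Qed.

(** Truncation of a real number to [[0, 1]]. *)
Definition unit_clamp (a : R) : R := Num.max 0 (Num.min 1 a).

Lemma unit_clamp_ge0 a : 0 <= unit_clamp a.
Proof. by rewrite le_max lexx. Qed.

Lemma unit_clamp_le1 a : unit_clamp a <= 1.
Proof. by rewrite ge_max ler01 ge_min lexx. Qed.

Lemma unit_clamp1 a : 1 <= a -> unit_clamp a = 1.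
Proof. by move=> a1; rewrite /unit_clamp min_l// max_r. Qed.

Lemma unit_clamp0 a : a <= 0 -> unit_clamp a = 0.
Proof. by move=> a0; rewrite /unit_clamp max_l// ge_min a0 orbT. Qed.

Lemma unit_clamp_le a : 0 <= a -> unit_clamp a <= a.
Proof. by move=> a0; rewrite ge_max a0 ge_min lexx orbT. Qed.

Lemma unit_clamp_lip a b : `|unit_clamp a - unit_clamp b| <= `|a - b|.
Proof.
have H x : unit_clamp x = 0 /\ x <= 0 \/ unit_clamp x = x \/ unit_clamp x = 1 /\ 1 <= x.
  have [x0|x0] := leP x 0; first by left; rewrite unit_clamp0.
  have [x1|x1] := leP 1 x; first by right; right; rewrite unit_clamp1.
  by right; left; rewrite /unit_clamp min_r ?ltW// max_r// ltW.
have a1 := unit_clamp_le1 a; have b1 := unit_clamp_le1 b.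
have a0 := unit_clamp_ge0 a; have b0 := unit_clamp_ge0 b.
have := ler_norm (a - b); have := ler_norm (b - a); rewrite (distrC b a) => n1 n2.
rewrite ler_norml.
by case: (H a) => [[-> ?]|[Ha|[-> ?]]]; case: (H b) => [[-> ?]|[Hb|[-> ?]]];
  rewrite ?Ha ?Hb; apply/andP; split; lra.
Qed.

Variables (F : V -> V) (xi : V) (m : nat) (L : R).
Hypothesis L0 : 0 <= L.
Hypothesis FL : forall x y : V, `|F x - F y| <= L * `|x - y|.

Lemma euler_path_lip N (w w' : path) (r : R) :
  (forall t, 0 <= t <= N.+1%:R -> `|w t - w' t| <= r) ->
  forall t, 0 <= t <= N%:R ->
    `|euler_path F xi m w t - euler_path F xi m w' t| <= (1 + growth L N * L) * r.
Proof.
move=> wr t tN.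
have r0 : 0 <= r by apply: le_trans (wr 0 _); rewrite ?lexx/=.
have h0 : 0 < (m.+1%:R^-1 : R) by rewrite invr_gt0.
have time k : (k <= (N * m.+1).+1)%N -> 0 <= (k%:R / m.+1%:R : R) <= N.+1%:R.
  move=> kN; rewrite divr_ge0//= ler_pdivrMr// -natrM ler_nat (leq_trans kN)//.
  by rewrite mulSn addnC addnS ltnS leq_addr.
have node k : euler F xi m w k - euler F xi m w' k =
    (w (k%:R / m.+1%:R) - w' (k%:R / m.+1%:R)) +
    (euler_sum F xi m w k - euler_sum F xi m w' k).
  by rewrite /euler; apply/matrixP => i j; rewrite !mxE; ring.
have bk : forall k, (k <= (N * m.+1).+1)%N ->
    `|euler_sum F xi m w k - euler_sum F xi m w' k| <= growth L N * (L * r).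
  apply: (discrete_gronwall (m := m) L0) => [||k kN].
  - by rewrite mulr_ge0.
  - by rewrite subrr normr0.
  rewrite !euler_sumS opprD addrACA -scalerBr (le_trans (ler_normD _ _))//.
  rewrite normrZ (gtr0_norm h0).
  have Fe : `|F (euler F xi m w k) - F (euler F xi m w' k)| <=
      L * (r + `|euler_sum F xi m w k - euler_sum F xi m w' k|).
    rewrite (le_trans (FL _ _))// ler_wpM2l// node (le_trans (ler_normD _ _))//.
    by rewrite lerD2r wr// time// leqW.
  have : m.+1%:R^-1 * `|F (euler F xi m w k) - F (euler F xi m w' k)| <=
      m.+1%:R^-1 * (L * (r + `|euler_sum F xi m w k - euler_sum F xi m w' k|)).
    by rewrite ler_wpM2l// ltW.
  move: `|_ - _| `|_ - _| (m.+1%:R^-1 : R) => a b c; lra.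
have th0 : 0 <= t * m.+1%:R by case/andP: tN => t0 _; rewrite mulr_ge0.
apply: interpolate_close => // k kN.
have kN' : (k <= (N * m.+1).+1)%N by apply: leq_trans kN _; rewrite ltnS truncn_grid_le.
rewrite node mulrDl mul1r -mulrA (le_trans (ler_normD _ _))// lerD ?bk//.
by rewrite wr// time.
Qed.

Lemma plip_euler N K phi : 0 <= K -> plip N K phi ->
  plip N.+1 (K * (1 + growth L N * L)) (fun w => phi (euler_path F xi m w)).
Proof.
move=> K0 lphi x y r Cx Cy xy; rewrite -mulrA.
by apply: lphi; [exact: Cpath_euler|exact: Cpath_euler|exact: euler_path_lip].
Qed.

End functionals.

(** * The limiting equation and its Euler scheme *)

Section sde_euler.
Variables (R : realType) (d : nat).
Local Notation V := 'cV[R]_d.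
Local Notation path := (path_space R d).
Local Notation leb := (@lebesgue_measure R).

(** The error of the left rectangle rule over [[a, b]]. *)
Lemma Rintegral_step (G : R -> R) (M a b c : R) :
  {within `[0, M]%classic, continuous G} -> 0 <= a -> a <= b -> b <= M ->
  (forall s, a <= s <= b -> `|G s - G a| <= c) ->
  `|\int[leb]_(s in `[0, b]) G s - \int[leb]_(s in `[0, a]) G s - (b - a) * G a|
    <= c * (b - a).
Proof.
move=> cG a0 ab bM Gc.
have iG : leb.-integrable `[0, b]%classic (EFin \o G).
  apply: continuous_compact_integrable; first exact: segment_compact.
  apply: continuous_subspaceW cG => s /=; rewrite !in_itv/= => /andP[-> sb].
  exact: le_trans bM.
have iG' : leb.-integrable `]a, b]%classic (EFin \o G).
  apply: integrableS iG => // s /=; rewrite !in_itv/= => /andP[as_ ->].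
  by rewrite (le_trans a0 (ltW as_)).
have mab : leb `]a, b]%classic = (b - a)%:E.
  rewrite lebesgue_measure_itv/= lte_fin; case: ltP => // ba.
  by rewrite (@le_anti _ _ a b) ?subrr// ab.
have icst k : leb.-integrable `]a, b]%classic (EFin \o cst k).
  apply: measurable_bounded_integrable => //.
    by apply: (le_lt_trans _ (ltry (b - a))); rewrite -mab.
  by exists `|k|; split => // x kx s _; exact: ltW.
have intcst k : \int[leb]_(s in `]a, b]) k = k * (b - a).
  by rewrite Rintegral_cst// (congr1 fine mab).
have := @Rintegral_itvB R G (BLeft 0) (BRight b) a iG.
rewrite !bnd_simp => ->//.
rewrite [(b - a) * G a]mulrC -[G a * _]intcst -RintegralB//; last exact: icst.
have iGa : leb.-integrable `]a, b]%classic (EFin \o (fun s => G s - G a)).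
  exact: (integrableB _ iG' (icst (G a))).
apply: le_trans (le_normr_Rintegral _ iGa) _ => //.
rewrite -intcst; apply: le_Rintegral => //; [exact: integrable_norm|exact: icst|].
by move=> s /=; rewrite in_itv/= => /andP[as_ sb]; rewrite Gc// (ltW as_).
Qed.

Variables (F Fr : V -> V) (xi : V) (L r : R) (N : nat).
Hypothesis L0 : 0 <= L.
Hypothesis FrL : forall x y : V, `|Fr x - Fr y| <= L * `|x - y|.
Hypothesis FFr : forall x : V, `|x| <= r -> F x = Fr x.
Variables (x w : path).
Hypothesis Cx : Cpath R d x.
Hypothesis xsol : forall t, 0 <= t ->
  x t = xi + w t + vintegral leb `[0, t] (fun s => F (x s)).
Hypothesis xr : forall t, 0 <= t <= N.+1%:R -> `|x t| <= r.

(** A solution that has not left the ball of radius [r], inside which the drift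
    is Lipschitz, is the limit of the Euler paths with the same driving path. *)
Lemma sde_euler_cvg (e : R) : 0 < e -> \forall m \near \oo,
  forall t : R, 0 <= t <= N%:R -> `|x t - euler_path Fr xi m w t| <= e.
Proof.
move=> e0; have g0 := growth_ge0 L N.
pose om := e / (1 + growth L N * L).
have gL : 0 < 1 + growth L N * L by rewrite ltr_wpDr// mulr_ge0.
have om0 : 0 < om by rewrite divr_gt0.
have [dl dl0 Hdl] := (CpathP x).1 Cx N.+1 om om0.
near=> m.
have hdl : (m.+1%:R^-1 : R) < dl.
  rewrite -[ltRHS]invrK ltf_pV2 ?posrE ?invr_gt0//.
  have h : dl^-1 <= m%:R by near: m; exact: nbhs_infty_ger.
  by rewrite (le_lt_trans h)// ltr_nat.
have h0 : 0 < (m.+1%:R^-1 : R) by rewrite invr_gt0.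
have xom (s t : R) : 0 <= s <= N.+1%:R -> 0 <= t <= N.+1%:R ->
    `|s - t| <= m.+1%:R^-1 -> `|x s - x t| <= om.
  by move=> sN tN st; rewrite ltW// Hdl// (le_lt_trans st).
pose A k := vintegral leb `[0, k%:R / m.+1%:R] (fun s => F (x s)).
have stable := @euler_stable R d Fr xi m L L0 FrL N w x A 0 (L * om) om.
move=> t tN; have := stable _ _ _ _ xom t tN.
rewrite mulr0 add0r addr0 => H.
have -> : e = om + growth L N * (L * om).
  by rewrite mulrA -[X in X + _]mul1r -mulrDl mulrC divfK// gt_eqF.
apply: H.
- by rewrite mulr_ge0// ltW.
- apply/colP => i; rewrite !mxE mul0r set_itv1; exact: Rintegral_set1.
- move=> k kN; rewrite /A -xsol ?divr_ge0// subrr normr0//.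
move=> k kN.
have kh0 : 0 <= (k%:R / m.+1%:R : R) by rewrite divr_ge0.
have SkN : (k.+1%:R / m.+1%:R : R) <= N.+1%:R.
  rewrite ler_pdivrMr// -natrM ler_nat (@leq_trans (N * m.+1).+1)//.
  by rewrite mulSn addnC addnS ltnS leq_addr.
have khS : (k.+1%:R / m.+1%:R : R) - k%:R / m.+1%:R = m.+1%:R^-1.
  by rewrite -mulrBl -[k.+1%:R]natr1 addrC addKr mul1r.
have khle : (k%:R / m.+1%:R : R) <= k.+1%:R / m.+1%:R by rewrite -subr_ge0 khS ltW.
apply: cV_norm_le => [|i]; first exact: (mulr_ge0 (mulr_ge0 L0 (ltW om0)) (ltW h0)).
have cG : {within `[0, N.+1%:R]%classic, continuous (fun s => Fr (x s) i ord0)}.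
  apply/subspace_continuousP => s; rewrite /= in_itv/= => sN.
  apply/cvgrPdist_lt => c c0; rewrite near_withinE.
  have K0 : 0 < L + 1 by rewrite ltr_wpDl.
  have [dl' dl'0 Hdl'] := (CpathP x).1 Cx N.+1 (c / (L + 1)) (divr_gt0 c0 K0).
  apply/nbhs_ballP; exists dl' => //= u; rewrite /ball/= in_itv/= => su uN.
  have := Hdl' s u sN uN su; rewrite ltr_pdivlMr// => xc.
  have := cV_coord_le (Fr (x s) - Fr (x u)) i; rewrite !mxE => /le_lt_trans; apply.
  apply: le_lt_trans (FrL _ _) _; apply: le_lt_trans xc.
  by rewrite mulrC ler_wpM2l// lerDl.
have eqF a : a <= N.+1%:R -> \int[leb]_(s in `[0, a]) F (x s) i ord0 =
    \int[leb]_(s in `[0, a]) Fr (x s) i ord0.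
  move=> aN; apply: eq_Rintegral => s /set_mem /=; rewrite in_itv/= => /andP[s0 sa].
  by rewrite FFr// xr// s0 (le_trans sa).
have := Rintegral_step cG kh0 khle SkN (c := L * om); rewrite khS !mxE !eqF ?(le_trans khle)//.
apply => s /andP[s1 s2].
have := cV_coord_le (Fr (x s) - Fr (x (k%:R / m.+1%:R))) i; rewrite !mxE.
move=> /le_trans; apply; apply: le_trans (FrL _ _) _; rewrite ler_wpM2l//.
apply: xom.
- by rewrite (le_trans kh0)// (le_trans s2).
- by rewrite kh0 (le_trans khle).
- by rewrite ger0_norm ?subr_ge0// -[leRHS]khS lerB.
Unshelve. all: by end_near. Qed.

End sde_euler.

(** * Convergence of the slow variables *)

(** For uniformly bounded functions, an almost sure asymptotic inequality, up to
    arbitrarily small errors, passes to the integrals. *)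
Lemma Rintegral_excess_cvg d (T : measurableType d) (R : realType)
    (mu : probability T R) (D : set T) (u v : nat -> T -> R) (B : R) :
  measurable D -> mu D = 1%E ->
  (forall k, measurable_fun D (u k)) -> (forall k, measurable_fun D (v k)) ->
  (forall k x, D x -> `|u k x| <= B) -> (forall k x, D x -> `|v k x| <= B) ->
  {ae mu, forall x, D x -> forall e : R, 0 < e -> \forall k \near \oo, u k x <= v k x + e} ->
  forall e : R, 0 < e -> \forall k \near \oo,
    \int[mu]_(x in D) u k x <= \int[mu]_(x in D) v k x + e.
Proof.
move=> mD D1 mu_ mv uB vB uv e e0.
have bu k : bmeas D (u k) by split; [exact: mu_|exists B => x; exact: uB].
have bv k : bmeas D (v k) by split; [exact: mv|exists B => x; exact: vB].
pose p k x := Num.max 0 (u k x - v k x).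
have bp k : bmeas D (p k) by apply: bmeas_max; [exact: bmeas_cst|exact: bmeasB].
have : (fun k => \int[mu]_(x in D) p k x) @ \oo --> \int[mu]_(x in D) (0 : R).
  apply: (bounded_cvg mD (B := B + B)) => [k||k x Dx|].
  - by case: (bp k).
  - exact: measurable_cst.
  - have BB : `|u k x - v k x| <= B + B by rewrite (le_trans (ler_normB _ _))// lerD ?uB ?vB.
    rewrite /p ger0_norm ?le_max ?lexx// ge_max (le_trans _ BB)//=.
    exact: le_trans (ler_norm _) BB.
  - apply: filterS uv => x uv Dx; apply/cvgrPdist_le => e' e'0.
    apply: filterS (uv Dx e' e'0) => k uvk.
    by rewrite sub0r normrN ger0_norm ?le_max ?lexx// ge_max (ltW e'0) lerBlDl.
rewrite Rintegral_prob_cst// => /cvgrPdist_le/(_ _ e0); apply: filterS => k.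
rewrite sub0r normrN => pe.
have : \int[mu]_(x in D) (u k x - v k x) <= \int[mu]_(x in D) p k x.
  by apply: le_Rintegral_bmeas => //; [exact: bmeasB|move=> x _; rewrite le_max lexx orbT].
rewrite RintegralB//; try exact: bmeas_integrable.
by have := ler_norm (\int[mu]_(x in D) p k x); lra.
Qed.

Section homogenization.
Variables (R : realType) (l d : nat).
Variables (Lambda : set 'cV[R]_l) (g : 'cV[R]_l -> 'cV[R]_l).
Variable mu : probability (borel 'cV[R]_l) R.
Variables (f0 : 'cV[R]_l -> 'cV[R]_d) (f : 'cV[R]_d -> 'cV[R]_l -> R -> 'cV[R]_d).
Variables (Sigma : 'M[R]_d) (xi : 'cV[R]_d).
Local Notation L := (Lambda : set (borel 'cV[R]_l)).
Local Notation path := (path_space R d).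
Local Notation C := (Cpath R d).
Local Notation Q := (mxsqrt Sigma).
Hypothesis cL : compact Lambda.
Hypothesis esys : ergodic_system Lambda g mu.
Hypothesis lf0 : [locally [lipschitz f0 y | y in Lambda]].
Hypothesis lf : forall e : R,
  [locally [lipschitz f p.1 p.2 e | p in [set: 'cV[R]_d] `*` Lambda]].
Hypothesis uf : forall K : set ('cV[R]_d * 'cV[R]_l),
  compact K -> K `<=` [set: 'cV[R]_d] `*` Lambda ->
  {uniform K, (fun (e : R) (p : 'cV[R]_d * 'cV[R]_l) => f p.1 p.2 e) @ 0^'
                --> (fun p : 'cV[R]_d * 'cV[R]_l => f p.1 p.2 0)}.
Hypothesis wip : WIP Lambda g mu f0 Sigma.
Context dO (O : measurableType dO) (P : probability O R) (W X : O -> path).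
Hypothesis bmW : brownian_motion P W.
Hypothesis solX : sde_solution P Q (averaged_drift Lambda mu f) xi W X.

Variable eps : nat -> R.
Hypothesis eps0 : forall k, 0 < eps k.
Hypothesis eps_cvg : eps @ \oo --> 0.

Let mL : measurable L := measurable_compact cL.
Let mu1 : mu L = 1%E. Proof. by case: esys. Qed.
Let P1 : P setT = 1%E. Proof. exact: probability_setT. Qed.

(** The driving paths: normalised Birkhoff sums, and their weak limit. *)
Let Wn k (y : borel 'cV[R]_l) : path := wip_path g f0 (steps eps k) y.
Let QW w : path := fun t => Q *m W w t.

Let rWn k : rpath L (Wn k). Proof. exact: (rpath_wip cL esys lf0). Qed.

Let rX : rpath setT X.
Proof. by have [[CX mX] _] := solX; split=> // w _; exact: CX. Qed.

Let rQW : rpath setT QW.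
Proof.
have [[CW mW] _ _ _] := bmW.
split=> [w _|t t0 i]; first exact/Cpath_mulmx/CW.
rewrite /QW; under eq_fun do rewrite mxE.
by apply: measurable_sum => j; apply: measurable_funM => //; exact: mW.
Qed.

(** The Brownian motion of the invariance principle may be replaced with [W]. *)
Lemma wip_plip psi N (K B : R) : plip N K psi -> (forall x, C x -> `|psi x| <= B) ->
  (fun k => \int[mu]_(y in L) psi (Wn k y)) @ \oo --> \int[P]_w psi (QW w).
Proof.
move=> lpsi psiB; have [d2 [T2 [P2 [W2 [bmW2 wc]]]]] := wip.
rewrite (brownian_eq_law Q lpsi psiB bmW bmW2).
have bpsi : [bounded psi x | x in C].
  by exists B; split; [exact: num_real|move=> M BM x Cx; exact: le_trans (psiB x Cx) (ltW BM)].
have H := wc psi (plip_continuous lpsi) bpsi.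
exact: (cvg_comp _ _ (steps_cvg eps0 eps_cvg) H).
Qed.

Variables (phi : path -> R) (N : nat) (K B : R).
Hypothesis K0 : 0 <= K.
Hypothesis lphi : plip N K phi.
Hypothesis phiB : forall x, C x -> `|phi x| <= B.

Let Cx0 : C (fun=> 0).
Proof. by apply: Cpath_lip => M; exists 0 => s t *; rewrite subrr normr0 mul0r. Qed.

Let B0 : 0 <= B. Proof. by apply: le_trans (phiB Cx0). Qed.

(** Oscillation of the driving path at scale [1 / (m + 1)]. *)
Definition osc m (w : path) : R :=
  pmod N.+2 (4 * m.+1%:R^-1) w + m.+1%:R^-1 * pnorm N.+2 w.

Let h0 m : 0 < (m.+1%:R^-1 : R). Proof. by rewrite invr_gt0. Qed.
Let h1 m : (m.+1%:R^-1 : R) <= 1. Proof. by rewrite invf_le1// ler1n. Qed.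

Lemma osc_ge0 m w : C w -> 0 <= osc m w.
Proof.
move=> Cw; rewrite addr_ge0 ?pmod_ge0//.
by apply: mulr_ge0; [exact/ltW|exact: pnorm_ge0].
Qed.

Lemma osc_cvg w : C w -> forall e : R, 0 < e -> \forall m \near \oo, osc m w <= e.
Proof.
move=> Cw e e0; have e20 : 0 < e / 2 by rewrite divr_gt0.
have [dl dl0 Hdl] := (CpathP w).1 Cw N.+2 _ e20.
have p0 := pnorm_ge0 N.+2 Cw.
near=> m; rewrite /osc [leRHS]splitr lerD//.
  apply: pmod_le => // s t sN tN st; rewrite ltW// Hdl// (le_lt_trans st)//.
  rewrite ltr_pdivrMr// -ltr_pdivrMl// mulrC.
  have h : 4 / dl <= m%:R by near: m; exact: nbhs_infty_ger.
  by rewrite (le_lt_trans h)// ltr_nat.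
rewrite mulrC ler_pdivrMr// -ler_pdivrMl// mulrC.
have h : pnorm N.+2 w / (e / 2) <= m%:R by near: m; exact: nbhs_infty_ger.
by rewrite (le_trans h)// ler_nat.
Unshelve. all: by end_near. Qed.

Lemma plip_osc m : plip N.+2 (2 + `|m.+1%:R^-1| * 1) (osc m).
Proof. by apply: plipD; [exact: plip_pmod|apply: plipZ; exact: plip_pnorm]. Qed.

Section fixed_truncation.
Variables (r Cst : R) (r0 : 0 <= r) (Cst1 : 1 <= Cst).

Let Fr := trunc_F Lambda mu f r.

Lemma trunc_F_lipschitz : exists2 M : R, 0 <= M &
  forall x y : 'cV[R]_d, `|Fr x - Fr y| <= M * `|x - y|.
Proof.
have [M M0 HM] := trunc_f_lip cL lf r0.
by exists M => //; exact: (trunc_F_lip cL esys lf r0 M0 HM).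
Qed.

(** The error functional: it bounds the error of the Euler scheme driven by [w]
    as long as that scheme stays away from the truncation radius, and is at
    least the trivial bound [2 * B] otherwise. *)
Definition error_bound m (w : path) : R :=
  (K + 2 * B) * (Cst * (unit_clamp (osc m w) + m.+1%:R^-1)) +
  2 * B * unit_clamp (pnorm N (euler_path Fr xi m w) - (r - 2)).

Lemma plip_error_bound m : exists M, plip N.+2 M (error_bound m).
Proof.
have [M M0 HM] := trunc_F_lipschitz.
have l1 : plip N.+2 _ (fun w => unit_clamp (osc m w) + m.+1%:R^-1) :=
  plipD (plip_comp (@unit_clamp_lip R) (plip_osc m)) (@plip_cst R d N.+2 m.+1%:R^-1).
have l2 : plip N.+1 _ (fun w => pnorm N (euler_path Fr xi m w)) :=
  plip_euler xi m M0 HM ler01 (@plip_pnorm R d N).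
have l3 := plip_comp (@unit_clamp_lip R)
  (plipD l2 (@plip_cst R d N.+1 (- (r - 2)))).
eexists; apply: plipD.
  apply: (@plipZ _ _ _ _ (K + 2 * B)); apply: (@plipZ _ _ _ _ Cst); exact: l1.
by apply: (@plipZ _ _ _ _ (2 * B)); apply: plip_le l3; rewrite leqW.
Qed.

Let EB := (K + 2 * B) * (Cst * 2) + 2 * B.

Let KB0 : 0 <= K + 2 * B. Proof. by rewrite addr_ge0// mulr_ge0. Qed.
Let C0 : 0 <= Cst. Proof. exact: le_trans Cst1. Qed.

Lemma error_bound_bound m w : `|error_bound m w| <= EB.
Proof.
have u1 := unit_clamp_ge0 (osc m w); have u2 := unit_clamp_le1 (osc m w).
have v1 := unit_clamp_ge0 (pnorm N (euler_path Fr xi m w) - (r - 2)).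
have v2 := unit_clamp_le1 (pnorm N (euler_path Fr xi m w) - (r - 2)).
have hh := h0 m; have hh1 := h1 m.
rewrite ger0_norm; last first.
  by rewrite addr_ge0// ?mulr_ge0// ?addr_ge0// ltW.
rewrite /EB lerD//; last by rewrite ler_piMr// mulr_ge0.
rewrite ler_wpM2l// ler_wpM2l//; rewrite (_ : 2 = 1 + 1 :> R)//; exact: lerD.
Qed.

Lemma plip_phi_euler m : exists M, plip N.+1 M (fun w => phi (euler_path Fr xi m w)).
Proof.
have [M M0 HM] := trunc_F_lipschitz.
by eexists; exact: (plip_euler xi m M0 HM K0 lphi).
Qed.

Let phi_dist x y : C x -> C y -> `|phi x - phi y| <= 2 * B.
Proof.
move=> Cx Cy; rewrite mulr_natl mulr2n (le_trans (ler_normB _ _))//.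
by rewrite lerD ?phiB.
Qed.

(** Error of the scheme in the limiting equation.  On the event that the
    solution comes close to the truncation radius only the trivial bound
    [4 * B] is available. *)
Lemma limit_error (e : R) : 0 < e -> \forall m \near \oo,
  \int[P]_w (error_bound m (QW w) + `|phi (euler_path Fr xi m (QW w)) - phi (X w)|) <=
  \int[P]_w (4 * B * unit_clamp (pnorm N.+1 (X w) - (r - 4))) + e.
Proof.
have [M M0 HM] := trunc_F_lipschitz.
have CX w : C (X w) by exact: rX.1.
have CQW w : C (QW w) by exact: rQW.1.
have bX : bmeas setT (fun w => phi (X w)).
  by have := bmeas_plip measurableT rX lphi phiB.
have bE m : bmeas setT (fun w => phi (euler_path Fr xi m (QW w))).
  have [M' lM'] := plip_phi_euler m.
  have := bmeas_plip measurableT rQW lM' (B := B).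
  by apply => x Cx; apply: phiB; exact: Cpath_euler.
have bEr m : bmeas setT (fun w => error_bound m (QW w)).
  have [M' lM'] := plip_error_bound m.
  have := bmeas_plip measurableT rQW lM' (B := EB).
  by apply => x Cx; exact: error_bound_bound.
have bu m : bmeas setT (fun w => error_bound m (QW w) +
    `|phi (euler_path Fr xi m (QW w)) - phi (X w)|).
  by apply: bmeasD => //; apply: bmeas_norm; exact: bmeasB.
have bv : bmeas setT (fun w => 4 * B * unit_clamp (pnorm N.+1 (X w) - (r - 4))).
  apply: bmeasZ.
  have lp := plip_comp (@unit_clamp_lip R)
    (plipD (@plip_pnorm R d N.+1) (@plip_cst R d N.+1 (- (r - 4)))).
  have := bmeas_plip measurableT rX lp (B := 1).
  by apply => x Cx; rewrite ger0_norm ?unit_clamp_ge0// unit_clamp_le1.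
apply: (Rintegral_excess_cvg (B := EB + 4 * B)) => //.
- by move=> m; case: (bu m).
- by move=> m; case: bv.
- move=> m w _; rewrite (le_trans (ler_normD _ _))// lerD//.
    exact: error_bound_bound.
  rewrite normr_id; apply: le_trans (phi_dist (@Cpath_euler _ _ Fr xi m _) (CX w)) _.
  by rewrite ler_wpM2r// ler_nat.
- move=> m w _; rewrite normrM [X in _ * X]ger0_norm ?unit_clamp_ge0//.
  rewrite ger0_norm ?mulr_ge0// ler_wpDl//.
    by rewrite /EB addr_ge0// !mulr_ge0.
  by rewrite ler_piMr ?mulr_ge0 ?unit_clamp_le1.
have [_ sde] := solX; apply: filterS sde => w sde _ e' e'0.
have KBC : 0 < (K + 2 * B) * Cst + 1 by rewrite ltr_wpDl// mulr_ge0.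
have e1 : 0 < e' / 4 / ((K + 2 * B) * Cst + 1) by rewrite !divr_gt0.
have hcvg : \forall m \near \oo, (m.+1%:R^-1 : R) <= e' / 4 / ((K + 2 * B) * Cst + 1).
  near=> m; rewrite -[leRHS]invrK lef_pV2 ?posrE ?invr_gt0//.
  have h : (e' / 4 / ((K + 2 * B) * Cst + 1))^-1 <= m%:R.
    by near: m; exact: nbhs_infty_ger.
  by rewrite (le_trans h)// ler_nat.
have small : \forall m \near \oo,
    (K + 2 * B) * (Cst * (unit_clamp (osc m (QW w)) + m.+1%:R^-1)) <= e' / 2.
  apply: filterS2 (osc_cvg (CQW w) e1) hcvg => m om hm.
  have um := le_trans (unit_clamp_le (osc_ge0 m (CQW w))) om.
  have k1 : ((K + 2 * B) * Cst + 1) * (e' / 4 / ((K + 2 * B) * Cst + 1)) = e' / 4.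
    by rewrite mulrC divfK// gt_eqF.
  have KC0 : 0 <= (K + 2 * B) * Cst by rewrite mulr_ge0.
  rewrite mulrA; move: ((K + 2 * B) * Cst) KC0 k1 um hm e1 => c c0.
  move: (e' / 4 / _) (unit_clamp _) (m.+1%:R^-1 : R) => a b h k1 bm hm a0.
  have : c * (b + h) <= c * (a + a) by rewrite ler_wpM2l// lerD.
  by move: k1; lra.
have u0 m := unit_clamp_ge0 (pnorm N (euler_path Fr xi m (QW w)) - (r - 2)).
have u1 m := unit_clamp_le1 (pnorm N (euler_path Fr xi m (QW w)) - (r - 2)).
have [Xr|rX'] := leP (pnorm N.+1 (X w)) (r - 3); last first.
  rewrite unit_clamp1; last by move: rX'; lra.
  apply: filterS small => m sm; rewrite /error_bound.
  have := phi_dist (@Cpath_euler _ _ Fr xi m (QW w)) (CX w).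
  have : 2 * B * unit_clamp (pnorm N (euler_path Fr xi m (QW w)) - (r - 2)) <= 2 * B.
    by rewrite ler_piMr// mulr_ge0.
  move: sm; move: ((K + 2 * B) * _) (2 * B * unit_clamp _) `|_| => a b c.
  by move: e'0; lra.
have Xt t : 0 <= t <= N.+1%:R -> `|X w t| <= r.
  by move=> tN; rewrite (le_trans (pnorm_ub (CX w) tN))// (le_trans Xr)// lerBlDl lerDr.
have FFr x : `|x| <= r -> averaged_drift Lambda mu f x = Fr x by exact: averaged_clamp.
have e20 : 0 < Num.min 1 (e' / 2 / (K + 1)).
  by rewrite lt_min ltr01 !divr_gt0// ltr_wpDl.
apply: filterS2 small (sde_euler_cvg M0 HM FFr (CX w) sde Xt e20) => m sm close.
have pE : pnorm N (euler_path Fr xi m (QW w)) <= r - 2.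
  apply: pnorm_le => t /[dup] tN /andP[t0 tN'].
  have := close t tN; rewrite le_min => /andP[c1 _].
  have tN1 : 0 <= t <= N.+1%:R by rewrite t0 (le_trans tN')// ler_nat.
  have := pnorm_ub (CX w) tN1.
  rewrite -[euler_path _ _ _ _ t](subKr (X w t)) => Xb.
  by rewrite (le_trans (ler_normB _ _))//; move: c1 Xb Xr; lra.
rewrite /error_bound [X in _ + 2 * B * X + _]unit_clamp0 ?subr_le0// mulr0 addr0.
have : `|phi (euler_path Fr xi m (QW w)) - phi (X w)| <= K * (e' / 2 / (K + 1)).
  apply: lphi; [exact: Cpath_euler|exact: CX|move=> t tN].
  by rewrite distrC; have := close t tN; rewrite le_min => /andP[].
have : K * (e' / 2 / (K + 1)) <= e' / 2.
  by rewrite mulrA ler_pdivrMr ?ltr_wpDl// mulrC ler_wpM2l ?lerDl// ltW// divr_gt0.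
have : 0 <= 4 * B * unit_clamp (pnorm N.+1 (X w) - (r - 4)).
  by rewrite !mulr_ge0// unit_clamp_ge0.
move: sm; move: ((K + 2 * B) * _) (4 * B * _) `|_| (K * _) => a b c k'.
by lra.
Unshelve. all: by end_near. Qed.

End fixed_truncation.

(** Error of the scheme for the fast-slow system, along the sequence [eps]. *)
Lemma slow_error (r : R) : 0 <= r -> exists2 Cst : R, 1 <= Cst & forall m (e : R), 0 < e ->
  \forall k \near \oo,
  \int[mu]_(y in L) `|phi (slow_path g f0 f xi (eps k) y) -
      phi (euler_path (trunc_F Lambda mu f r) xi m (Wn k y))| <=
  \int[mu]_(y in L) error_bound r Cst m (Wn k y) + e.
Proof.
move=> r0; have [Cst Cst1 HC] := slow_close f0 xi cL esys lf uf eps0 eps_cvg N r0.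
exists Cst => // m; set Fr := trunc_F Lambda mu f r.
have rs k : rpath L (slow_path g f0 f xi (eps k)).
  by have := rpath_slow xi cL esys lf0 lf (eps k); apply.
have C0 : 0 <= Cst by exact: le_trans Cst1.
have KB0 : 0 <= K + 2 * B by rewrite addr_ge0// mulr_ge0.
have phi_dist x y : C x -> C y -> `|phi x - phi y| <= 2 * B.
  move=> Cx Cy; rewrite mulr_natl mulr2n (le_trans (ler_normB _ _))//.
  by rewrite lerD ?phiB.
have bu k : bmeas L (fun y => `|phi (slow_path g f0 f xi (eps k) y) -
    phi (euler_path Fr xi m (Wn k y))|).
  apply: bmeas_norm; apply: bmeasB.
    by have := bmeas_plip mL (rs k) lphi phiB.
  have [M lM] := plip_phi_euler r0 m.
  have := bmeas_plip mL (rWn k) lM (B := B).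
  by apply => x Cx; apply: phiB; exact: Cpath_euler.
have bv k : bmeas L (fun y => error_bound r Cst m (Wn k y)).
  have [M lM] := plip_error_bound Cst r0 m.
  have := bmeas_plip mL (rWn k) lM.
  by apply => x Cx; exact: error_bound_bound.
apply: (Rintegral_excess_cvg (B := (K + 2 * B) * (Cst * 2) + 2 * B)) => //.
- by move=> k; case: (bu k).
- by move=> k; case: (bv k).
- move=> k y Ly; rewrite normr_id.
  apply: le_trans (phi_dist _ _ ((rs k).1 y Ly) (@Cpath_euler _ _ Fr xi m _)) _.
  by rewrite lerDr mulr_ge0// mulr_ge0.
- by move=> k y Ly; exact: error_bound_bound.
apply: filterS (HC m) => y HCy Ly e e0; apply: filterS (HCy Ly) => k {}HCy.
have CW : C (Wn k y) by exact: (rWn k).1.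
have CE := @Cpath_euler _ _ Fr xi m (Wn k y).
have Cs : C (slow_path g f0 f xi (eps k) y) by exact: (rs k).1.
apply: ler_wpDr; first exact: ltW.
have hh := h0 m.
have o0 := osc_ge0 m CW.
have u0 := unit_clamp_ge0 (osc m (Wn k y)).
have v0 := unit_clamp_ge0 (pnorm N (euler_path Fr xi m (Wn k y)) - (r - 2)).
have t1 : 0 <= (K + 2 * B) * (Cst * (unit_clamp (osc m (Wn k y)) + m.+1%:R^-1)).
  by rewrite mulr_ge0// mulr_ge0// addr_ge0// ltW.
have t2 : 0 <= 2 * B * unit_clamp (pnorm N (euler_path Fr xi m (Wn k y)) - (r - 2)).
  by rewrite mulr_ge0// mulr_ge0.
(* Where the oscillation or the estimate of [slow_close] exceeds 1, that estimate
   cannot be used, but [error_bound] is at least the trivial bound [2 * B]. *)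
have big : 1 <= Cst * (unit_clamp (osc m (Wn k y)) + m.+1%:R^-1) ->
    2 * B <= error_bound r Cst m (Wn k y).
  move=> big; rewrite /error_bound ler_wpDr//.
  apply: (@le_trans _ _ (K + 2 * B)); first by rewrite lerDr.
  by rewrite ler_peMr.
have [Er|rE] := leP (pnorm N (euler_path Fr xi m (Wn k y))) (r - 1); last first.
  apply: le_trans (phi_dist _ _ Cs CE) _.
  rewrite /error_bound [unit_clamp (_ - _)]unit_clamp1 ?mulr1 ?lerDr//.
  by move: rE; rewrite /Fr; lra.
have [ho|ho] := leP 1 (osc m (Wn k y)).
  apply: le_trans (phi_dist _ _ Cs CE) _; apply: big.
  by rewrite unit_clamp1// mulrC -[leLHS]mulr1 ler_pM ?ler01// lerDl ltW.
have uE : unit_clamp (osc m (Wn k y)) = osc m (Wn k y).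
  by rewrite /unit_clamp min_r ?(ltW ho)// max_r.
have [c1|c1] := leP 1 (Cst * (osc m (Wn k y) + m.+1%:R^-1)).
  by apply: le_trans (phi_dist _ _ Cs CE) _; apply: big; rewrite uE.
have close : forall t : R, 0 <= t <= N%:R ->
    `|slow_path g f0 f xi (eps k) y t - euler_path Fr xi m (Wn k y) t| <=
    Cst * (osc m (Wn k y) + m.+1%:R^-1).
  apply: HCy.
  - move=> s t sN tN st; apply: le_trans (pmod_ub CW sN tN st) _.
    by rewrite lerDl mulr_ge0// ?(ltW hh)//; exact: pnorm_ge0.
  - move=> t tN; rewrite /osc ler_wpDl ?pmod_ge0//.
    by apply: ler_wpM2l (ltW hh) _ _ _; exact: (pnorm_ub CW tN).
  - by move=> t tN; rewrite (le_trans (pnorm_ub CE tN)).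
  - exact: ltW.
apply: le_trans (lphi Cs CE close) _.
rewrite /error_bound uE ler_wpDr// ler_wpM2r//.
  by rewrite mulr_ge0// addr_ge0// ltW.
by rewrite lerDl mulr_ge0.
Qed.

(** Convergence on one functional. The number [r] makes the solution unlikely to
    come close to the truncation radius, then [m] makes the step of the scheme
    small, and both the scheme and its error bound pass to the limit in [k] by the
    invariance principle. *)
Lemma slow_cvg :
  (fun k => \int[mu]_(y in L) phi (slow_path g f0 f xi (eps k) y)) @ \oo -->
    \int[P]_w phi (X w).
Proof.
apply/cvgrPdist_le => dl dl0; pose e := dl / 5.
have e0 : 0 < e by rewrite divr_gt0.
have CX w : C (X w) by exact: rX.1.
have bJ (r : nat) : bmeas setT (fun w => 4 * B * unit_clamp (pnorm N.+1 (X w) - (r%:R - 4))).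
  apply: bmeasZ.
  have lp := plip_comp (@unit_clamp_lip R)
    (plipD (@plip_pnorm R d N.+1) (@plip_cst R d N.+1 (- (r%:R - 4)))).
  have := bmeas_plip measurableT rX lp (B := 1).
  by apply => x Cx; rewrite ger0_norm ?unit_clamp_ge0// unit_clamp_le1.
have : (fun r : nat => \int[P]_w (4 * B * unit_clamp (pnorm N.+1 (X w) - (r%:R - 4))))
    @ \oo --> \int[P]_w (0 : R).
  apply: (bounded_cvg measurableT (B := 4 * B)) => //.
  - by move=> r; case: (bJ r).
  - move=> r w _; rewrite ger0_norm ?mulr_ge0 ?unit_clamp_ge0//.
    by rewrite ler_piMr ?mulr_ge0 ?unit_clamp_le1.
  apply: aeW => w _; apply: (@cvg_near_cst _ _ (0 : R)).
  have : \forall r \near \oo, pnorm N.+1 (X w) + 4 <= r%:R by exact: nbhs_infty_ger.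
  by apply: filterS => r hr; rewrite unit_clamp0 ?mulr0//; move: hr; lra.
rewrite (Rintegral_prob_cst measurableT) => // /cvgrPdist_le/(_ _ e0)[r _ /(_ r (leqnn r))].
rewrite sub0r normrN => /(le_trans (ler_norm _)) Jr.
have [Cst Cst1 slow_err] := slow_error (ler0n R r).
have [m _ /(_ m (leqnn m)) lim_err] := limit_error (ler0n R r) Cst1 e0.
set Fr := trunc_F Lambda mu f r%:R in slow_err lim_err.
have [ME lE] := plip_error_bound Cst (ler0n R r) m.
have [Mp lp] := plip_phi_euler (ler0n R r) m.
have pB w : C w -> `|phi (euler_path Fr xi m w)| <= B.
  by move=> _; apply: phiB; exact: Cpath_euler.
have eB w (_ : C w) := error_bound_bound r%:R Cst1 m w.
have cE := wip_plip lE eB.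
have cp := wip_plip lp pB.
have bX := bmeas_plip measurableT rX lphi phiB.
have bE := bmeas_plip measurableT rQW lp pB.
have bEr := bmeas_plip measurableT rQW lE eB.
have bd := bmeas_norm (bmeasB bE bX).
move: lim_err; rewrite RintegralD//; try exact: bmeas_integrable.
move=> lim_err.
have dE := Rintegral_dist_le P measurableT bE bX bd (fun w _ => lexx _).
move/cvgrPdist_le : cE => /(_ _ e0) cE; move/cvgrPdist_le : cp => /(_ _ e0) cp.
apply: filterS3 (slow_err m e e0) cE cp => k se cEk cpk.
have rs : rpath L (slow_path g f0 f xi (eps k)).
  by have := rpath_slow xi cL esys lf0 lf (eps k); apply.
have bs := bmeas_plip mL rs lphi phiB.
have bW := bmeas_plip mL (rWn k) lp pB.
have sd := Rintegral_dist_le mu mL bs bW (bmeas_norm (bmeasB bs bW)) (fun w _ => lexx _).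
have E5 : dl = e * 5 by rewrite /e divfK.
move: se cEk cpk sd dE lim_err Jr; rewrite E5 /Fr !ler_norml.
do 8 (set uu := Rintegral _ _ _; move: uu => ?).
move=> ? /andP[? ?] /andP[? ?] /andP[? ?] /andP[? ?] ? ?; apply/andP; split; lra.
Qed.

End homogenization.

Theorem theorem1p1 (R : realType) (l d : nat)
  (Lambda : set 'cV[R]_l) (g : 'cV[R]_l -> 'cV[R]_l)
  (mu : probability (borel 'cV[R]_l) R)
  (f0 : 'cV[R]_l -> 'cV[R]_d)
  (f : 'cV[R]_d -> 'cV[R]_l -> R -> 'cV[R]_d)
  (Sigma : 'M[R]_d) (xi : 'cV[R]_d) :
  compact Lambda ->
  ergodic_system Lambda g mu ->
  [locally [lipschitz f0 y | y in Lambda]] ->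
  (forall e : R,
     [locally [lipschitz f p.1 p.2 e | p in [set: 'cV[R]_d] `*` Lambda]]) ->
  (forall K : set ('cV[R]_d * 'cV[R]_l),
     compact K -> K `<=` [set: 'cV[R]_d] `*` Lambda ->
     {uniform K, (fun (e : R) (p : 'cV[R]_d * 'cV[R]_l) => f p.1 p.2 e) @ 0^'
                   --> (fun p : 'cV[R]_d * 'cV[R]_l => f p.1 p.2 0)}) ->
  vintegral mu (Lambda : set (borel 'cV[R]_l)) f0 = 0 ->
  sym_psd Sigma ->
  WIP Lambda g mu f0 Sigma ->
  forall (dO : measure_display) (O : measurableType dO) (P : probability O R)
    (W X : O -> path_space R d),
    brownian_motion P W ->
    sde_solution P (mxsqrt Sigma) (averaged_drift Lambda mu f) xi W X ->
    weak_cvg (Cpath R d) 0^'+ mu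
      (Lambda : set (borel 'cV[R]_l)) (slow_path g f0 f xi) P X.
Proof.
move=> cL esys lf0 lf uf _ _ wip dO O P W X bmW solX phi cphi bphi.
apply: (cvg_at_rightP _ _ _).2 => u [u0 ucvg].
have rs k := rpath_slow xi cL esys lf0 lf (u k).
have rX : rpath setT X.
  by have [[CX mX] _] := solX; split=> // w _; exact: CX.
have mL := measurable_compact cL.
have := portmanteau mL rs rX _ cphi bphi; apply.
move=> psi N K B lpsi psiB.
exact: (slow_cvg cL esys lf0 lf uf wip bmW solX u0 ucvg (normr_ge0 K) (plip_abs lpsi) psiB).
Qed.
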